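(* Suppose (A1)--(A6) of the context hold, $(\hat Q^n_s(0),\hat Z^n_{1,2}(0))\Rightarrow(\hat Q_s(0),\hat Z_{1,2}(0))$ in $\mathbb R^2$, and in addition $x(0)=x^*$ for the stationary point $x^*=(q_1^*,q_2^*,z_{1,2}^* )$ of the context, so that $x$ is stationary. Then the time transformations in the limit process of the context simplify to $\gamma_i(t)=\xi_it$ ($i=1,2,3$), $\gamma_{i,2}(t)=\xi_{i,2}t$ and $\phi_{i,2}(t)=\eta_{i,2}t$ ($i=1,2$), where $$\begin{aligned}\xi_1&\equiv2(\lambda_1+\lambda_2)-\mu_{1,2}z^*_{1,2}-\mu_{2,2}(m_2-z^*_{1,2}),\\ \xi_{1,2}&\equiv\mu_{1,2}\pi_{1,2}(x^* )z^*_{1,2},\qquad \xi_{2,2}\equiv\mu_{2,2}(1-\pi_{1,2}(x^* ))(m_2-z^*_{1,2}),\\ \eta_{1,2}&\equiv\mu_{1,2}(1-\pi_{1,2}(x^* ))z^*_{1,2},\qquad \eta_{2,2}\equiv\mu_{2,2}\pi_{1,2}(x^* )(m_2-z^*_{1,2}),\\ \xi_2&\equiv\psi^2(x^* )\sigma^2(x^* ),\qquad \xi_3\equiv\sigma^2(x^* ),\end{aligned}$$ with $\psi(x^* )=\mu_{2,2}(m_2-z^*_{1,2})+\mu_{1,2}z^*_{1,2}$. Then $(\hat Q_s,\hat Z_{1,2})$ becomes a bivariate Ornstein--Uhlenbeck process, satisfying the two-dimensional stochastic differential equation $$d\mathcal X=\mathcal M\mathcal X\,dt+\mathcal S\,d\mathcal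 B,$$ where $\mathcal X\equiv(\hat Q_s,\hat Z_{1,2})^t$, $\mathcal B\equiv(B_1,B_2)^t$ with $B_1,B_2$ two independent standard Brownian motions, and $$\begin{aligned}\mathcal M_{1,1}&\equiv-(p_1\theta_1+p_2\theta_2),\quad \mathcal M_{1,2}\equiv\mu_{2,2}-\mu_{1,2},\quad \mathcal M_{2,1}\equiv0,\\ \mathcal M_{2,2}&\equiv\frac{-\mu_{1,2}\mu_{2,2}m_2z^*_{1,2}}{\mu_{1,2}z^*_{1,2}+\mu_{2,2}(m_2-z^*_{1,2})}<0,\\ \mathcal S_{1,1}^2&\equiv\xi_1+\xi_{1,2}+\xi_{2,2}+\eta_{1,2}+\eta_{2,2}=2(\lambda_1+\lambda_2),\\ \mathcal S_{1,2}&\equiv\mathcal S_{2,1}\equiv\eta_{1,2}-\eta_{2,2}=0,\qquad \mathcal S_{2,2}^2\equiv\xi_2+\xi_4,\\ \xi_4&\equiv\eta_{1,2}+\eta_{2,2}=\frac{2\mu_{1,2}\mu_{2,2}z^*_{1,2}(m_2-z^*_{1,2})}{\mu_{1,2}z^*_{1,2}+(m_2-z^*_{1,2})\mu_{2,2}}.\end{aligned}$$ As a consequence, $(\hat Q_s(t),\hat Z_{1,2}(t))$ has a bivariate normal distribution with zero means for each $t$. The covariance matrix of the steady-state random vector $(\hat Q_s(\infty),\hat Z_{1,2}(\infty))$ has elements $$\begin{aligned}\sigma^2_{Q_s}(\infty)&\equiv\mathrm{Var}(\hat Q_s(\infty))=\mathcal Q_1+\mathcal Q_2,\quad \mathcal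 Q_1\equiv\frac{\mathcal S_{1,1}^2}{2|\mathcal M_{1,1}|}=\frac{\lambda_1+\lambda_2}{p_1\theta_1+p_2\theta_2},\\ \mathcal Q_2&\equiv\frac{\mathcal M_{1,2}\,\sigma^2_{Q_s,Z_{1,2}}(\infty)}{|\mathcal M_{1,1}|}=\frac{(\mu_{2,2}-\mu_{1,2})\,\sigma^2_{Q_s,Z_{1,2}}(\infty)}{p_1\theta_1+p_2\theta_2},\\ \sigma^2_{Z_{1,2}}(\infty)&\equiv\mathrm{Var}(\hat Z_{1,2}(\infty))=\frac{\mathcal S_{2,2}^2}{2|\mathcal M_{2,2}|}\equiv\mathcal Z_1+\mathcal Z_2,\quad \mathcal Z_1\equiv\frac{\xi_4}{2|\mathcal M_{2,2}|}=1-\frac{z^*_{1,2}}{m_2},\\ \mathcal Z_2&\equiv\frac{\xi_2}{2|\mathcal M_{2,2}|}=\frac{\psi^2(x^* )\sigma^2(x^* )}{2|\mathcal M_{2,2}|},\\ \sigma^2_{Q_s,Z_{1,2}}(\infty)&\equiv\mathrm{Cov}(\hat Q_s(\infty),\hat Z_{1,2}(\infty))=\xi_5\,\sigma^2_{Z_{1,2}}(\infty),\qquad \xi_5\equiv\frac{\mathcal M_{1,2}}{|\mathcal M_{1,1}+\mathcal M_{2,2}|}.\end{aligned}$$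
   Context: Notation. $\mathcal D_k$ is the space of $\mathbb R^k$-valued right-continuous functions with left limits on $[0,\infty)$, with the (product) Skorohod $J_1$ topology; $\Rightarrow$ is convergence in distribution; $M^t$ is the transpose of $M$. Model. For each $n\ge1$ consider a queueing system with two customer classes and two service pools (X model). Class-$i$ customers arrive in a Poisson process of rate $\lambda^n_i$; each class-$i$ customer waiting in queue abandons after an exponential time of rate $\theta_i>0$; pool $j$ has $m^n_j$ servers; class-$i$ service times in pool $j$ are exponential of rate $\mu_{i,j}>0$; all these are mutually independent. $Q^n_i(t)$ is the class-$i$ queue length, $Z^n_{i,j}(t)$ the number of class-$i$ customers in service in pool $j$. Control (FQR-T): with thresholds $k^n_{1,2},k^n_{2,1}>0$ and ratios $r_{1,2}\ge r_{2,1}$, put $D^n_{1,2}=Q^n_1-k^n_{1,2}-r_{1,2}Q^n_2$ and $D^n_{2,1}=r_{2,1}Q^n_2-k^n_{2,1}-Q^n_1$. A newly available pool-2 server at time $t$ takes a class-1 customer if $D^n_{1,2}(t)>0$ and $Z^n_{2,1}(t)=0$, otherwise a class-2 customer; symmetrically, a newly available pool-1 server takes a class-2 customer if $D^n_{2,1}(t)>0$ and $Z^n_{1,2}(t)=0$, otherwise a class-1 customer. Write $r=r_{1,2}$, $p_1=r/(1+r)$, $p_2=1/(1+r)$, $Q^n_s=Q^n_1+Q^n_2$, $X^n=(Q^n_1,Q^n_2,Z^n_{1,2})$, $\bar X^n=X^n/n$. Fast-time-scale process (FTSP). Let $r=a/b$ in lowest terms. For $\gamma=(q_1,q_2,z_{1,2})\in[0,\infty)^2\times[0,m_2]$,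 $D(\gamma,\cdot)$ is the pure-jump Markov process on $b^{-1}\mathbb Z$ with jumps: $+1$ at rate $\lambda_1$ and $-r$ at rate $\lambda_2$ from every state; from states $d>0$: $-1$ at rate $\mu_{1,1}m_1+\theta_1q_1+\mu_{1,2}z_{1,2}+\mu_{2,2}(m_2-z_{1,2})$ and $+r$ at rate $\theta_2q_2$; from states $d\le0$: $-1$ at rate $\mu_{1,1}m_1+\theta_1q_1$ and $+r$ at rate $\mu_{1,2}z_{1,2}+\mu_{2,2}(m_2-z_{1,2})+\theta_2q_2$ (rates of coinciding jumps add). $\mathbb A$ is the set of $\gamma$ with $q_1=rq_2$ for which $D(\gamma,\cdot)$ is positive recurrent; $D(\gamma,\infty)$ has its stationary law, $\pi_{1,2}(\gamma)=P(D(\gamma,\infty)>0)\in(0,1)$, and $\sigma^2(\gamma)=\lim_{t\to\infty}t^{-1}\mathrm{Var}\big(\int_0^t1_{\{D(\gamma,s)>0\}}ds\big)$. Fluid limit. $x=(q_1,q_2,z_{1,2})$ is the unique solution, with initial value $x(0)$, of $\dot q_1=\lambda_1-m_1\mu_{1,1}-\pi_{1,2}(x)[z_{1,2}\mu_{1,2}+z_{2,2}\mu_{2,2}]-\theta_1q_1$, $\dot q_2=\lambda_2-(1-\pi_{1,2}(x))[z_{2,2}\mu_{2,2}+z_{1,2}\mu_{1,2}]-\theta_2q_2$, $\dot z_{1,2}=\pi_{1,2}(x)z_{2,2}\mu_{2,2}-(1-\pi_{1,2}(x))z_{1,2}\mu_{1,2}$, with $z_{2,2}=m_2-z_{1,2}$.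 Put $q_s=q_1+q_2$. Its unique stationary point is $x^*=(q_1^*,q_2^*,z_{1,2}^* )$ with $z^*_{1,2}=\frac{\theta_2(\lambda_1-m_1\mu_{1,1})-r\theta_1(\lambda_2-m_2\mu_{2,2})}{r\theta_1\mu_{2,2}+\theta_2\mu_{1,2}}\wedge m_2$, $q_1^*=(\lambda_1-m_1\mu_{1,1}-\mu_{1,2}z^*_{1,2})/\theta_1$, $q_2^*=(\lambda_2-\mu_{2,2}(m_2-z^*_{1,2}))/\theta_2$, and $\pi_{1,2}(x^* )=\mu_{1,2}z^*_{1,2}/(\mu_{1,2}z^*_{1,2}+(m_2-z^*_{1,2})\mu_{2,2})$. Assumptions. (A1) For some $\lambda_i,m_i>0$: $(\lambda^n_i-n\lambda_i)/\sqrt n\to0$ and $(m^n_i-nm_i)/\sqrt n\to0$, $i=1,2$. (A2) With $\rho_i=\lambda_i/(m_i\mu_{i,i})$ and $q^a_i=(\lambda_i-\mu_{i,i}m_i)^+/\theta_i$: $\theta_1q^a_1>\mu_{1,2}m_2(1-\rho_2)^+$ and $q^a_1>r_{1,2}q^a_2$. (A3) There are $c_n>0$ with $c_n/n\to0$, $c_n/\sqrt n\to\infty$, and $k_{1,2},k_{2,1}>0$ with $k^n_{1,2}/c_n\to k_{1,2}$, $k^n_{2,1}/c_n\to k_{2,1}$. (A4) $r_{1,2},r_{2,1}$ are positive rationals. (A5) $P(Z^n_{2,1}(0)=0,\ Q^n_i(0)>a_n,\ i=1,2)=1$ for all $n$, where $a_n/c_n\to a\in(0,\infty]$; $\bar X^n(0)\Rightarrow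 x(0)\in\mathbb A$ with $x(0)$ deterministic; $D^n_{1,2}(0)\Rightarrow L$ for a finite random variable $L$. (A6) $x(t)\in\mathbb A$ for all $t\ge0$. Scaled processes and limit process. $\hat Q^n_s=(Q^n_s-nq_s)/\sqrt n$, $\hat Z^n_{1,2}=(Z^n_{1,2}-nz_{1,2})/\sqrt n$. $(\hat Q_s,\hat Z_{1,2})$ denotes the limit in distribution in $\mathcal D_2$ of $(\hat Q^n_s,\hat Z^n_{1,2})$ given by the paper's FCLT: the unique solution of $\hat Q_s(t)=\hat Q_s(0)+(\mu_{2,2}-\mu_{1,2})\int_0^t\hat Z_{1,2}ds-(p_1\theta_1+p_2\theta_2)\int_0^t\hat Q_sds+B_1(\gamma_1(t))-B_{1,2}(\phi_{1,2}(t))-B_{1,3}(\gamma_{1,2}(t))-B_{2,2}(\phi_{2,2}(t))-B_{2,3}(\gamma_{2,2}(t))$, $\hat Z_{1,2}(t)=\hat Z_{1,2}(0)-\int_0^t[(\mu_{2,2}-\mu_{1,2})\pi_{1,2}(x(s))+\mu_{1,2}]\hat Z_{1,2}(s)ds-B_{1,2}(\phi_{1,2}(t))+B_{2,2}(\phi_{2,2}(t))+B_2(\gamma_2(t))$, with $B_1,B_{1,2},B_{2,2},B_{1,3},B_{2,3},B_2$ independent standard Brownian motions and $\gamma_1(t)=(\lambda_1+\lambda_2+m_1\mu_{1,1})t+(p_1\theta_1+p_2\theta_2)\int_0^tq_s(u)du$, $\phi_{1,2}(t)=\mu_{1,2}\int_0^t(1-\pi_{1,2}(x(u)))z_{1,2}(u)du$,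 $\phi_{2,2}(t)=\mu_{2,2}\int_0^t\pi_{1,2}(x(u))(m_2-z_{1,2}(u))du$, $\gamma_{1,2}(t)=\mu_{1,2}\int_0^t\pi_{1,2}(x(u))z_{1,2}(u)du$, $\gamma_{2,2}(t)=\mu_{2,2}\int_0^t(1-\pi_{1,2}(x(u)))(m_2-z_{1,2}(u))du$, $\gamma_2(t)=\int_0^t\psi^2(x(u))\sigma^2(x(u))du$, $\psi(x(u))=\mu_{2,2}(m_2-z_{1,2}(u))+\mu_{1,2}z_{1,2}(u)$, and $\gamma_3(t)=\int_0^t\sigma^2(x(u))du$ (the time change of the limit $\hat I=B_2\circ\gamma_3$ of $\hat I^n(t)=\sqrt n\int_0^t(1_{\{D^n_{1,2}(s)>0\}}-\pi_{1,2}(x(s)))ds$).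
   Formalization: The factor z* in the numerator of M_{2,2} is removed, so Z_1 = z*(1 - z*/m_2); normality with zero means for each t is stated for centered normal initial vectors, and in general for X(t) - e^{tM}X(0), which is independent of X(0). *)

(* Defs.v *)
From HB Require Import structures.
From mathcomp Require Import all_boot all_order all_algebra.
From mathcomp Require Import all_classical all_reals all_analysis.

Set Implicit Arguments.
Unset Strict Implicit.
Unset Printing Implicit Defensive.

Import Order.TTheory GRing.Theory Num.Theory.
Import numFieldNormedType.Exports.

Local Open Scope classical_set_scope.
Local Open Scope ring_scope.

Section Probability.
Context {R : realType}.

(* Convergence in distribution tested against a class [test] of functionals:
   bounded continuous functions on a topological space, or bounded
   J1-continuous functionals on path space.  Every X i, and the limit, may live
   on its own probability space. *)
Definition cvg_law_for (T : Type) (test : set (T -> R))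
    (I : Type) (F : set_system I) (d : I -> measure_display)
    (Om : forall i, measurableType (d i)) (P : forall i, probability (Om i) R)
    (X : forall i, Om i -> T)
    (d' : measure_display) (Om' : measurableType d') (P' : probability Om' R)
    (Y : Om' -> T) : Prop :=
  forall f : T -> R, test f ->
    ('E_(P i)[fun w => f (X i w)])%E @[i --> F] --> ('E_P'[fun w => f (Y w)])%E.

Definition bounded_continuous (T : topologicalType) : set (T -> R) :=
  [set f | continuous f /\ exists K : R, forall y, `|f y| <= K].

Definition cadlag (f : R -> R) : Prop :=
  (forall t, 0 <= t -> f s @[s --> t^'+] --> f t) /\
  (forall t, 0 < t -> cvg (f s @[s --> t^'-])).

Definition time_change (l : R -> R) : Prop :=
  [/\ l 0 = 0,
      (forall s t, 0 <= s -> s < t -> l s < l t),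
      {within `[0, +oo[, continuous l}
    & (forall y, 0 <= y -> exists2 t, 0 <= t & l t = y)].

(* J1 convergence of sequences in the Skorohod space of paths on [0, +oo[;
   paths are functions on R of which only the restriction to [0, +oo[ matters *)
Definition J1_cvg (f : nat -> R -> R) (g : R -> R) : Prop :=
  exists l : nat -> R -> R, (forall n, time_change (l n)) /\
    forall T e : R, 0 < T -> 0 < e -> \forall n \near \oo,
      forall t, 0 <= t <= T -> `|l n t - t| < e /\ `|f n (l n t) - g t| < e.

(* The J1 topology is metrizable, hence so is the product topology on pairs of
   paths, and its continuous functionals are the sequentially continuous ones.
   In the product topology each coordinate has its own time change. *)
Definition bounded_J1_continuous2 : set ((R -> R) * (R -> R) -> R) :=
  [set F | (exists K : R, forall y, `|F y| <= K) /\
    forall (f1 f2 : nat -> R -> R) (g1 g2 : R -> R),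
      (forall n, cadlag (f1 n) /\ cadlag (f2 n)) -> cadlag g1 -> cadlag g2 ->
      J1_cvg f1 g1 -> J1_cvg f2 g2 ->
      F (f1 n, f2 n) @[n --> \oo] --> F (g1, g2)].

Section OneSpace.
Context {d : measure_display} {Om : measurableType d} (P : probability Om R).

(* The library's [normal_prob m 0] is a uniform law, so the degenerate normal
   law is given explicitly as a Dirac mass. *)
Definition centered_normal (X : Om -> R) (v : R) : Prop :=
  [/\ 0 <= v, measurable_fun setT X
    & forall A : set R, measurable A ->
        P (X @^-1` A) =
        if v == 0 then (\d_(0%R : R) A)%E else normal_prob 0 (Num.sqrt v) A].

Definition centered_binormal (X Y : Om -> R) : Prop :=
  forall a b : R, exists v, centered_normal (fun w => a * X w + b * Y w) v.

Definition process_sigma (W : R -> Om -> R) : set (set Om) :=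
  <<s [set E | exists t (A : set R),
                 [/\ 0 <= t, measurable A & E = W t @^-1` A] ]>>.

Definition pair_sigma (X Y : Om -> R) : set (set Om) :=
  <<s [set E | exists2 A : set R, measurable A
                 & E = X @^-1` A \/ E = Y @^-1` A] >>.

(* The members of s are meant to be sigma-algebras; as these contain [setT], the
   product rule for the whole list gives it for every sublist. *)
Definition mutually_independent (s : seq (set (set Om))) : Prop :=
  forall E : nat -> set Om,
    (forall i, (i < size s)%N -> nth set0 s i (E i)) ->
    P (\big[setI/setT]_(i < size s) E i) =
    (\prod_(i < size s) fine (P (E i)))%:E.

Definition standard_brownian (W : R -> Om -> R) : Prop :=
  [/\ (forall w, W 0 w = 0),
      (forall w, {within `[0, +oo[, continuous (fun t => W t w)}),
      (forall t, 0 <= t -> measurable_fun setT (W t)),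
      (forall s t, 0 <= s -> s < t ->
         centered_normal (fun w => W t w - W s w) (t - s))
    & (forall (n : nat) (t : nat -> R) (A : nat -> set R),
         0 <= t 0%N -> (forall i, t i <= t i.+1) ->
         (forall i, measurable (A i)) ->
         P (\big[setI/setT]_(i < n) [set w | A i (W (t i.+1) w - W (t i) w)]) =
         (\prod_(i < n) fine (P [set w | A i (W (t i.+1) w - W (t i) w)]))%:E)].

(* dX = M X dt + S dB in integrated form; as S is constant, the stochastic
   integral is S B(t). *)
Definition linear_sde (k : nat) (M S : 'M[R]_k) (X B : R -> Om -> 'cV[R]_k) :
    Prop :=
  {ae P, forall w, forall t, 0 <= t -> forall i,
     X t w i 0 = X 0 w i 0
       + (\int[lebesgue_measure]_(s in `[0, t]) ((M *m X s w) i 0))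
       + (S *m B t w) i 0}.

End OneSpace.

End Probability.

Section JumpProcess.
Context {R : realType} {S : choiceType}.

(* [jumps x] lists the possible transitions out of x as pairs (rate, target);
   the rates of pairs with the same target add up. *)
Variable jumps : S -> seq (R * S).

(* Honest solution of the Kolmogorov backward equation started at the
   identity; it is the transition function when the chain is non-explosive. *)
Definition transition_function (p : R -> S -> S -> R) : Prop :=
  [/\ (forall t x y, 0 <= t -> 0 <= p t x y),
      (forall t x, 0 <= t -> (\esum_(y in [set: S]) (p t x y)%:E = 1)%E),
      (forall x y, p 0 x y = (x == y)%:R),
      (forall x y, p t x y @[t --> 0^'+] --> p 0 x y)
    & (forall (t : R) x y, 0 < t ->
         is_derive t 1 (fun u : R => p u x y)
           (\sum_(j <- jumps x) j.1 * (p t j.2 y - p t x y)))].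

Definition jump_path (f : R -> S) : Prop :=
  (forall t, 0 <= t -> \forall s \near t^'+, f s = f t) /\
  (forall t, 0 < t -> exists y, \forall s \near t^'-, f s = y).

Definition jump_markov {d : measure_display} {Om : measurableType d}
    (P : probability Om R) (X : R -> Om -> S) : Prop :=
  [/\ (forall t x, 0 <= t -> measurable [set w | X t w = x]),
      (forall w, jump_path (fun t => X t w))
    & exists2 p, transition_function p
      & forall (n : nat) (t : nat -> R) (x : nat -> S),
          0 <= t 0%N -> (forall i, t i <= t i.+1) ->
          P (\big[setI/setT]_(i < n.+2) [set w | X (t i) w = x i]) =
          (P (\big[setI/setT]_(i < n.+1) [set w | X (t i) w = x i])
            * (p (t n.+1 - t n) (x n) (x n.+1))%:E)%E].

Definition return_time {Om : Type} (X : R -> Om -> S) (x : S) (w : Om) :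
    \bar R :=
  ereal_inf [set t%:E | t in
    [set t | [/\ 0 <= t, X t w = x
               & exists2 s, 0 <= s <= t & X s w <> x] ] ].

Definition positive_recurrent : Prop :=
  forall x : S,
    exists (d : measure_display) (Om : measurableType d)
           (P : probability Om R) (X : R -> Om -> S),
      [/\ jump_markov P X, (forall w, X 0 w = x)
        & (\int[P]_w return_time X x w < +oo)%E].

Definition stationary_law (nu : S -> R) : Prop :=
  [/\ (forall x, 0 <= nu x),
      (\esum_(x in [set: S]) (nu x)%:E = 1)%E
    & exists2 p, transition_function p
      & forall t y, 0 <= t ->
          (\esum_(x in [set: S]) (nu x * p t x y)%:E = (nu y)%:E)%E].

Definition occupation_time {Om : Type} (X : R -> Om -> S) (U : pred S)
    (t : R) (w : Om) : R :=
  \int[lebesgue_measure]_(s in `[0, t]) (U (X s w))%:R.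

(* v is the limit of Var(int_0^t 1_{X(s) in U} ds) / t for the version of the
   chain with stationary law nu. *)
Definition occupation_variance (nu : S -> R) (U : pred S) (v : R) : Prop :=
  exists (d : measure_display) (Om : measurableType d)
         (P : probability Om R) (X : R -> Om -> S),
    [/\ jump_markov P X,
        (forall x, P [set w | X 0 w = x] = (nu x)%:E)
      & ((t^-1)%:E * 'V_P[occupation_time X U t])%E @[t --> +oo] --> v%:E].

End JumpProcess.

Section XModel.
Context {R : realType}.

(* Index ij refers to class i and pool j. *)
Record xparams : Type := XParams {
  lam1 : R; lam2 : R;
  m1 : R; m2 : R;
  mu11 : R; mu12 : R; mu21 : R; mu22 : R;
  th1 : R; th2 : R;
  r12 : rat; r21 : rat }.

Record xsystem : Type := XSystem {
  slam1 : R; slam2 : R;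
  sm1 : nat; sm2 : nat;
  sk12 : R; sk21 : R }.

Definition rates_positive (p : xparams) : Prop :=
  [/\ 0 < mu11 p, 0 < mu12 p, 0 < mu21 p & 0 < mu22 p] /\
  (0 < th1 p /\ 0 < th2 p).

Definition system_positive (s : xsystem) : Prop :=
  [/\ 0 < slam1 s, 0 < slam2 s, 0 < sk12 s & 0 < sk21 s].

(* (Q_1, Q_2, Z_11, Z_12, Z_21, Z_22) *)
Definition xstate : Type := (nat * nat * nat * nat * nat * nat)%type.

Definition xQ1 (s : xstate) : nat := let '(a, _, _, _, _, _) := s in a.
Definition xQ2 (s : xstate) : nat := let '(_, a, _, _, _, _) := s in a.
Definition xZ12 (s : xstate) : nat := let '(_, _, _, a, _, _) := s in a.
Definition xZ21 (s : xstate) : nat := let '(_, _, _, _, a, _) := s in a.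

Definition D12 (p : xparams) (sy : xsystem) (s : xstate) : R :=
  (xQ1 s)%:R - sk12 sy - ratr (r12 p) * (xQ2 s)%:R.
Definition D21 (p : xparams) (sy : xsystem) (s : xstate) : R :=
  ratr (r21 p) * (xQ2 s)%:R - sk21 sy - (xQ1 s)%:R.

(* State after a server that has just become free in pool 1 (resp. 2) has
   applied the control.  The server idles when the class assigned to it has an
   empty queue; for the other pool's class this cannot happen, since D21 > 0
   forces Q_2 > 0 and D12 > 0 forces Q_1 > 0. *)
Definition release1 (p : xparams) (sy : xsystem) (s : xstate) : xstate :=
  let '(q1, q2, z11, z12, z21, z22) := s in
  if (0 < D21 p sy s) && (z12 == 0%N)
  then (q1, q2.-1, z11, z12, z21.+1, z22)
  else if (0 < q1)%N then (q1.-1, q2, z11.+1, z12, z21, z22) else s.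

Definition release2 (p : xparams) (sy : xsystem) (s : xstate) : xstate :=
  let '(q1, q2, z11, z12, z21, z22) := s in
  if (0 < D12 p sy s) && (z21 == 0%N)
  then (q1.-1, q2, z11, z12.+1, z21, z22)
  else if (0 < q2)%N then (q1, q2.-1, z11, z12, z21, z22.+1) else s.

(* An arriving customer enters its own pool if a server is free there and
   queues otherwise. *)
Definition xjumps (p : xparams) (sy : xsystem) (s : xstate) :
    seq (R * xstate) :=
  let '(q1, q2, z11, z12, z21, z22) := s in
  [:: (slam1 sy, if (z11 + z21 < sm1 sy)%N
                 then (q1, q2, z11.+1, z12, z21, z22)
                 else (q1.+1, q2, z11, z12, z21, z22));
      (slam2 sy, if (z12 + z22 < sm2 sy)%N
                 then (q1, q2, z11, z12, z21, z22.+1)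
                 else (q1, q2.+1, z11, z12, z21, z22));
      (th1 p * q1%:R, (q1.-1, q2, z11, z12, z21, z22));
      (th2 p * q2%:R, (q1, q2.-1, z11, z12, z21, z22));
      (mu11 p * z11%:R, release1 p sy (q1, q2, z11.-1, z12, z21, z22));
      (mu21 p * z21%:R, release1 p sy (q1, q2, z11, z12, z21.-1, z22));
      (mu12 p * z12%:R, release2 p sy (q1, q2, z11, z12.-1, z21, z22));
      (mu22 p * z22%:R, release2 p sy (q1, q2, z11, z12, z21, z22.-1))].

(* Invariant under [xjumps]. *)
Definition admissible (sy : xsystem) (s : xstate) : Prop :=
  let '(q1, q2, z11, z12, z21, z22) := s in
  [/\ (z11 + z21 <= sm1 sy)%N, (z12 + z22 <= sm2 sy)%N,
      ((0 < q1)%N -> (z11 + z21)%N = sm1 sy)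
    & ((0 < q2)%N -> (z12 + z22)%N = sm2 sy)].

Definition xmodel (p : xparams) (sy : xsystem) {d : measure_display}
    {Om : measurableType d} (P : probability Om R) (X : R -> Om -> xstate) :
    Prop :=
  jump_markov (xjumps p sy) P X /\ forall w, admissible sy (X 0 w).

(* Fluid state (q_1, q_2, z_12). *)
Definition fstate : Type := (R * R * R)%type.
Definition fq1 (g : fstate) : R := g.1.1.
Definition fq2 (g : fstate) : R := g.1.2.
Definition fz (g : fstate) : R := g.2.
Definition fqs (g : fstate) : R := fq1 g + fq2 g.

Section Fluid.
Variable p : xparams.

Definition rr : R := ratr (r12 p).
Definition p1 : R := rr / (1 + rr).
Definition p2 : R := 1 / (1 + rr).

Definition pool2_rate (g : fstate) : R :=
  mu12 p * fz g + mu22 p * (m2 p - fz g).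

(* With r = a/b in lowest terms, the point d of b^-1 Z is encoded by the integer
   k = b d: the jumps 1 and r become b and a. *)
Definition ftsp_jumps (g : fstate) (k : int) : seq (R * int) :=
  let a := numq (r12 p) in let b := denq (r12 p) in
  if (0 < k) then
    [:: (lam1 p, k + b); (lam2 p, k - a);
        (mu11 p * m1 p + th1 p * fq1 g + pool2_rate g, k - b);
        (th2 p * fq2 g, k + a)]
  else
    [:: (lam1 p, k + b); (lam2 p, k - a);
        (mu11 p * m1 p + th1 p * fq1 g, k - b);
        (pool2_rate g + th2 p * fq2 g, k + a)].

Definition bbA : set fstate :=
  [set g | [/\ 0 <= fq1 g, 0 <= fq2 g, 0 <= fz g <= m2 p, fq1 g = rr * fq2 g
             & positive_recurrent (ftsp_jumps g)] ].

(* nu g is the law of D(g, oo). *)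
Definition ftsp_pi (nu : fstate -> int -> R) (g : fstate) : R :=
  fine (\esum_(k in [set k : int | (0 < k)%R]) (nu g k)%:E)%E.

Definition ftsp_variance (nu : fstate -> int -> R) (g : fstate) (v : R) :
    Prop :=
  occupation_variance (ftsp_jumps g) (nu g) (fun k : int => 0 < k) v.

Variables (pi12 : fstate -> R) (sig2 : fstate -> R).

Definition fluid_solution (x0 : fstate) (x : R -> fstate) : Prop :=
  x 0 = x0 /\
  [/\ {within `[0, +oo[, continuous (fun t => fq1 (x t))},
      {within `[0, +oo[, continuous (fun t => fq2 (x t))}
    & {within `[0, +oo[, continuous (fun t => fz (x t))}] /\
  forall t : R, 0 < t ->
  [/\ is_derive t 1 (fun s : R => fq1 (x s))
        (lam1 p - m1 p * mu11 p
         - pi12 (x t) * (fz (x t) * mu12 p + (m2 p - fz (x t)) * mu22 p)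
         - th1 p * fq1 (x t)),
      is_derive t 1 (fun s : R => fq2 (x s))
        (lam2 p
         - (1 - pi12 (x t)) * ((m2 p - fz (x t)) * mu22 p + fz (x t) * mu12 p)
         - th2 p * fq2 (x t))
    & is_derive t 1 (fun s : R => fz (x s))
        (pi12 (x t) * (m2 p - fz (x t)) * mu22 p
         - (1 - pi12 (x t)) * fz (x t) * mu12 p)].

Definition zstar : R :=
  Num.min ((th2 p * (lam1 p - m1 p * mu11 p)
            - rr * th1 p * (lam2 p - m2 p * mu22 p))
           / (rr * th1 p * mu22 p + th2 p * mu12 p)) (m2 p).
Definition q1star : R := (lam1 p - m1 p * mu11 p - mu12 p * zstar) / th1 p.
Definition q2star : R := (lam2 p - mu22 p * (m2 p - zstar)) / th2 p.
Definition xstar : fstate := (q1star, q2star, zstar).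

Section TimeChanges.
Variable x : R -> fstate.
Local Notation "'integral0' t f" :=
  (Rintegral lebesgue_measure `[0, t]%classic f)
  (at level 10, t at next level, f at next level).

Definition gamma1 (t : R) : R :=
  (lam1 p + lam2 p + m1 p * mu11 p) * t
  + (p1 * th1 p + p2 * th2 p) * integral0 t (fun u => fqs (x u)).
Definition phi12 (t : R) : R :=
  mu12 p * integral0 t (fun u => (1 - pi12 (x u)) * fz (x u)).
Definition phi22 (t : R) : R :=
  mu22 p * integral0 t (fun u => pi12 (x u) * (m2 p - fz (x u))).
Definition gamma12 (t : R) : R :=
  mu12 p * integral0 t (fun u => pi12 (x u) * fz (x u)).
Definition gamma22 (t : R) : R :=
  mu22 p * integral0 t (fun u => (1 - pi12 (x u)) * (m2 p - fz (x u))).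
Definition psi (g : fstate) : R := mu22 p * (m2 p - fz g) + mu12 p * fz g.
Definition gamma2 (t : R) : R :=
  integral0 t (fun u => psi (x u) ^+ 2 * sig2 (x u)).
Definition gamma3 (t : R) : R := integral0 t (fun u => sig2 (x u)).

Definition limit_equations {d : measure_display} {Om : measurableType d}
    (P : probability Om R) (B1 B12 B22 B13 B23 B2 Q Z : R -> Om -> R) : Prop :=
  {ae P, forall w, forall t, 0 <= t ->
    Q t w = Q 0 w + (mu22 p - mu12 p) * integral0 t (fun s => Z s w)
            - (p1 * th1 p + p2 * th2 p) * integral0 t (fun s => Q s w)
            + B1 (gamma1 t) w - B12 (phi12 t) w - B13 (gamma12 t) w
            - B22 (phi22 t) w - B23 (gamma22 t) w
    /\
    Z t w = Z 0 w
            - integral0 t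
                (fun s => ((mu22 p - mu12 p) * pi12 (x s) + mu12 p) * Z s w)
            - B12 (phi12 t) w + B22 (phi22 t) w + B2 (gamma2 t) w}.

End TimeChanges.

Definition xi1 : R :=
  2 * (lam1 p + lam2 p) - mu12 p * zstar - mu22 p * (m2 p - zstar).
Definition xi12 : R := mu12 p * pi12 xstar * zstar.
Definition xi22 : R := mu22 p * (1 - pi12 xstar) * (m2 p - zstar).
Definition eta12 : R := mu12 p * (1 - pi12 xstar) * zstar.
Definition eta22 : R := mu22 p * pi12 xstar * (m2 p - zstar).
Definition xi2 : R := psi xstar ^+ 2 * sig2 xstar.
Definition xi3 : R := sig2 xstar.
Definition xi4 : R := eta12 + eta22.

(* M22 is the drift coefficient - ((mu22 - mu12) pi12 + mu12) of the second
   limit equation at xstar, where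
   pi12 xstar = mu12 zstar / (mu12 zstar + mu22 (m2 - zstar)); its numerator has
   no factor zstar. *)
Definition M11 : R := - (p1 * th1 p + p2 * th2 p).
Definition M12 : R := mu22 p - mu12 p.
Definition M21 : R := 0.
Definition M22 : R :=
  - (mu12 p * mu22 p * m2 p) / (mu12 p * zstar + mu22 p * (m2 p - zstar)).

Definition S11 : R := Num.sqrt (xi1 + xi12 + xi22 + eta12 + eta22).
Definition S12 : R := eta12 - eta22.
Definition S21 : R := eta12 - eta22.
Definition S22 : R := Num.sqrt (xi2 + xi4).

Definition mx2 (a b c d : R) : 'M[R]_2 :=
  \matrix_(i < 2, j < 2)
    if i == 0 then (if j == 0 then a else b) else (if j == 0 then c else d).
Definition col2 (a b : R) : 'cV[R]_2 := \col_(i < 2) if i == 0 then a else b.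

Definition calM : 'M[R]_2 := mx2 M11 M12 M21 M22.
Definition calS : 'M[R]_2 := mx2 S11 S12 S21 S22.

Definition xi5 : R := M12 / `|M11 + M22|.
Definition calZ1 : R := xi4 / (2 * `|M22|).
Definition calZ2 : R := xi2 / (2 * `|M22|).
Definition varZ : R := S22 ^+ 2 / (2 * `|M22|).
Definition covQZ : R := xi5 * varZ.
Definition calQ1 : R := S11 ^+ 2 / (2 * `|M11|).
Definition calQ2 : R := M12 * covQZ / `|M11|.

End Fluid.

Definition assumption1 (p : xparams) (sy : nat -> xsystem) : Prop :=
  [/\ 0 < lam1 p, 0 < lam2 p, 0 < m1 p & 0 < m2 p] /\
  [/\ (slam1 (sy n) - n%:R * lam1 p) / Num.sqrt n%:R @[n --> \oo] --> (0 : R),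
      (slam2 (sy n) - n%:R * lam2 p) / Num.sqrt n%:R @[n --> \oo] --> (0 : R),
      ((sm1 (sy n))%:R - n%:R * m1 p) / Num.sqrt n%:R @[n --> \oo] --> (0 : R)
    & ((sm2 (sy n))%:R - n%:R * m2 p) / Num.sqrt n%:R @[n --> \oo] --> (0 : R)].

Definition assumption2 (p : xparams) : Prop :=
  let rho2 := lam2 p / (m2 p * mu22 p) in
  let qa1 := Num.max (lam1 p - mu11 p * m1 p) 0 / th1 p in
  let qa2 := Num.max (lam2 p - mu22 p * m2 p) 0 / th2 p in
  mu12 p * m2 p * Num.max (1 - rho2) 0 < th1 p * qa1 /\
  ratr (r12 p) * qa2 < qa1.

Definition assumption3 (sy : nat -> xsystem) (c : nat -> R) : Prop :=
  [/\ (forall n, 0 < c n),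
      c n / n%:R @[n --> \oo] --> (0 : R),
      c n / Num.sqrt n%:R @[n --> \oo] --> +oo
    & exists k12 k21 : R,
      [/\ 0 < k12, 0 < k21,
          sk12 (sy n) / c n @[n --> \oo] --> k12
        & sk21 (sy n) / c n @[n --> \oo] --> k21] ].

Definition assumption4 (p : xparams) : Prop :=
  [/\ 0 < r12 p, 0 < r21 p & r21 p <= r12 p].

Section Sequence.
Variables (p : xparams) (sy : nat -> xsystem)
  (dn : nat -> measure_display) (On : forall n, measurableType (dn n))
  (Pn : forall n, probability (On n) R)
  (X : forall n, R -> On n -> xstate).

Definition barX (n : nat) (t : R) (w : On n) : fstate :=
  ((xQ1 (X t w))%:R / n%:R, (xQ2 (X t w))%:R / n%:R, (xZ12 (X t w))%:R / n%:R).

Definition hatQs (x : R -> fstate) (n : nat) (t : R) (w : On n) : R :=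
  ((xQ1 (X t w) + xQ2 (X t w))%:R - n%:R * fqs (x t)) / Num.sqrt n%:R.

Definition hatZ (x : R -> fstate) (n : nat) (t : R) (w : On n) : R :=
  ((xZ12 (X t w))%:R - n%:R * fz (x t)) / Num.sqrt n%:R.

(* x0 and L are random elements of an arbitrary auxiliary space, used only
   through their laws. *)
Definition assumption5 (c : nat -> R) (x0 : fstate) {d : measure_display}
    {Om : measurableType d} (P : probability Om R) : Prop :=
  [/\ exists2 a : nat -> R,
        (exists2 l : \bar R, (0 < l)%E & (a n / c n)%:E @[n --> \oo] --> l)
        & forall n, (0 < n)%N ->
            Pn n [set w | [/\ xZ21 (X 0 w) = 0%N, a n < (xQ1 (X 0 w))%:R
                            & a n < (xQ2 (X 0 w))%:R] ] = 1%E,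
      cvg_law_for (@bounded_continuous R fstate) \oo Pn
        (fun n => @barX n 0) P (cst x0),
      bbA p x0
    & exists2 L : Om -> R, measurable_fun setT L
      & cvg_law_for (@bounded_continuous R R) \oo Pn
          (fun n w => D12 p (sy n) (X 0 w)) P L].

End Sequence.

Definition assumption6 (p : xparams) (x : R -> fstate) : Prop :=
  forall t, 0 <= t -> bbA p (x t).

End XModel.

Arguments xparams : clear implicits.
Arguments xsystem : clear implicits.
Arguments fstate : clear implicits.
Arguments barX {R dn On} X n t w.
Arguments hatQs {R dn On} X x n t w.
Arguments hatZ {R dn On} X x n t w.

(* Main.v *)
Require Import Defs.
From HB Require Import structures.
From mathcomp Require Import all_boot all_order all_algebra.
From mathcomp Require Import all_classical all_reals all_analysis.
From mathcomp Require Import measurable_realfun zify ring lra.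
Import Order.TTheory GRing.Theory Num.Theory.
Import numFieldNormedType.Exports.
Local Open Scope classical_set_scope.
Local Open Scope ring_scope.

Set Implicit Arguments.
Unset Strict Implicit.

(**
The corollary rests on one identity for the fast chain at the stationary point.
A stationary law makes the mean drift of the chain vanish; at [xstar] the drift
takes one value on the positive states and another one on the remaining states,
so that its mean vanishes exactly when
   pi12 * mu22 * (m2 - z) = (1 - pi12) * mu12 * z      ([drift_zero], [pi_balance]).
Hence [xstar] is a rest point of the fluid equation, the fluid limit is constant
by uniqueness, and all the time changes are linear. The same identity says that
eta12 = eta22. It also gives z < m2: otherwise pi12 would be 1, and a stationary
law without mass on the nonpositive states has no mass at all ([zstar_lt]).

The six Brownian terms enter the limit equations through two linear
combinations. Combinations of independent Brownian motions with orthogonal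
normalized coefficients are again independent Brownian motions ([mix_brownian],
[mix_indep]); this is the rotation invariance of the Gaussian plane
([gauss_rotation]), applied to increments along grids. The two combinations are
orthogonal because eta12 = eta22, and they are the driving pair of the stochastic
differential equation ([six_noises]).

The equation is solved path by path. Its matrix S is constant, so the noise term
is S B(t); with Phi(t) = exp(t M) and the grid s_i = i t / n, telescoping and the
semigroup law of Phi show that
   X(t) - Phi(t) X(0) = lim_n sum_(i < n) Phi(t - s_(i+1)) S (B(s_(i+1)) - B(s_i))
([path_limit]). Every sum is a linear image of independent normal variables that
are independent of X(0), hence a centered normal pair ([gauss_sums]). Its covariance is
a Riemann sum, with limit Sigma - Phi Sigma Phi^T, where Sigma solves the
Lyapunov equation M Sigma + Sigma M^T + S S^T = 0 ([convolution_variances]).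
Laws pass to the limit when they are tested against bounded continuous functions
([same_law_limit]); this yields the law of X(t) - Phi(t) X(0) together with its
independence of X(0) ([noise_law]), and thus the normality of the marginals.

As t tends to infinity, Phi(t) tends to 0, so that X(t) converges in law to the
centered normal law of covariance Sigma, for any initial law ([steady_cvg]).
The limit is unique, and the entries of Sigma are the announced covariances
([steady_unique], [lyapunov]).
*)

(** * Affine changes of variable and rotations of the Gaussian plane *)

Section LebesgueAffine.
Context {R : realType}.
Local Notation leb := (@lebesgue_measure R).
Local Open Scope ereal_scope.

Lemma lebesgue_shift (t : R) (A : set R) : measurable A ->
  leb ((fun x : R => (x + t)%R) @^-1` A) = leb A.
Proof.
move=> mA.
have mf : measurable_fun setT (fun x : R => (x + t)%R : measurableTypeR R).
  exact: measurable_funD.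
rewrite -[LHS]/(pushforward leb (fun x : R => (x + t)%R : measurableTypeR R) A).
apply/esym/lebesgue_measure_unique => //.
move=> _ [[a b] _ <-].
rewrite /= /pushforward.
rewrite (_ : _ @^-1` _ = `](a - t)%R, (b - t)%R]%classic); last first.
  by apply/seteqP; split=> x /=; rewrite !in_itv/= ltrBlDr lerBrDr.
rewrite !lebesgue_measure_itv/= !lte_fin ltrD2r; case: ifP => // _; congr _%:E; ring.
Qed.

Lemma ge0_integral_shift (t : R) (f : R -> \bar R) : measurable_fun setT f ->
  (forall x, 0 <= f x) ->
  \int[leb]_x f (x + t)%R = \int[leb]_x f x.
Proof.
move=> mf f0.
have mg : measurable_fun setT (fun x : R => (x + t)%R : measurableTypeR R).
  exact: measurable_funD.
have := @ge0_integral_pushforward _ _ (measurableTypeR R) (measurableTypeR R) R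
  _ mg leb setT f measurableT mf (fun x _ => f0 x).
rewrite preimage_setT => <-.
by apply: eq_measure_integral => A mA _; exact: lebesgue_shift.
Qed.

Lemma lebesgue_scale (s : R) (A : set R) : (0 < s)%R -> measurable A ->
  leb A = s%:E * leb ((fun x : R => (s * x)%R) @^-1` A).
Proof.
move=> s0 mA.
have mf : measurable_fun setT (fun x : R => (s * x)%R : measurableTypeR R).
  exact: measurable_funM.
pose s' : {nonneg R} := NngNum (ltW s0).
pose m := @measure_function_pushforward__canonical__measure_function_Measure
  _ _ (measurableTypeR R) (measurableTypeR R) R leb _ mf.
rewrite -[RHS]/(mscale s' m A).
apply: lebesgue_measure_unique => //.
move=> _ [[a b] _ <-].
rewrite /= /mscale/= /pushforward.
rewrite (_ : _ @^-1` _ = `](s^-1 * a)%R, (s^-1 * b)%R]%classic); last first.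
  by apply/seteqP; split=> x /=; rewrite !in_itv/= ler_pdivlMl// ltr_pdivrMl.
rewrite !lebesgue_measure_itv/= !lte_fin ltr_pM2l ?invr_gt0//.
case: ifPn => _; last by rewrite mule0.
by rewrite -EFinM -mulrBr mulrA divff ?gt_eqF// mul1r.
Qed.

Lemma ge0_integral_scale (s : R) (f : R -> \bar R) : (0 < s)%R ->
  measurable_fun setT f -> (forall x, 0 <= f x) ->
  \int[leb]_x f x = s%:E * \int[leb]_x f (s * x)%R.
Proof.
move=> s0 mf f0.
have mg : measurable_fun setT (fun x : R => (s * x)%R : measurableTypeR R).
  exact: measurable_funM.
have := @ge0_integral_pushforward _ _ (measurableTypeR R) (measurableTypeR R) R
  _ mg leb setT f measurableT mf (fun x _ => f0 x).
rewrite preimage_setT => <-.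
pose s' : {nonneg R} := NngNum (ltW s0).
rewrite -[s%:E]/(s'%:num%:E).
rewrite -ge0_integral_mscale//.
apply: eq_measure_integral => A mA _; exact: lebesgue_scale.
Qed.

End LebesgueAffine.

Section GaussPlane.
Context {R : realType}.
Local Notation leb := (@lebesgue_measure R).
Local Notation gam := (normal_prob (0:R) 1).
Local Notation phi := (normal_pdf (0:R) 1).
Local Open Scope ereal_scope.

Lemma ge0_integral_normal (m s : R) (f : R -> \bar R) : measurable_fun setT f ->
  (forall x, 0 <= f x) ->
  \int[normal_prob m s]_x f x = \int[leb]_x (f x * (normal_pdf m s x)%:E).
Proof.
move=> mf f0.
have dom := normal_prob_dominates m s.
rewrite -(Radon_Nikodym_SigmaFinite.change_of_variables dom f0)//.
apply: ae_eq_integral => //.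
- apply: emeasurable_funM => //; apply: (measurable_int leb).
  exact: Radon_Nikodym_SigmaFinite.f_integrable.
- apply: emeasurable_funM => //; apply/measurable_EFinP.
  exact: measurable_normal_pdf.
- apply: ae_eqe_mul2l; apply: integral_ae_eq => //.
  + exact: Radon_Nikodym_SigmaFinite.f_integrable.
  + by apply/measurable_EFinP; exact: measurable_normal_pdf.
  + move=> E _ mE; rewrite -Radon_Nikodym_SigmaFinite.f_integral//.
Qed.

Lemma shear1 (t : R) (f : R * R -> \bar R) : measurable_fun setT f ->
  (forall x, 0 <= f x) ->
  \int[(leb \x leb)%E]_z f (z.1 + t * z.2, z.2)%R = \int[(leb \x leb)%E]_z f z.
Proof.
move=> mf f0.
have mg : measurable_fun setT (fun z : R * R => (z.1 + t * z.2, z.2)%R).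
  by apply: measurable_fun_pair => //; apply: measurable_funD => //; apply: measurable_funM.
rewrite [LHS]fubini_tonelli2//; last exact: (measurableT_comp mf mg).
rewrite fubini_tonelli2//.
apply: eq_integral => y _; rewrite /fubini_G/=.
apply: (@ge0_integral_shift R (t * y)%R (fun x => f (x, y))) => //.
exact: measurableT_comp.
Qed.

Lemma shear2 (t : R) (f : R * R -> \bar R) : measurable_fun setT f ->
  (forall x, 0 <= f x) ->
  \int[(leb \x leb)%E]_z f (z.1, z.2 + t * z.1)%R = \int[(leb \x leb)%E]_z f z.
Proof.
move=> mf f0.
have mg : measurable_fun setT (fun z : R * R => (z.1, z.2 + t * z.1)%R).
  by apply: measurable_fun_pair => //; apply: measurable_funD => //; apply: measurable_funM.
rewrite [LHS]fubini_tonelli1//; last exact: (measurableT_comp mf mg).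
rewrite fubini_tonelli1//.
apply: eq_integral => y _; rewrite /fubini_F/=.
apply: (@ge0_integral_shift R (t * y)%R (fun x => f (y, x))) => //.
exact: measurableT_comp.
Qed.

Lemma gauss2_density (f : R * R -> \bar R) : measurable_fun setT f ->
  (forall x, 0 <= f x) ->
  \int[(gam \x gam)%E]_z f z =
  \int[(leb \x leb)%E]_z (f z * (phi z.1 * phi z.2)%:E).
Proof.
move=> mf f0.
have mphi := @measurable_normal_pdf R 0 1.
have phi0 x : (0 <= phi x)%R by exact: normal_pdf_ge0.
rewrite fubini_tonelli1// ge0_integral_normal//; last 2 first.
  exact: measurable_fun_fubini_tonelli_F.
  by move=> x; apply: integral_ge0.
rewrite fubini_tonelli1//; last 2 first.
  apply: emeasurable_funM => //; apply/measurable_EFinP; apply: measurable_funM.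
    exact: measurableT_comp.
  exact: measurableT_comp.
  by move=> z; rewrite mule_ge0// lee_fin mulr_ge0.
apply: eq_integral => x _; rewrite /fubini_F/=.
rewrite ge0_integral_normal//; last exact: measurableT_comp.
rewrite muleC -ge0_integralZl//; last 3 first.
- apply: emeasurable_funM; first exact: measurableT_comp.
  exact/measurable_EFinP.
- by move=> y _; rewrite mule_ge0// lee_fin.
- by rewrite lee_fin.
apply: eq_integral => y _.
by rewrite EFinM muleCA.
Qed.

Lemma normal_pdf_rotation (c s x y : R) : (c ^+ 2 + s ^+ 2 = 1)%R ->
  (phi (c * x + s * y) * phi (- s * x + c * y) = phi x * phi y)%R.
Proof.
move=> cs.
rewrite /normal_pdf oner_eq0 /normal_fun mulrACA [RHS]mulrACA -!expRD.
congr (_ * expR _)%R; rewrite !subr0 -!mulrDl -!opprD; congr (- _ / _)%R.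
rewrite -[RHS]mul1r -cs; ring.
Qed.

(** A rotation with s <> 0 is a product of three shears, and the sections of a
    shear are translations. *)
Lemma lebesgue_rotation (c s : R) (F : R * R -> \bar R) :
  (c ^+ 2 + s ^+ 2 = 1)%R -> s != 0%R ->
  measurable_fun setT F -> (forall z, 0 <= F z) ->
  \int[(leb \x leb)%E]_z F (c * z.1 + s * z.2, - s * z.1 + c * z.2)%R =
  \int[(leb \x leb)%E]_z F z.
Proof.
move=> cs s0 mF F0.
(* t is the tangent of half the angle *)
pose t := ((1 - c) / s)%R.
have ts : (s * t = 1 - c)%R by rewrite /t mulrCA divff// mulr1.
have tc : (t + c * t = s)%R.
  rewrite /t mulrA -mulrDl.
  by apply: (mulIf s0); rewrite divfK//; lra.
have m1 : measurable_fun setT (fun z : R * R => (z.1 + t * z.2, z.2)%R).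
  by apply: measurable_fun_pair => //; apply: measurable_funD => //; apply: measurable_funM.
have m2 : measurable_fun setT (fun z : R * R => (z.1, z.2 + - s * z.1)%R).
  by apply: measurable_fun_pair => //; apply: measurable_funD => //; apply: measurable_funM.
have E1 := shear1 t mF F0.
have E2 := shear2 (- s) (measurableT_comp mF m1) (fun z => F0 _).
have E3 := shear1 t (measurableT_comp (measurableT_comp mF m1) m2) (fun z => F0 _).
rewrite -[RHS]E1 -[RHS]E2 -[RHS]E3.
apply: eq_integral => -[x y] _ /=; congr (F (_, _)).
- have -> : (c * x = x - s * t * x)%R by rewrite ts; ring.
  have -> : (s * y = (t + c * t) * y)%R by rewrite tc.
  have -> : (c * t = t - s * t * t)%R by rewrite ts; ring.
  ring.
- have -> : (c * y = y - s * t * y)%R by rewrite ts; ring.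
  ring.
Qed.

(** The joint density depends on x^2 + y^2 only. *)
Lemma gauss_rotation (c s : R) (f : R * R -> \bar R) :
  (c ^+ 2 + s ^+ 2 = 1)%R -> s != 0%R ->
  measurable_fun setT f -> (forall x, 0 <= f x) ->
  \int[(gam \x gam)%E]_z f (c * z.1 + s * z.2, - s * z.1 + c * z.2)%R =
  \int[(gam \x gam)%E]_z f z.
Proof.
move=> cs s0 mf f0.
have mphi := @measurable_normal_pdf R 0 1.
have phi0 x : (0 <= phi x)%R by exact: normal_pdf_ge0.
have mr : measurable_fun setT
    (fun z : R * R => (c * z.1 + s * z.2, - s * z.1 + c * z.2)%R).
  by apply: measurable_fun_pair; apply: measurable_funD => //; apply: measurable_funM.
have := gauss2_density (measurableT_comp mf mr) (fun z => f0 _).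
rewrite [X in X = _ -> _]/= => ->; rewrite gauss2_density//.
have mF : measurable_fun setT
    (fun z : R * R => f z * (phi z.1 * phi z.2)%:E).
  apply: emeasurable_funM => //; apply/measurable_EFinP; apply: measurable_funM.
    exact: measurableT_comp.
  exact: measurableT_comp.
have F0 z : 0 <= f z * (phi z.1 * phi z.2)%:E.
  by rewrite mule_ge0// lee_fin mulr_ge0.
have <- := lebesgue_rotation cs s0 mF F0.
by apply: eq_integral => -[x y] _ /=; rewrite normal_pdf_rotation.
Qed.

End GaussPlane.

(** * Independence of finite families of sigma-algebras *)

Section Independence.
Context {R : realType} {d : measure_display} {Om : measurableType d}.
Variable P : probability Om R.
Implicit Types (I J : finType).

(** The families used below contain [setT], so the product rule over all the
    indices implies the one over every subset of them. *)
Definition indep I (G : I -> set (set Om)) : Prop :=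
  forall E : I -> set Om, (forall i, G i (E i)) ->
  P (\big[setI/setT]_i E i) = (\prod_i fine (P (E i)))%:E.

Definition pi_system (G : set (set Om)) : Prop :=
  [/\ G setT, setI_closed G & G `<=` measurable].

Lemma pi_bigI I (p : pred I) (G : set (set Om)) (E : I -> set Om) : pi_system G ->
  (forall i, p i -> G (E i)) -> G (\big[setI/setT]_(i | p i) E i).
Proof. by move=> [GT GI _] GE; elim/big_ind : _. Qed.

Lemma sigma_measurable (G : set (set Om)) : G `<=` measurable ->
  <<s G >> `<=` measurable.
Proof. by move=> GM; apply: smallest_sub => //; exact: sigma_algebra_measurable. Qed.

Lemma sigma_pi_system (G : set (set Om)) : G `<=` measurable ->
  pi_system (<<s G >>).
Proof.
move=> GM; split.
- exact: (@measurableT _ (g_sigma_algebraType G)).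
- by move=> A B; exact: (@measurableI _ (g_sigma_algebraType G)).
- exact: sigma_measurable.
Qed.

Lemma indep_sub I (G H : I -> set (set Om)) :
  (forall i, H i `<=` G i) -> indep G -> indep H.
Proof. by move=> HG iG E HE; apply: iG => i; exact/HG. Qed.

(** As functions of the event of index i0, both sides of the product rule are
    finite measures; they agree on a pi-system, hence on the sigma-algebra
    that it generates. *)
Lemma indep_ext1 I (G : I -> set (set Om)) (i0 : I) :
  (forall i, pi_system (G i)) -> indep G ->
  indep (fun i => if i == i0 then <<s G i >> else G i).
Proof.
move=> piG iG E HE.
have mG i : G i `<=` measurable by case: (piG i).
have mE i : measurable (E i).
  by have := HE i; case: ifP => _; [exact: sigma_measurable|exact: mG].
pose K := \big[setI/setT]_(i | i != i0) E i.
have mK : measurable K by apply: bigsetI_measurable.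
have c0 : 0 <= \prod_(i | i != i0) fine (P (E i)).
  by apply: prodr_ge0 => i _; exact: fine_ge0.
pose c : {nonneg R} := NngNum c0.
have sGE : <<s G i0 >> (E i0) by have := HE i0; rewrite eqxx.
rewrite (bigD1 i0)//= (bigD1 (F := fun i => fine (P (E i))) i0)//=.
rewrite -/K mulrC EFinM fineK ?fin_num_measure//.
apply: (@g_sigma_algebra_measure_unique _ R Om (G i0) (mG i0) (fun _ => setT)
  _ _ (mrestr P mK) (mscale c P)) => //.
- by move=> _; case: (piG i0).
- by apply/seteqP; split=> // w _; exists 0%N.
- by case: (piG i0).
- move=> A GA; rewrite /mrestr /mscale/= /K.
  pose E' i := if i == i0 then A else E i.
  have := iG E'; rewrite (bigD1 i0)//= (bigD1 (F := fun i => fine (P (E' i))) i0)//=.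
  rewrite /E' eqxx (eq_bigr E); last by move=> i /negbTE ->.
  rewrite (eq_bigr (fun i => fine (P (E i)))); last by move=> i /negbTE ->.
  move=> H1; rewrite [LHS]H1.
    by rewrite mulrC EFinM fineK ?fin_num_measure//; exact: mG GA.
  by move=> i; have := HE i; case: eqP => [->|].
- move=> _; apply: (@le_lt_trans _ _ 1%E); last by rewrite ltry.
  by apply: probability_le1; exact: measurableI.
Qed.

Lemma indep_sigma I (G : I -> set (set Om)) :
  (forall i, pi_system (G i)) -> indep G -> indep (fun i => <<s G i >>).
Proof.
move=> piG iG.
pose H (s : seq I) i := if i \in s then <<s G i >> else G i.
have piH s i : pi_system (H s i).
  by rewrite /H; case: ifP => // _; apply: sigma_pi_system; case: (piG i).
have iH s : indep (H s).
  elim: s => [|i0 s IH]; first by move=> E HE; apply: iG => i; exact: HE.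
  have iH' := @indep_ext1 _ _ i0 (piH s) IH.
  apply: (indep_sub _ iH') => i A.
  rewrite /H inE; case: eqP => [->|_ //] /=.
  by case: ifP => _ //; exact: sub_sigma_algebra.
apply: (indep_sub _ (iH (enum I))) => i A.
by rewrite /H mem_enum.
Qed.

Lemma indep_partial I (G : I -> set (set Om)) (p : pred I) (E : I -> set Om) :
  (forall i, G i setT) -> indep G -> (forall i, p i -> G i (E i)) ->
  P (\big[setI/setT]_(i | p i) E i) = (\prod_(i | p i) fine (P (E i)))%:E.
Proof.
move=> GT iG GE.
rewrite big_mkcond [in RHS]big_mkcond/= iG; last first.
  by move=> i; case: ifPn => // /GE.
congr (_%:E); apply: eq_bigr => i _; case: ifP => // _.
by rewrite probability_setT.
Qed.

(** The intersections of events with indices in one fibre of h are a pi-system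
    that generates the sigma-algebra of the fibre. *)
Lemma indep_group I J (h : I -> J) (G : I -> set (set Om)) :
  (forall i, pi_system (G i)) -> indep G ->
  indep (fun j => <<s \bigcup_(i in [set i | h i = j]) G i >>).
Proof.
move=> piG iG.
have GT i : G i setT by case: (piG i).
pose C j := [set A | exists E : I -> set Om, (forall i, G i (E i)) /\
  A = \big[setI/setT]_(i | h i == j) E i].
have piC j : pi_system (C j).
  split.
  - by exists (fun _ => setT); split => //; rewrite big1.
  - move=> _ _ [E [GE ->]] [F [GF ->]]; exists (fun i => E i `&` F i); split.
      by move=> i; case: (piG i) => _ + _; apply.
    by rewrite big_split.
  - move=> _ [E [GE ->]]; apply: bigsetI_measurable => i _.
    by case: (piG i) => _ _; apply.
apply: (@indep_sub _ (fun j => <<s C j >>)).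
  move=> j; apply: smallest_sub; first exact: smallest_sigma_algebra.
  move=> A [i /= hij GA]; apply: sub_sigma_algebra.
  exists (fun k => if k == i then A else setT); split.
    by move=> k; case: eqP => [->|].
  rewrite (bigD1 i) ?hij//= eqxx big1 ?setIT// => k /andP[_ /negbTE ->//].
apply: indep_sigma => // F CF.
have [E EF] := choice CF.
have GE i : G i (E (h i) i) by case: (EF (h i)).
transitivity (P (\big[setI/setT]_i E (h i) i)).
  rewrite [in RHS](partition_big h predT)//=; congr (P _); apply: eq_bigr => j _.
  by case: (EF j) => _ ->; apply: eq_bigr => i /eqP ->.
rewrite iG// (partition_big h predT)//=; congr (_%:E); apply: eq_bigr => j _.
case: (EF j) => GEj ->; rewrite (indep_partial GT iG)//=.
by apply: eq_bigr => i /eqP ->.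
Qed.

(** Independence between the fibres of h and independence inside each fibre
    combine into independence of the whole family. *)
Lemma indep_split I J (h : I -> J) (G : I -> set (set Om)) (H : J -> set (set Om)) :
  (forall j, pi_system (H j)) -> indep H -> (forall i, G i `<=` H (h i)) ->
  (forall j (E : I -> set Om), (forall i, G i (E i)) ->
    P (\big[setI/setT]_(i | h i == j) E i) =
    (\prod_(i | h i == j) fine (P (E i)))%:E) ->
  indep G.
Proof.
move=> piH iH GH within E GE.
rewrite (partition_big h predT)//= iH; last first.
  by move=> j; apply: pi_bigI => // i /eqP <-; exact: GH.
rewrite [in RHS](partition_big h predT)//=; congr (_%:E).
by apply: eq_bigr => j _; rewrite within.
Qed.

Lemma indep_inj I J (h : I -> J) (H : J -> set (set Om)) : injective h ->
  (forall j, pi_system (H j)) -> indep H -> indep (fun i => H (h i)).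
Proof.
move=> ih piH iH; apply: (indep_split (h := h) piH iH) => [i //|j E HE].
have [[i hij]|nj] := pselect (exists i, h i = j).
  rewrite -big_filter -[in RHS]big_filter.
  suff -> : [seq k <- index_enum I | h k == j] = [:: i].
    rewrite !big_seq1 fineK// fin_num_measure//.
    by case: (piH (h i)) => _ _; apply; exact: HE.
  have := filter_pred1_uniq (index_enum_uniq I) (mem_index_enum i) => <-.
  apply: eq_filter => k /=; rewrite -hij; apply/eqP/eqP => [/ih//|->//].
rewrite !big_pred0 ?probability_setT// => i; apply/negP => /eqP hij.
  by apply: nj; exists i.
by apply: nj; exists i.
Qed.

End Independence.

(** * Laws of random variables and the standard normal laws *)

Section Laws.
Context {R : realType}.
Local Notation gam := (normal_prob (0:R) 1).
Local Open Scope ereal_scope.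

Lemma measurable_idR : @measurable_fun _ _ (measurableTypeR R) R setT idfun.
Proof. by move=> _ A mA; rewrite setTI. Qed.

Definition std1_id : {mfun measurableTypeR R >-> R} :=
  @mfun_Sub _ _ (measurableTypeR R) R idfun (mem_set measurable_idR).

(** The law [normal_prob 0 1], carried from the Borel type [measurableTypeR R]
    to [R] itself, on which random variables take their values. *)
Definition std1 : probability R R := distribution gam std1_id.

Definition std2 : probability (R * R)%type R := (std1 \x std1)%E.

Lemma std1_integral (f : R -> \bar R) : measurable_fun setT f ->
  (forall x, 0 <= f x) -> \int[std1]_x f x = \int[gam]_x f x.
Proof. by move=> mf f0; rewrite ge0_integral_distribution. Qed.

Definition same_law {d d' e} {T : measurableType d} {T' : measurableType d'}
  {V : measurableType e} (m : {measure set T -> \bar R}) (X : T -> V)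
  (m' : {measure set T' -> \bar R}) (X' : T' -> V) : Prop :=
  forall A, measurable A -> m (X @^-1` A) = m' (X' @^-1` A).

Lemma same_law_ge0 d d' e (T : measurableType d) (T' : measurableType d')
    (V : measurableType e) (m : {measure set T -> \bar R}) (X : T -> V)
    (m' : {measure set T' -> \bar R}) (X' : T' -> V) (f : V -> \bar R) :
  measurable_fun setT X -> measurable_fun setT X' -> same_law m X m' X' ->
  measurable_fun setT f -> (forall v, 0 <= f v) ->
  \int[m]_w f (X w) = \int[m']_w f (X' w).
Proof.
move=> mX mX' XX' mf f0.
have := @ge0_integral_pushforward _ _ _ _ R _ mX m setT f measurableT mf (fun x _ => f0 x).
rewrite preimage_setT => <-.
have := @ge0_integral_pushforward _ _ _ _ R _ mX' m' setT f measurableT mf (fun x _ => f0 x).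
rewrite preimage_setT => <-.
by apply: eq_measure_integral => A mA _; exact: XX'.
Qed.

Lemma same_law_expectation d d' e (T : measurableType d) (T' : measurableType d')
    (V : measurableType e) (P : probability T R) (X : T -> V)
    (P' : probability T' R) (X' : T' -> V) (f : V -> R) :
  measurable_fun setT X -> measurable_fun setT X' -> same_law P X P' X' ->
  measurable_fun setT f -> P.-integrable setT (EFin \o (f \o X)) ->
  'E_P[f \o X] = 'E_P'[f \o X'].
Proof.
move=> mX mX' XX' mf iX; rewrite !unlock.
have mf' : measurable_fun setT (EFin \o f) by exact/measurable_EFinP.
have iX' : P'.-integrable setT (EFin \o (f \o X')).
  apply/integrableP; split; first exact: measurableT_comp mf' mX'.
  move/integrableP : iX => [_]; apply: le_lt_trans.
  rewrite (@same_law_ge0 _ _ _ _ _ _ _ _ _ _ (fun v => `|(f v)%:E|) mX mX' XX')//.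
  exact: measurableT_comp.
have := @integral_pushforward _ _ _ _ R _ mX P setT _ mf' iX measurableT.
rewrite preimage_setT => <-.
have := @integral_pushforward _ _ _ _ R _ mX' P' setT _ mf' iX' measurableT.
rewrite preimage_setT => <-.
by apply: eq_measure_integral => A mA _; exact: XX'.
Qed.

Lemma normal_scale (s : R) (A : set R) : (0 < s)%R -> measurable A ->
  normal_prob 0 s A = std1 ((fun z : R => (s * z)%R) @^-1` A).
Proof.
move=> s0 mA.
have mpdf s' : measurable_fun setT (EFin \o normal_pdf 0 s').
  by apply/measurable_EFinP; exact: measurable_normal_pdf.
have mB : measurable ((fun z : R => (s * z)%R) @^-1` A).
  rewrite -[X in measurable X]setTI.
  by apply: (@measurable_funM _ _ R setT (cst s) id).
rewrite -[RHS]/(gam _) /normal_prob integral_mkcond [RHS]integral_mkcond.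
rewrite (ge0_integral_scale s0)//; first last.
- by move=> x; rewrite erestrict_ge0// => y _; rewrite lee_fin normal_pdf_ge0.
- by apply/(measurable_restrictT _ mA); apply: (measurable_funS measurableT) => //; exact: mpdf.
rewrite -ge0_integralZl//; first last.
- by rewrite lee_fin ltW.
- by move=> x _; rewrite erestrict_ge0// => y _; rewrite lee_fin normal_pdf_ge0.
- apply: measurableT_comp; last exact: (@measurable_funM _ _ R setT (cst s) id).
  by apply/(measurable_restrictT _ mA); apply: (measurable_funS measurableT) => //; exact: mpdf.
apply: eq_integral => x _; rewrite /patch.
have -> : (x \in (fun z : R => s * z)%R @^-1` A) = ((s * x)%R \in A) by [].
case: ifP => _; last by rewrite mule0.
rewrite -EFinM; congr _%:E.
rewrite /normal_pdf oner_eq0 gt_eqF// /normal_fun /normal_peak mulrA; congr (_ * expR _)%R.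
  rewrite expr1n mul1r -mulrnAr sqrtrM ?sqr_ge0// sqrtr_sqr gtr0_norm//.
  by rewrite invfM mulrA divff ?mul1r// gt_eqF.
rewrite !subr0 expr1n exprMn; field.
by rewrite gt_eqF.
Qed.

(** Scaling one standard variable treats the Dirac mass (v = 0) and the normal
    laws uniformly. *)
Lemma centered_normalP d (Om : measurableType d) (P : probability Om R)
    (X : Om -> R) (v : R) :
  centered_normal P X v <-> [/\ (0 <= v)%R, measurable_fun setT X
    & same_law P X std1 (fun z => (Num.sqrt v * z)%R)].
Proof.
have H A : (0 <= v)%R -> measurable A ->
    (if v == 0%R then (\d_(0%R : R) A)%E else normal_prob 0 (Num.sqrt v) A) =
    std1 ((fun z : R => (Num.sqrt v * z)%R) @^-1` A).
  move=> v0 mA; case: eqP => [->|/eqP vn0].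
    rewrite sqrtr0 diracE.
    have -> : (fun z : R => (0 * z)%R) = cst 0%R by apply/funext => z; rewrite mul0r.
    rewrite preimage_cst.
    by case: ifP => _; rewrite ?probability_setT ?measure0.
  by rewrite normal_scale// sqrtr_gt0 lt_neqAle eq_sym vn0.
split=> -[v0 mX law]; split=> // A mA; first exact: etrans (law A mA) (H A v0 mA).
exact: etrans (law A mA) (esym (H A v0 mA)).
Qed.

Lemma independent_integral d e e' (Om : measurableType d) (P : probability Om R)
    (V : measurableType e) (V' : measurableType e') (X : Om -> V) (Y : Om -> V')
    (f : V * V' -> \bar R) :
  measurable_fun setT X -> measurable_fun setT Y ->
  (forall A B, measurable A -> measurable B ->
    P (X @^-1` A `&` Y @^-1` B) = P (X @^-1` A) * P (Y @^-1` B)) ->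
  measurable_fun setT f -> (forall v, 0 <= f v) ->
  \int[P]_w f (X w, Y w) = \int[P]_w \int[P]_w' f (X w, Y w').
Proof.
move=> mX mY XY mf f0.
have mXY : measurable_fun setT (fun w => (X w, Y w)) by exact: measurable_fun_pair.
pose X' : {mfun Om >-> V} := mfun_Sub (mem_set mX).
pose Y' : {mfun Om >-> V'} := mfun_Sub (mem_set mY).
have := @ge0_integral_pushforward _ _ _ _ R _ mXY P setT f measurableT mf (fun x _ => f0 x).
rewrite preimage_setT => <-.
transitivity (\int[(distribution P X' \x distribution P Y')%E]_v f v).
  apply: eq_measure_integral => A mA _; apply/esym.
  by apply: product_measure_unique => //= B C mB mC; exact: XY.
rewrite fubini_tonelli1//.
rewrite (@ge0_integral_distribution _ _ _ _ _ P X')//; last 2 first.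
- exact: measurable_fun_fubini_tonelli_F.
- by move=> v; exact: integral_ge0.
apply: eq_integral => w _; rewrite /= /fubini_F.
rewrite (@ge0_integral_distribution _ _ _ _ _ P Y')//.
exact: measurableT_comp.
Qed.

(** When s = 0 the sign condition on c leaves the identity only; this is why a
    nonnegative cosine is asked for. *)
Lemma gauss_rotate (c s : R) (f : R * R -> \bar R) :
  (0 <= c)%R -> (c ^+ 2 + s ^+ 2 = 1)%R ->
  measurable_fun setT f -> (forall x, 0 <= f x) ->
  \int[std1]_x \int[std1]_y f (c * x + s * y, - s * x + c * y)%R =
  \int[std1]_x \int[std1]_y f (x, y).
Proof.
move=> c0 cs mf f0.
have [s0|s0] := eqVneq s 0%R.
  have -> : c = 1%R.
    by apply/eqP; rewrite -(@eqrXn2 _ 2)// expr1n -cs s0 expr0n addr0.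
  apply: eq_integral => x _; apply: eq_integral => y _.
  by rewrite s0 oppr0 !mul0r addr0 add0r !mul1r.
have mr : measurable_fun setT
    (fun z : R * R => (c * z.1 + s * z.2, - s * z.1 + c * z.2)%R).
  by apply: measurable_fun_pair; apply: measurable_funD => //; apply: measurable_funM.
have std2E (g : R * R -> \bar R) : measurable_fun setT g -> (forall z, 0 <= g z) ->
    \int[std1]_x \int[std1]_y g (x, y) = \int[(gam \x gam)%E]_z g z.
  move=> mg g0; rewrite fubini_tonelli1// std1_integral//; last 2 first.
  - exact: measurable_fun_fubini_tonelli_F.
  - by move=> x; exact: integral_ge0.
  apply: eq_integral => x _; rewrite std1_integral//; exact: measurableT_comp.
have H1 := std2E _ (measurableT_comp mf mr) (fun z => f0 _).
have H2 := gauss_rotation cs s0 mf f0.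
exact: etrans H1 (etrans H2 (esym (std2E f mf f0))).
Qed.

(** The rotation that turns the vector (r, b) onto the first axis. *)
Lemma givens (r b : R) : (0 <= r)%R -> exists h c s : R,
  [/\ (0 <= h)%R, (0 <= c)%R, (c ^+ 2 + s ^+ 2 = 1)%R,
    (h ^+ 2 = r ^+ 2 + b ^+ 2)%R & (r = h * c)%R /\ (b = h * s)%R].
Proof.
move=> r0; pose h := Num.sqrt (r ^+ 2 + b ^+ 2).
have h2 : (h ^+ 2 = r ^+ 2 + b ^+ 2)%R by rewrite sqr_sqrtr// addr_ge0 ?sqr_ge0.
exists h; have [h0|h0] := eqVneq h 0%R.
  move: h2; rewrite h0 expr0n/= => /esym/eqP.
  rewrite paddr_eq0 ?sqr_ge0// !sqrf_eq0 => /andP[/eqP -> /eqP ->].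
  exists 1%R, 0%R; rewrite !mul0r; split=> //; first by rewrite expr1n expr0n addr0.
  by rewrite expr0n addr0.
exists (r / h)%R, (b / h)%R; split=> //.
- by rewrite sqrtr_ge0.
- by rewrite divr_ge0// sqrtr_ge0.
- by rewrite !exprMn -mulrDl -h2 exprVn divff// sqrf_eq0.
- by split; rewrite mulrCA divff// mulr1.
Qed.

(** A centered normal pair, given by a triangular factor of its covariance:
    the variances are p^2 + q^2 and r^2, and the covariance is q r. *)
Definition binlaw d (Om : measurableType d) (P : probability Om R)
    (X Y : Om -> R) (p q r : R) : Prop :=
  same_law P (fun w => (X w, Y w)) std2 (fun z => (p * z.1 + q * z.2, r * z.2)%R).

End Laws.

Section Chol.
Context {R : realType}.
Local Notation std1 := (@std1 R).
Local Open Scope ereal_scope.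

Lemma measurable_affine2 d (T : measurableType d) (X Y : T -> R) (a b : R) :
  measurable_fun setT X -> measurable_fun setT Y ->
  measurable_fun setT (fun w => (a * X w + b * Y w)%R).
Proof.
by move=> mX mY; apply: measurable_funD; apply: measurable_funM.
Qed.

Lemma integral_prob_cst d (T : measurableType d) (P : probability T R) (e : \bar R) :
  \int[P]_x e = e.
Proof.
rewrite (integral_cst P measurableT e).
by rewrite -[RHS]mule1; congr (e * _); exact: probability_setT.
Qed.

Lemma std1_swap (g : R -> R -> \bar R) :
  measurable_fun setT (fun z : R * R => g z.1 z.2) -> (forall x y, 0 <= g x y) ->
  \int[std1]_x \int[std1]_y g x y = \int[std1]_y \int[std1]_x g x y.
Proof.
move=> mg g0.
exact: (@fubini_tonelli _ _ _ _ R std1 std1 (fun z => g z.1 z.2) mg (fun z => g0 z.1 z.2)).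
Qed.

Lemma measurable_int1 d (T : measurableType d) (g : T -> R -> \bar R) :
  measurable_fun setT (fun z : T * R => g z.1 z.2) -> (forall x y, 0 <= g x y) ->
  measurable_fun setT (fun x => \int[std1]_y g x y).
Proof.
move=> mg g0.
exact: (@measurable_fun_fubini_tonelli_F _ _ _ _ R std1 (fun z => g z.1 z.2) mg (fun z => g0 z.1 z.2)).
Qed.

(** A rotation of (y, g) clears the third variable from the second coordinate,
    and a rotation of (x, g) then clears it from the first one; both preserve
    the normal law. *)
Lemma gauss_lower3 (p q r a b : R) : (0 <= p)%R -> (0 <= r)%R ->
  exists p' q' r' : R, [/\ (0 <= p')%R, (0 <= r')%R,
    [/\ (p' ^+ 2 + q' ^+ 2 = p ^+ 2 + q ^+ 2 + a ^+ 2)%R, (q' * r' = q * r + a * b)%R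
    & (r' ^+ 2 = r ^+ 2 + b ^+ 2)%R] &
    forall f : R * R -> \bar R, measurable_fun setT f -> (forall x, 0 <= f x) ->
    \int[std1]_x \int[std1]_y \int[std1]_g f (p * x + q * y + a * g, r * y + b * g)%R
    = \int[std1]_x \int[std1]_y f (p' * x + q' * y, r' * y)%R].
Proof.
move=> p0 r0.
have [r' [c [s [r'0 c0 cs r'E [rc bs]]]]] := givens b r0.
have [q' q'E] : exists q', q' = (q * c + a * s)%R by eexists.
have [a' a'E] : exists a', a' = (a * c - q * s)%R by eexists.
have [p' [c1 [s1 [p'0 c10 cs1 p'E [pc as1]]]]] := givens a' p0.
have qa (y g : R) :
    (q' * (c * y + s * g) + a' * (- s * y + c * g) = q * y + a * g)%R.
  rewrite q'E a'E -[RHS]mulr1 -cs; ring.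
exists p', q', r'; split; [exact: p'0 | exact: r'0 | split; [| |exact: r'E] |].
- rewrite p'E -addrA -[RHS]addrA; congr (_ + _)%R.
  by rewrite -[RHS]mulr1 -cs q'E a'E; ring.
- by rewrite [in RHS]rc [in RHS]bs q'E; ring.
move=> f mf f0.
transitivity (\int[std1]_x \int[std1]_y \int[std1]_g
    f (p * x + q' * y + a' * g, r' * y)%R).
  apply: eq_integral => x _.
  pose k (z : R * R) := f (p * x + q' * z.1 + a' * z.2, r' * z.1)%R.
  have mk : measurable_fun setT k.
    apply: (measurableT_comp mf); apply: measurable_fun_pair; last exact: measurable_funM.
    apply: measurable_funD; last exact: measurable_funM.
    by apply: measurable_funD => //; exact: measurable_funM.
  have H := @gauss_rotate R c s k c0 cs mk (fun _ => f0 _).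
  apply: (etrans _ H).
  apply: eq_integral => y _; apply: eq_integral => g _.
  rewrite /k/=; congr (f (_, _)); last by rewrite rc bs; ring.
  by rewrite -addrA -qa; ring.
have M3 : measurable_fun setT (fun z : (R * R) * R =>
    f (p * z.1.1 + q' * z.1.2 + a' * z.2, r' * z.1.2)%R).
  apply: (measurableT_comp mf); apply: measurable_fun_pair.
    apply: measurable_funD; last by apply: measurable_funM.
    by apply: measurable_affine2; apply: measurableT_comp.
  by apply: measurable_funM => //; apply: measurableT_comp.
have S1 := @std1_swap (fun x y => \int[std1]_g
  f (p * x + q' * y + a' * g, r' * y)%R)
  (@measurable_int1 _ _ (fun z g =>
    f (p * z.1 + q' * z.2 + a' * g, r' * z.2)%R) M3 (fun _ _ => f0 _))
  (fun _ _ => integral_ge0 std1 (fun _ _ => f0 _)).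
have M2 : measurable_fun setT (fun z : R * R =>
    f (p' * z.1 + q' * z.2, r' * z.2)%R).
  apply: (measurableT_comp mf); apply: measurable_fun_pair.
    exact: measurable_affine2.
  exact: measurable_funM.
have S2 := @std1_swap (fun x y => f (p' * x + q' * y, r' * y)%R) M2
  (fun _ _ => f0 _).
apply: (etrans S1); apply: (etrans _ (esym S2)).
apply: eq_integral => y _.
pose k (z : R * R) := f (p' * z.1 + q' * y, r' * y)%R.
have mk : measurable_fun setT k.
  apply: (measurableT_comp mf); apply: measurable_fun_pair; last exact: measurable_cst.
  apply: measurable_funD; last exact: measurable_cst.
  by apply: measurable_funM; [exact: measurable_cst|exact: measurable_fst].
transitivity (\int[std1]_x \int[std1]_g k (c1 * x + s1 * g, - s1 * x + c1 * g)%R).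
  apply: eq_integral => x _; apply: eq_integral => g _.
  rewrite /k/=; congr (f (_, _)).
  by rewrite pc as1; ring.
apply: (etrans (gauss_rotate c10 cs1 mk (fun _ => f0 _))).
apply: eq_integral => x _.
exact: (integral_prob_cst std1 (f (p' * x + q' * y, r' * y)%R)).
Qed.

Lemma binlaw_integral d (Om : measurableType d) (P : probability Om R)
    (X Y : Om -> R) (p q r : R) (f : R * R -> \bar R) :
  measurable_fun setT X -> measurable_fun setT Y -> binlaw P X Y p q r ->
  measurable_fun setT f -> (forall z, 0 <= f z) ->
  \int[P]_w f (X w, Y w) =
  \int[std1]_x \int[std1]_y f (p * x + q * y, r * y)%R.
Proof.
move=> mX mY law mf f0.
have mXY : measurable_fun setT (fun w => (X w, Y w)) by exact: measurable_fun_pair.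
have mL : measurable_fun setT
    (fun z : R * R => (p * z.1 + q * z.2, r * z.2)%R).
  by apply: measurable_fun_pair; [exact: measurable_affine2|exact: measurable_funM].
apply: (etrans (same_law_ge0 mXY mL law mf f0)).
exact: (@fubini_tonelli1 _ _ _ _ R std1 std1 _ (measurableT_comp mf mL) (fun _ => f0 _)).
Qed.

Lemma binlaw_add d (Om : measurableType d) (P : probability Om R)
    (X Y U : Om -> R) (p q r a b v : R) :
  measurable_fun setT X -> measurable_fun setT Y -> centered_normal P U v ->
  (forall (A : set (R * R)) (B : set R), measurable A -> measurable B ->
    P ((fun w => (X w, Y w)) @^-1` A `&` U @^-1` B) =
    P ((fun w => (X w, Y w)) @^-1` A) * P (U @^-1` B)) ->
  (0 <= p)%R -> (0 <= r)%R -> binlaw P X Y p q r ->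
  exists p' q' r' : R, [/\ (0 <= p')%R, (0 <= r')%R,
    [/\ (p' ^+ 2 + q' ^+ 2 = p ^+ 2 + q ^+ 2 + a ^+ 2 * v)%R,
        (q' * r' = q * r + a * b * v)%R
      & (r' ^+ 2 = r ^+ 2 + b ^+ 2 * v)%R] &
    binlaw P (fun w => X w + a * U w)%R (fun w => Y w + b * U w)%R p' q' r'].
Proof.
move=> mX mY /centered_normalP[v0 mU lawU] XYU p0 r0 law.
have mXY : measurable_fun setT (fun w => (X w, Y w)) by exact: measurable_fun_pair.
have sv : (Num.sqrt v ^+ 2 = v)%R by rewrite sqr_sqrtr.
pose s := Num.sqrt v.
have [p' [q' [r' [p'0 r'0 [E1 E2 E3] H]]]] :=
  gauss_lower3 q (a * s)%R (b * s)%R p0 r0.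
exists p', q', r'; split; [exact: p'0|exact: r'0|split|].
- by rewrite E1 exprMn sv.
- by rewrite E2 /s mulrACA -expr2 sv.
- by rewrite E3 exprMn sv.
move=> A mA.
pose f (z : R * R) : \bar R := (\1_A z)%:E.
have mf : measurable_fun setT f by apply/measurable_EFinP; exact: measurable_indic.
have f0 z : 0 <= f z by rewrite lee_fin.
pose XU w := (X w + a * U w, Y w + b * U w)%R.
have mXU : measurable_fun setT XU.
  by apply: measurable_fun_pair; apply: measurable_funD => //; apply: measurable_funM.
have mh : measurable_fun setT (fun z : (R * R) * R =>
    f (z.1.1 + a * z.2, z.1.2 + b * z.2)%R).
  apply: (measurableT_comp mf); apply: measurable_fun_pair.
    apply: measurable_funD; first exact: measurableT_comp.
    by apply: measurable_funM; [exact: measurable_cst|exact: measurable_snd].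
  apply: measurable_funD; first exact: measurableT_comp.
  by apply: measurable_funM; [exact: measurable_cst|exact: measurable_snd].
transitivity (\int[P]_w f (XU w)).
  have := integral_indic P measurableT (A := XU @^-1` A).
  rewrite setIT => <-//.
  by rewrite -[X in measurable X]setTI; exact: mXU.
have := independent_integral mXY mU XYU mh (fun _ => f0 _).
rewrite /= => E; apply: (etrans E).
have sm : measurable_fun setT (fun x : R => (s * x)%R) by exact: measurable_funM.
transitivity (\int[P]_w \int[std1]_g f (X w + a * s * g, Y w + b * s * g)%R).
  apply: eq_integral => w _.
  have := @same_law_ge0 _ _ _ _ _ _ _ _ _ _ _
    (fun g : R => f (X w + a * g, Y w + b * g)%R) mU sm lawU.
  rewrite /= => ->//.
  - by apply: eq_integral => g _; rewrite !mulrA.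
  - apply: (measurableT_comp mf); apply: measurable_fun_pair.
      apply: measurable_funD; first exact: measurable_cst.
      exact: measurable_funM.
    apply: measurable_funD; first exact: measurable_cst.
    exact: measurable_funM.
have mh' : measurable_fun setT (fun z : (R * R) * R =>
    f (z.1.1 + a * s * z.2, z.1.2 + b * s * z.2)%R).
  apply: (measurableT_comp mf); apply: measurable_fun_pair.
    apply: measurable_funD; first exact: measurableT_comp.
    by apply: measurable_funM; [exact: measurable_cst|exact: measurable_snd].
  apply: measurable_funD; first exact: measurableT_comp.
  by apply: measurable_funM; [exact: measurable_cst|exact: measurable_snd].
have mF := @measurable_int1 _ _ (fun (z : R * R) g =>
  f (z.1 + a * s * g, z.2 + b * s * g)%R) mh' (fun _ _ => f0 _).
have := binlaw_integral mX mY law mF (fun _ => integral_ge0 std1 (fun _ _ => f0 _)).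
rewrite /= => E'; apply: (etrans E'); apply: (etrans (H f mf f0)).
have mL : measurable_fun setT
    (fun z : R * R => (p' * z.1 + q' * z.2, r' * z.2)%R).
  by apply: measurable_fun_pair; [exact: measurable_affine2|exact: measurable_funM].
have := @fubini_tonelli1 _ _ _ _ R std1 std1 _ (measurableT_comp mf mL) (fun _ => f0 _).
rewrite /fubini_F/= => <-.
have := integral_indic std2 measurableT
  (A := (fun z : R * R => (p' * z.1 + q' * z.2, r' * z.2)%R) @^-1` A).
rewrite setIT => <-//.
by rewrite -[X in measurable X]setTI; exact: mL.
Qed.

End Chol.

(** * Linear images of independent normal variables *)

Section GaussSums.
Context {R : realType} {d : measure_display} {Om : measurableType d}.
Variable P : probability Om R.
Local Notation std1 := (@std1 R).

Definition rvs (X : Om -> R) : set (set Om) :=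
  [set E | exists2 A : set R, measurable A & E = X @^-1` A].

Lemma rvs_pi (X : Om -> R) : measurable_fun setT X -> pi_system (rvs X).
Proof.
move=> mX; split.
- by exists setT.
- by move=> _ _ [A mA ->] [B mB ->]; exists (A `&` B) => //; exact: measurableI.
- by move=> _ [A mA ->]; rewrite -[X in measurable X]setTI; exact: mX.
Qed.

Definition gmeas (G : set (set Om)) e (V : measurableType e) (X : Om -> V) :=
  @measurable_fun _ _ (g_sigma_algebraType G) V setT X.

Lemma gmeas_preimage G e (V : measurableType e) (X : Om -> V) A :
  gmeas G X -> measurable A -> <<s G >> (X @^-1` A).
Proof. by move=> mX mA; have := mX measurableT A mA; rewrite setTI. Qed.

Lemma gmeas_rvs (G : set (set Om)) (X : Om -> R) : rvs X `<=` G -> gmeas G X.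
Proof.
move=> XG _ A mA; rewrite setTI; apply: sub_sigma_algebra; apply: XG.
by exists A.
Qed.

Lemma gmeas_sub (G : set (set Om)) (X : Om -> R) : gmeas G X -> rvs X `<=` <<s G >>.
Proof. by move=> mX _ [A mA ->]; exact: gmeas_preimage. Qed.

Lemma gmeas_sum (G : set (set Om)) (I : Type) (s : seq I) (p : pred I)
    (a : I -> R) (g : I -> Om -> R) :
  (forall i, p i -> gmeas G (g i)) ->
  gmeas G (fun w => \sum_(i <- s | p i) a i * g i w).
Proof.
move=> mg; rewrite /gmeas.
under eq_fun do rewrite big_mkcond/=.
apply: (@measurable_sum _ (g_sigma_algebraType G)) => i.
case: (boolP (p i)) => [/mg mgi|_]; last exact: measurable_cst.
by apply: measurable_funM => //; exact: measurable_cst.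
Qed.

Lemma binlaw0 : binlaw P (fun _ => 0) (fun _ => 0) 0 0 0.
Proof.
move=> A mA.
have -> : (fun z : R * R => (0 * z.1 + 0 * z.2, 0 * z.2)) = cst (0, 0).
  by apply/funext => z; rewrite !mul0r addr0.
have -> : (fun _ : Om => (0, 0)) = cst (0 : R, 0 : R) by [].
rewrite !preimage_cst; case: ifP => _; last by rewrite !measure0.
exact: etrans (probability_setT P) (esym (probability_setT std2)).
Qed.

(** Induction on the index set, with [binlaw_add] for the addition of one
    independent variable. A triangular factor is carried along, but only its
    covariance is known. *)
Lemma gauss_sums (I : finType) (g : I -> Om -> R) (v a b : I -> R) :
  indep P (fun i => rvs (g i)) -> (forall i, centered_normal P (g i) (v i)) ->
  exists p q r : R, [/\ 0 <= p, 0 <= r,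
    [/\ p ^+ 2 + q ^+ 2 = \sum_i a i ^+ 2 * v i,
        q * r = \sum_i a i * b i * v i & r ^+ 2 = \sum_i b i ^+ 2 * v i] &
    binlaw P (fun w => \sum_i a i * g i w) (fun w => \sum_i b i * g i w) p q r].
Proof.
move=> ig gn.
have mg i : measurable_fun setT (g i) by case: (gn i).
have : uniq (index_enum I) by exact: index_enum_uniq.
elim: (index_enum I) => [_|i0 s IH /= /andP[i0s us]].
  exists 0, 0, 0; split=> //; first by rewrite !big_nil expr0n mulr0 addr0; split.
  have -> : (fun w : Om => \sum_(i <- [::]) a i * g i w) = fun _ => 0.
    by apply/funext => w; rewrite big_nil.
  have -> : (fun w : Om => \sum_(i <- [::]) b i * g i w) = fun _ => 0.
    by apply/funext => w; rewrite big_nil.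
  exact: binlaw0.
have [p [q [r [p0 r0 [E1 E2 E3] law]]]] := IH us.
have ig' := indep_group (h := fun i => i == i0) (fun i => rvs_pi (mg i)) ig.
pose G := \bigcup_(i in [set i | (i == i0) = false]) rvs (g i).
have sgm (c : I -> R) : gmeas G (fun w => \sum_(i <- s) c i * g i w).
  have -> : (fun w => \sum_(i <- s) c i * g i w) =
      (fun w => \sum_(i <- s | i != i0) c i * g i w).
    apply/funext => w; rewrite big_seq [RHS]big_seq_cond; apply: eq_bigl => i.
    by case: (boolP (i \in s)) => //= si; case: eqP => // ii; rewrite -ii si in i0s.
  apply: gmeas_sum => i /negbTE ii0; apply: gmeas_rvs => A gA.
  by exists i.
have Gm : G `<=` measurable.
  by move=> A [i _]; case: (rvs_pi (mg i)) => _ _; apply.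
have msum (c : I -> R) : measurable_fun setT (fun w => \sum_(i <- s) c i * g i w).
  by apply: measurable_sum => i; apply: measurable_funM.
pose XY w := (\sum_(i <- s) a i * g i w, \sum_(i <- s) b i * g i w).
have XYU : forall (A : set (R * R)) (B : set R), measurable A -> measurable B ->
    P (XY @^-1` A `&` g i0 @^-1` B) = (P (XY @^-1` A) * P (g i0 @^-1` B))%E.
  move=> A B mA mB.
  set E := _ @^-1` A; set F := _ @^-1` B.
  have sE : <<s G >> E.
    by apply: gmeas_preimage => //; apply: measurable_fun_pair; exact: sgm.
  have sF : rvs (g i0) F by exists B.
  have mE : measurable E by exact: sigma_measurable Gm _ sE.
  have mF : measurable F by case: (rvs_pi (mg i0)) => _ _; exact.
  have := ig' (fun x => if x then F else E).
  rewrite !big_bool/= setIC => ->.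
    by rewrite EFinM muleC !fineK ?fin_num_measure.
  case; last exact: sE.
  by apply: sub_sigma_algebra; exists i0; [exact: eqxx|exact: sF].
have [p' [q' [r' [p'0 r'0 [F1 F2 F3] law']]]] :=
  binlaw_add (a i0) (b i0) (msum a) (msum b) (gn i0) XYU p0 r0 law.
exists p', q', r'; split=> //.
  by rewrite !big_cons F1 F2 F3 E1 E2 E3; split; rewrite addrC.
have -> : (fun w => \sum_(i <- i0 :: s) a i * g i w) =
    (fun w => \sum_(i <- s) a i * g i w + a i0 * g i0 w).
  by apply/funext => w; rewrite big_cons addrC.
have -> : (fun w => \sum_(i <- i0 :: s) b i * g i w) =
    (fun w => \sum_(i <- s) b i * g i w + b i0 * g i0 w).
  by apply/funext => w; rewrite big_cons addrC.
exact: law'.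
Qed.

Lemma binlaw_snd (X Y : Om -> R) (p q r : R) : measurable_fun setT Y -> 0 <= r ->
  binlaw P X Y p q r -> centered_normal P Y (r ^+ 2).
Proof.
move=> mY r0 law; apply/centered_normalP; split; rewrite ?sqr_ge0// => A mA.
rewrite sqrtr_sqr ger0_norm//.
have := law (setT `*` A) (measurableX measurableT mA).
have -> : (fun w => (X w, Y w)) @^-1` (setT `*` A) = Y @^-1` A.
  by apply/seteqP; split=> w //= [].
move=> ->.
have -> : (fun z : R * R => (p * z.1 + q * z.2, r * z.2)) @^-1` (setT `*` A)
    = setT `*` ((fun z : R => r * z) @^-1` A).
  by apply/seteqP; split=> -[x y] //= [].
apply: (etrans (product_measure1E std1 std1 measurableT _)).
  rewrite -[X in measurable X]setTI.
  by apply: (@measurable_funM _ _ R setT (cst r) id).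
have e : std1 setT = 1%E by exact: probability_setT.
by rewrite [X in (X * _)%E]e mul1e.
Qed.

Lemma normal_sum (I : finType) (g : I -> Om -> R) (v b : I -> R) :
  indep P (fun i => rvs (g i)) -> (forall i, centered_normal P (g i) (v i)) ->
  centered_normal P (fun w => \sum_i b i * g i w) (\sum_i b i ^+ 2 * v i).
Proof.
move=> ig gn; have [p [q [r [_ r0 [_ _ <-] law]]]] := gauss_sums b b ig gn.
apply: binlaw_snd r0 law.
by apply: measurable_sum => i; apply: measurable_funM => //; case: (gn i).
Qed.

(** Either q = 0, and the two coordinates depend on different variables, or r
    = 0, and the second coordinate is 0. *)
Lemma binlaw_indep (X Y : Om -> R) (p q r : R) : measurable_fun setT X ->
  measurable_fun setT Y -> q * r = 0 ->
  binlaw P X Y p q r -> forall A B, measurable A -> measurable B ->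
  P (X @^-1` A `&` Y @^-1` B) = (P (X @^-1` A) * P (Y @^-1` B))%E.
Proof.
move=> mX mY qr law A B mA mB.
have mul_pre c (C : set R) : measurable C ->
    measurable ((fun z : R => c * z) @^-1` C).
  move=> mC; rewrite -[X in measurable X]setTI.
  by apply: (@measurable_funM _ _ R setT (cst c) id).
have e : std1 setT = 1%E by exact: probability_setT.
have LX C : measurable C -> P (X @^-1` C) =
    std2 ((fun z : R * R => p * z.1 + q * z.2) @^-1` C).
  move=> mC; have := law (C `*` setT) (measurableX mC measurableT).
  have -> : (fun w => (X w, Y w)) @^-1` (C `*` setT) = X @^-1` C.
    by apply/seteqP; split=> w //= [].
  move=> ->; congr (std2 _).
  by apply/seteqP; split=> z //= [].
have LY C : measurable C -> P (Y @^-1` C) =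
    std2 ((fun z : R * R => r * z.2) @^-1` C).
  move=> mC; have := law (setT `*` C) (measurableX measurableT mC).
  have -> : (fun w => (X w, Y w)) @^-1` (setT `*` C) = Y @^-1` C.
    by apply/seteqP; split=> w //= [].
  move=> ->; congr (std2 _).
  by apply/seteqP; split=> z //= [].
have LXY : P (X @^-1` A `&` Y @^-1` B) =
    std2 ((fun z : R * R => p * z.1 + q * z.2) @^-1` A `&`
          (fun z : R * R => r * z.2) @^-1` B).
  exact: law (measurableX mA mB).
move/eqP : qr; rewrite mulf_eq0 => /orP[/eqP q0|/eqP r0].
  pose A' := (fun z : R => p * z) @^-1` A; pose B' := (fun z : R => r * z) @^-1` B.
  have mA' : measurable A' by exact: mul_pre.
  have mB' : measurable B' by exact: mul_pre.
  have EA : (fun z : R * R => p * z.1 + q * z.2) @^-1` A = A' `*` setT.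
    by apply/seteqP; split=> -[x y] /=; rewrite q0 mul0r addr0 // => -[].
  have EB : (fun z : R * R => r * z.2) @^-1` B = setT `*` B'.
    by apply/seteqP; split=> -[x y] //= [].
  have M C D : measurable C -> measurable D ->
      std2 (C `*` D) = (std1 C * std1 D)%E.
    exact: product_measure1E.
  rewrite LXY LX// LY// EA EB -setXI setIT setTI.
  by rewrite !M// !e mule1 mul1e.
have EB : (fun z : R * R => r * z.2) @^-1` B = (cst 0 : R * R -> R) @^-1` B.
  by apply/seteqP; split=> -[x y] /=; rewrite r0 mul0r.
rewrite LXY LX// LY// EB preimage_cst; case: ifP => _.
  by rewrite setIT [X in (_ * X)%E](probability_setT std2) mule1.
by rewrite setI0 !measure0 mule0.
Qed.

End GaussSums.

(** * Linear combinations of independent Brownian motions *)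

Section BrownianMix.
Context {R : realType} {d : measure_display} {Om : measurableType d}.
Variable P : probability Om R.

Lemma big_fiber (V : Type) (idx : V) (op : Monoid.com_law idx) (I K : finType)
    (f : K -> I) (p : pred I) (F : I -> V) : injective f ->
  (forall i, p i <-> exists k, f k = i) ->
  \big[op/idx]_(i | p i) F i = \big[op/idx]_k F (f k).
Proof.
move=> fi pf; rewrite -big_filter -(big_map f predT F).
apply: perm_big; apply: uniq_perm.
- by rewrite filter_uniq// index_enum_uniq.
- by rewrite map_inj_uniq// index_enum_uniq.
- move=> i; rewrite mem_filter mem_index_enum andbT; apply/idP/mapP.
    by move=> /pf[k <-]; exists k => //; rewrite mem_index_enum.
  by move=> [k _ ->]; apply/pf; exists k.
Qed.

Lemma indep_unit (G : unit -> set (set Om)) : (forall u, G u `<=` measurable) ->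
  indep P G.
Proof.
move=> mG E GE; have E1 (V : Type) (idx : V) (op : Monoid.com_law idx) F :
    \big[op/idx]_(u : unit) F u = F tt.
  by rewrite (bigD1 tt)//= big1 ?Monoid.mulm1// => -[].
by rewrite !E1 fineK// fin_num_measure//; exact: mG (GE tt).
Qed.

(** The pair (K, f) enumerates the fibre of h over j, so that independence
    inside a fibre can be proved over any convenient index type. *)
Lemma indep_refine (I J : finType) (h : I -> J) (G : I -> set (set Om))
    (H : J -> set (set Om)) :
  (forall j, pi_system (H j)) -> indep P H -> (forall i, G i `<=` H (h i)) ->
  (forall j, exists (K : finType) (f : K -> I), [/\ injective f,
     (forall i, h i = j <-> exists k, f k = i) & indep P (fun k => G (f k))]) ->
  indep P G.
Proof.
move=> piH iH GH within; apply: (indep_split (h := h) piH iH GH) => j E GE.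
have [K [f [fi fh iG]]] := within j.
have ph i : h i == j <-> exists k, f k = i by rewrite -fh; split=> /eqP.
by rewrite (big_fiber _ _ fi ph) (big_fiber _ _ fi ph); exact: iG.
Qed.

Lemma mutually_independentP (s : seq (set (set Om))) :
  mutually_independent P s <-> indep P (fun i : 'I_(size s) => nth set0 s i).
Proof.
split=> [H E HE|H E HE]; last exact: (H (fun i => E i) (fun i => HE i (ltn_ord i))).
pose E' k := if insub k is Some i then E i else setT.
have E'E (i : 'I_(size s)) : E' i = E i.
  by rewrite /E'; case: insubP => [j _ /val_inj ->//|]; rewrite ltn_ord.
have -> : \big[setI/setT]_i E i = \big[setI/setT]_(i < size s) E' i.
  by apply: eq_bigr => i _; rewrite E'E.
have -> : \prod_i fine (P (E i)) = \prod_(i < size s) fine (P (E' i)).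
  by apply: eq_bigr => i _; rewrite E'E.
by apply: H => i si; have := HE (Ordinal si); rewrite -(E'E (Ordinal si)).
Qed.

Lemma continuous0P (f : R -> R) : {within `[0, +oo[, continuous f} <->
  forall x, 0 <= x -> forall e, 0 < e -> exists2 r, 0 < r &
    forall y, 0 <= y -> `|y - x| < r -> `|f y - f x| < e.
Proof.
split=> [/subspace_continuousP H x x0 e e0|H].
  have /H/cvgrPdist_lt/(_ e e0) : x \in `[0, +oo[ by rewrite in_itv/= x0.
  rewrite near_withinE => /nbhs_ballP[r /= r0 rH]; exists r => // y y0 yx.
  rewrite distrC; apply: rH; last by rewrite /= in_itv/= y0.
  by rewrite /ball/= distrC.
apply/subspace_continuousP => x; rewrite /= in_itv/= andbT => x0.
apply/cvgrPdist_lt => e e0; have [r r0 rH] := H x x0 e e0.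
rewrite near_withinE; apply/nbhs_ballP; exists r => // y.
rewrite /ball/= distrC => yx; rewrite in_itv/= andbT => y0.
by rewrite distrC; exact: rH.
Qed.

Definition process_gen (W : R -> Om -> R) : set (set Om) :=
  [set E | exists t (A : set R), [/\ 0 <= t, measurable A & E = W t @^-1` A] ].

Lemma process_gen_measurable (W : R -> Om -> R) :
  (forall t, 0 <= t -> measurable_fun setT (W t)) ->
  process_gen W `<=` measurable.
Proof.
move=> mW _ [t [A [t0 mA ->]]]; rewrite -[X in measurable X]setTI.
exact: mW.
Qed.

Lemma process_gmeas (W : R -> Om -> R) t : 0 <= t -> gmeas (process_gen W) (W t).
Proof. by move=> t0; apply: gmeas_rvs => _ [A mA ->]; exists t, A. Qed.

Lemma process_sigma_pi (W : R -> Om -> R) :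
  (forall t, 0 <= t -> measurable_fun setT (W t)) -> pi_system (process_sigma W).
Proof. by move=> mW; apply: sigma_pi_system; exact: process_gen_measurable. Qed.

Lemma centered_normal0 : centered_normal P (fun _ => 0) 0.
Proof.
split=> // A mA; rewrite eqxx diracE preimage_cst.
by case: ifP => _; rewrite ?probability_setT ?measure0.
Qed.

Lemma brownian_increment (W : R -> Om -> R) s t : standard_brownian P W ->
  0 <= s <= t -> centered_normal P (fun w => W t w - W s w) (t - s).
Proof.
move=> [_ _ _ nW _] /andP[s0]; rewrite le_eqVlt => /orP[/eqP <-|]; last exact: nW.
rewrite subrr; under [X in centered_normal _ X]eq_fun do rewrite subrr.
exact: centered_normal0.
Qed.

Section Mix.
Variables (J : finType) (B : J -> R -> Om -> R) (c : J -> R) (F0 : set (set Om)).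
Hypothesis bB : forall j, standard_brownian P (B j).
Hypothesis c0 : forall j, 0 <= c j.
Hypothesis piF0 : pi_system F0.
Hypothesis iB : indep P (fun o : option J =>
  if o is Some j then process_sigma (B j) else F0).

Definition mix (a : J -> R) (t : R) (w : Om) : R := \sum_j a j * B j (c j * t) w.

Let mB j t : 0 <= t -> measurable_fun setT (B j t).
Proof. by case: (bB j) => _ _ + _ _; apply. Qed.

Section Grid.
Variable t : nat -> R.
Hypothesis t0 : 0 <= t 0%N.
Hypothesis tS : forall k, t k <= t k.+1.
Variable n : nat.

Let tge0 k : 0 <= t k.
Proof. by elim: k => // k IH; exact: le_trans IH (tS k). Qed.

Definition dB (j : J) (k : nat) (w : Om) : R :=
  B j (c j * t k.+1) w - B j (c j * t k) w.

Definition dW (a : J -> R) (k : nat) (w : Om) : R :=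
  mix a (t k.+1) w - mix a (t k) w.

Let dWE a k : dW a k = fun w => \sum_j a j * dB j k w.
Proof.
apply/funext => w; rewrite /dW /mix -sumrB; apply: eq_bigr => j _.
by rewrite mulrBr.
Qed.

Let dB_normal j k : centered_normal P (dB j k) (c j * (t k.+1 - t k)).
Proof.
rewrite mulrBr; apply: brownian_increment; first exact: bB.
by rewrite mulr_ge0//= ler_wpM2l.
Qed.

Let mdB j k : measurable_fun setT (dB j k).
Proof. by case: (dB_normal j k). Qed.

Let G1 (o : option (J * 'I_n)) : set (set Om) :=
  if o is Some jk then rvs (dB jk.1 jk.2) else F0.

Let piG1 o : pi_system (G1 o).
Proof. by case: o => [[j k]|] //=; exact: rvs_pi. Qed.

Lemma indep_increments : indep P G1.
Proof.
apply: (indep_refine (h := fun o : option (J * 'I_n) => omap fst o) _ iB).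
- by move=> [j|] //; apply: process_sigma_pi; exact: mB.
- move=> [[j k]|] //=; apply: gmeas_sub.
  apply: measurable_funB; apply: process_gmeas; exact: mulr_ge0.
- move=> [j|]; last first.
    exists unit, (fun _ => None); split; first by move=> [] [].
      move=> [[j k]|]; split=> //=; by [case|exists tt|move=> _; exists tt].
    by apply: indep_unit => _; case: piF0.
  exists 'I_n, (fun k => Some (j, k)); split; first by move=> k l [].
    move=> [[j' k]|]; split=> //=; first by move=> [->]; exists k.
      by move=> [k' [-> _]].
    by case.
  + move=> E HE /=.
    have [k|A HA] := @choice 'I_n (set R)
        (fun k A => measurable A /\ E k = dB j k @^-1` A).
      by have [A mA ->] := HE k; exists A.
    pose A' k := if insub k is Some i then A i else setT.
    have A'E (i : 'I_n) : A' i = A i.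
      by rewrite /A'; case: insubP => [i' _ /val_inj ->//|]; rewrite ltn_ord.
    have mA' k : measurable (A' k).
      by rewrite /A'; case: insubP => // i _ _; case: (HA i).
    have EE (k : 'I_n) : E k =
        [set w | A' k (B j (c j * t k.+1) w - B j (c j * t k) w)].
      by case: (HA k) => _ ->; rewrite A'E.
    rewrite (eq_bigr _ (fun k _ => EE k)).
    rewrite (eq_bigr _ (fun k _ => congr1 (fun X => fine (P X)) (EE k))).
    case: (bB j) => _ _ _ _ /(_ n (fun k => c j * t k) A'); apply=> //.
      exact: mulr_ge0.
    by move=> k; exact: ler_wpM2l.
Qed.

Let dB_step a b k : indep P G1 -> (k < n)%N ->
  exists p q r : R, [/\ 0 <= p, 0 <= r,
    [/\ p ^+ 2 + q ^+ 2 = (\sum_j a j ^+ 2 * c j) * (t k.+1 - t k),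
        q * r = (\sum_j a j * b j * c j) * (t k.+1 - t k)
      & r ^+ 2 = (\sum_j b j ^+ 2 * c j) * (t k.+1 - t k)] &
    binlaw P (dW a k) (dW b k) p q r].
Proof.
move=> iG1 kn.
have iBk : indep P (fun j => rvs (dB j k)).
  apply: (@indep_inj _ _ _ P _ _ (fun j => Some (j, Ordinal kn)) G1) => //.
  by move=> j j' [].
rewrite !dWE !mulr_suml.
have [p [q [r [p0 r0 [E1 E2 E3] law]]]] := gauss_sums a b iBk (fun j => dB_normal j k).
exists p, q, r; split=> //; split.
- by rewrite E1; apply: eq_bigr => j _; rewrite mulrA.
- by rewrite E2; apply: eq_bigr => j _; rewrite mulrA.
- by rewrite E3; apply: eq_bigr => j _; rewrite mulrA.
Qed.

Let mdW a k : measurable_fun setT (dW a k).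
Proof.
by rewrite dWE; apply: measurable_sum => j; apply: measurable_funM.
Qed.

Lemma dW_normal a k : (k < n)%N -> \sum_j a j ^+ 2 * c j = 1 ->
  centered_normal P (dW a k) (t k.+1 - t k).
Proof.
move=> kn a1; have [p [q [r [_ r0 [_ _ E] law]]]] := dB_step a a indep_increments kn.
by rewrite -[t k.+1 - _]mul1r -a1 -E; apply: binlaw_snd r0 law; exact: mdW.
Qed.

Let h2 (o : option (J * 'I_n)) : option 'I_n := omap snd o.

Let G2 (o : option 'I_n) := <<s \bigcup_(i in [set i | h2 i = o]) G1 i >>.

Let indepG2 : indep P G2.
Proof. by apply: indep_group => //; exact: indep_increments. Qed.

Let G2m o : (\bigcup_(i in [set i | h2 i = o]) G1 i) `<=` measurable.
Proof. by move=> A [i _]; case: (piG1 i) => _ _; apply. Qed.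

Let dW_G2 a (k : 'I_n) : rvs (dW a k) `<=` G2 (Some k).
Proof.
apply: gmeas_sub; rewrite dWE.
by apply: gmeas_sum => j _; apply: gmeas_rvs => A gA; exists (Some (j, k)).
Qed.

Lemma indep_dW1 a : indep P (fun k : 'I_n => rvs (dW a k)).
Proof.
have : indep P (fun k : 'I_n => G2 (Some k)).
  have iS : injective (@Some 'I_n) by move=> k l [].
  by apply: (indep_inj iS _ indepG2) => o; exact: sigma_pi_system.
by apply: indep_sub => k; exact: dW_G2.
Qed.

(** Increments over the same step are uncorrelated, hence independent by
    [binlaw_indep]; increments over different steps come from independent
    increments of the B j. *)
Lemma indep_dW2 a b : \sum_j a j * b j * c j = 0 ->
  indep P (fun o : option ('I_n * bool) =>
    if o is Some (k, e) then rvs (dW (if e then a else b) k) else F0).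
Proof.
move=> ab.
apply: (indep_refine (h := fun o : option ('I_n * bool) => omap fst o) _ indepG2).
- by move=> o; exact: sigma_pi_system.
- move=> [[k e]|] /=; first exact: dW_G2.
  by move=> A FA; apply: sub_sigma_algebra; exists None.
- move=> [k|]; last first.
    exists unit, (fun _ => None); split; first by move=> [] [].
      move=> [[j e]|]; split=> //=; by [case|exists tt|move=> _; exists tt].
    by apply: indep_unit => _; case: piF0.
  exists bool, (fun e => Some (k, e)); split; first by move=> e e' [].
    move=> [[k' e]|]; split=> //=; first by move=> [->]; exists e.
      by move=> [e' [-> _]].
    by case.
  move=> E HE; rewrite !big_bool/=.
  have [A mA ->] := HE true; have [A' mA' ->] := HE false.
  have [p [q [r [_ r0 [_ E2 _] law]]]] := dB_step a b indep_increments (ltn_ord k).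
  rewrite ab mul0r in E2.
  rewrite (binlaw_indep (mdW a k) (mdW b k) E2 law mA mA') EFinM !fineK//.
    rewrite fin_num_measure// -[X in measurable X]setTI; exact: mdW.
  rewrite fin_num_measure// -[X in measurable X]setTI; exact: mdW.
Qed.

End Grid.

Lemma mix_measurable a t : 0 <= t -> measurable_fun setT (mix a t).
Proof.
move=> t0; apply: measurable_sum => j; apply: measurable_funM => //.
by apply: mB; exact: mulr_ge0.
Qed.

Lemma mix0 a w : mix a 0 w = 0.
Proof.
rewrite /mix big1// => j _; rewrite mulr0.
by case: (bB j) => -> _ _ _ _; rewrite mulr0.
Qed.

Lemma mix_brownian a : \sum_j a j ^+ 2 * c j = 1 -> standard_brownian P (mix a).
Proof.
move=> a1; split.
- exact: mix0.
- move=> w.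
  have -> : (fun t => mix a t w) = \sum_j (fun t => a j * B j (c j * t) w).
    by apply/funext => t; rewrite fct_sumE.
  apply: (big_ind (fun f : R -> R => {within `[0, +oo[, continuous f})).
  + by move=> x; exact: cst_continuous.
  + by move=> f g cf cg x; exact: continuousD (cf x) (cg x).
  + move=> j _; case: (bB j) => _ /(_ w)/continuous0P cB _ _ _.
    apply/continuous0P => x x0 e e0.
    have e' : 0 < e / (`|a j| + 1) by rewrite divr_gt0// ltr_wpDl.
    have [r r0 H] := cB (c j * x) (mulr_ge0 (c0 j) x0) _ e'.
    exists (r / (c j + 1)); first by rewrite divr_gt0// ltr_wpDl.
    move=> y y0; rewrite ltr_pdivlMr ?ltr_wpDl// => yx.
    have {}H : `|B j (c j * y) w - B j (c j * x) w| < e / (`|a j| + 1).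
      apply: H; first exact: mulr_ge0.
      rewrite -mulrBr normrM ger0_norm// (le_lt_trans _ yx)// mulrC.
      by rewrite ler_wpM2l// lerDl.
    rewrite -mulrBr normrM (@le_lt_trans _ _ ((`|a j| + 1) *
      `|B j (c j * y) w - B j (c j * x) w|))//.
      by rewrite ler_wpM2r// lerDl.
    by move: H; rewrite ltr_pdivlMr ?ltr_wpDl// mulrC.
- exact: mix_measurable.
- move=> s t s0 st.
  pose g k := if k is 0%N then s else t.
  have := @dW_normal g s0 _ 1%N a 0%N isT a1.
  apply; by case=> [|k] /=; rewrite ?lexx// ltW.
- move=> n t A t0 tS mA.
  have tge0 k : 0 <= t k by elim: k => // k IH; exact: le_trans IH (tS k).
  have := @indep_dW1 t t0 tS n a.
  move=> /(_ (fun k : 'I_n => [set w | A k (mix a (t k.+1) w - mix a (t k) w)])).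
  by apply => k; exists (A k).
Qed.

Let cyl (W : R -> Om -> R) : set (set Om) :=
  [set E | exists n (s : nat -> R) (A : nat -> set R),
    [/\ (forall i, 0 <= s i), (forall i, measurable (A i)) &
        E = \big[setI/setT]_(i < n) W (s i) @^-1` A i] ].

Let cyl_pi (W : R -> Om -> R) : (forall t, 0 <= t -> measurable_fun setT (W t)) ->
  pi_system (cyl W).
Proof.
move=> mW; split.
- by exists 0%N, (fun _ => 0), (fun _ => setT); split=> //; rewrite big_ord0.
- move=> _ _ [n [s [A [s0 mA ->]]]] [n' [s' [A' [s'0 mA' ->]]]].
  exists (n + n')%N, (fun i => if (i < n)%N then s i else s' (i - n)%N),
    (fun i => if (i < n)%N then A i else A' (i - n)%N); split.
  + by move=> i; case: ifP.
  + by move=> i; case: ifP.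
  + rewrite big_split_ord/=; congr (_ `&` _); apply: eq_bigr => i _.
      by rewrite ltn_ord.
    by rewrite ltnNge leq_addr/= addKn.
- move=> _ [n [s [A [s0 mA ->]]]]; apply: bigsetI_measurable => i _.
  by rewrite -[X in measurable X]setTI; exact: mW.
Qed.

Let cyl_gen (W : R -> Om -> R) : process_sigma W `<=` <<s cyl W >>.
Proof.
apply: smallest_sub; first exact: smallest_sigma_algebra.
move=> _ [t [A [t0 mA ->]]]; apply: sub_sigma_algebra.
by exists 1%N, (fun _ => t), (fun _ => A); split=> //; rewrite big_ord1.
Qed.

(** Events that depend on finitely many values of two processes can thus be
    expressed by the increments along one grid. *)
Lemma common_grid (s : seq R) : all (fun u => 0 <= u) s ->
  exists (t : nat -> R) (n : nat), [/\ t 0%N = 0, (forall k, t k <= t k.+1) &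
    forall u, u \in s -> exists2 k, (k <= n)%N & u = t k].
Proof.
move=> s0; pose L := sort <=%R (0 :: s); pose n := (size L).-1.
have szL : size L = n.+1 by rewrite /n size_sort.
have sL : sorted <=%R L by apply: sort_sorted; exact: le_total.
pose t k := nth 0 L (minn k n).
have tle k l : (k <= l)%N -> t k <= t l.
  move=> kl; apply: (sorted_leq_nth le_trans lexx 0 sL).
  - by rewrite inE szL ltnS geq_minr.
  - by rewrite inE szL ltnS geq_minr.
  - by rewrite leq_min geq_minr andbT (leq_trans (geq_minl _ _) kl).
have tidx u : u \in (0 :: s) -> exists2 k, (k <= n)%N & u = t k.
  move=> us; have uL : u \in L by rewrite mem_sort.
  have il : (index u L <= n)%N by rewrite -ltnS -szL index_mem.
  by exists (index u L) => //; rewrite /t (minn_idPl il) nth_index.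
exists t, n; split.
- apply/le_anti/andP; split.
    by have [k _ ->] := tidx 0 (mem_head _ _); exact: tle.
  have : t 0%N \in L by rewrite mem_nth// szL ltnS geq_minr.
  by rewrite mem_sort inE => /orP[/eqP -> //|]; exact/allP.
- by move=> k; exact: tle.
- by move=> u us; apply: tidx; rewrite inE us orbT.
Qed.

(** Cylinder events generate the sigma-algebra of a process, and two of them
    are determined by increments along a common grid, where [indep_dW2]
    applies. *)
Lemma mix_indep a b : \sum_j a j * b j * c j = 0 ->
  mutually_independent P [:: F0; process_sigma (mix a); process_sigma (mix b)].
Proof.
move=> ab; apply/mutually_independentP.
pose C := [:: F0; cyl (mix a); cyl (mix b)].
have piC (i : 'I_3) : pi_system (nth set0 C i).
  by move: i => [[|[|[|]]]] //= _; apply: cyl_pi; exact: mix_measurable.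
suff iC : indep P (fun i : 'I_3 => nth set0 C i).
  apply: (indep_sub _ (indep_sigma piC iC)) => -[[|[|[|]]]] //= _.
move=> E HE.
have := HE ord0; set i1 : 'I_3 := lift ord0 ord0; set i2 : 'I_3 := ord_max.
rewrite /= => F0E.
have [n [s [A [s0 mA E1]]]] := HE i1; have [n' [s' [A' [s'0 mA' E2]]]] := HE i2.
have [|t [N [t0 tS tin]]] := @common_grid
    ([seq s i | i <- iota 0 n] ++ [seq s' i | i <- iota 0 n']).
  by rewrite all_cat !all_map; apply/andP; split; apply/allP => i _ /=.
have t00 : 0 <= t 0%N by rewrite t0.
pose G3 (o : option ('I_N * bool)) :=
  if o is Some (k, e) then rvs (dW t (if e then a else b) k) else F0.
have iG3 : indep P G3 := indep_dW2 t00 tS ab.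
have tge0 k : 0 <= t k by elim: k => // k IH; exact: le_trans IH (tS k).
have mdW e k : measurable_fun setT (dW t e k).
  by apply: measurable_funB; exact: mix_measurable.
have piG3 o : pi_system (G3 o).
  by case: o => [[k e]|] //=; exact: rvs_pi.
pose h (o : option ('I_N * bool)) : 'I_3 :=
  if o is Some (_, e) then (if e then i1 else i2) else ord0.
have iH := indep_group (h := h) piG3 iG3.
have mixt e u j : u = t j -> (j <= N)%N ->
    gmeas (\bigcup_(i in [set i | h i = if e then i1 else i2]) G3 i)
      (mix (if e then a else b) u).
  move=> -> jN; set x := if e then a else b.
  have -> : mix x (t j) = fun w => \sum_(k < N | (k < j)%N) 1 * dW t x k w.
    apply/funext => w.
    rewrite -(big_ord_widen N (fun k => 1 * dW t x k w) jN).
    under eq_bigr do rewrite mul1r.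
    rewrite -(big_mkord xpredT (fun k => dW t x k w)) telescope_sumr//.
    by rewrite t0 mix0 subr0.
  apply: gmeas_sum => k _; apply: gmeas_rvs => B' gB'; exists (Some (k, e)) => //.
have HEi (i : 'I_3) : <<s \bigcup_(k in [set k | h k = i]) G3 k >> (E i).
  have bigI (F : set (set Om)) m (Q : 'I_m -> set Om) : (forall k, <<s F >> (Q k)) ->
      <<s F >> (\big[setI/setT]_k Q k).
    move=> HQ; elim/big_ind : _ => //.
    - exact: (@measurableT _ (g_sigma_algebraType F)).
    - by move=> X Y; exact: (@measurableI _ (g_sigma_algebraType F)).
  have : [\/ i = ord0, i = i1 | i = i2].
    by case: i => [[|[|[|]]]] //= p; [apply: Or31|apply: Or32|apply: Or33]; exact: val_inj.
  case=> ->.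
  - by apply: sub_sigma_algebra; exists None.
  - rewrite E1; apply: bigI => k.
    have [|j jN sj] := tin (s k).
      by rewrite mem_cat map_f// mem_iota ltn_ord.
    exact: gmeas_preimage (mixt true _ _ sj jN) (mA k).
  - rewrite E2; apply: bigI => k.
    have [|j jN sj] := tin (s' k).
      by rewrite mem_cat orbC map_f// mem_iota ltn_ord.
    exact: gmeas_preimage (mixt false _ _ sj jN) (mA' k).
exact: iH HEi.
Qed.

End Mix.
End BrownianMix.

(** * Continuous and cadlag functions on the half-line *)

Section RealInduction.
Context {R : realType}.

(** A form of the compactness of [0, T] that suits one-sided regularity: let s
    be the supremum of the b with Q 0 b; the left part of the local property
    gives Q 0 s, the right part excludes s < T. *)
Lemma real_induction (T : R) (Q : R -> R -> Prop) : 0 <= T ->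
  (forall a b c, a <= b -> b <= c -> Q a b -> Q b c -> Q a c) ->
  (forall x, 0 <= x <= T -> exists2 r, 0 < r &
     (forall a, 0 <= a <= x -> x - r < a -> Q a x) /\
     (forall b, x <= b <= T -> b < x + r -> Q x b)) ->
  Q 0 T.
Proof.
move=> T0 Qadd Qloc.
pose S := [set b | 0 <= b <= T /\ Q 0 b].
have Q00 : Q 0 0.
  have [|r r0 [H _]] := Qloc 0; first by rewrite lexx.
  by apply: H; rewrite ?lexx// sub0r oppr_lt0.
have S0 : S 0 by split=> //; rewrite lexx.
have ubS : ubound S T by move=> b [/andP[]].
have hsS : has_sup S by split; [exists 0|exists T].
set s := sup S.
have s0 : 0 <= s by apply: ub_le_sup => //; exists T.
have sT : s <= T by apply: ge_sup => //; exists 0.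
have [|r r0 [H1 H2]] := Qloc s; first by rewrite s0.
have Q0s : Q 0 s.
  have [b [/andP[b0 bT] Qb] sb] := sup_adherent r0 hsS.
  have bs : b <= s by apply: ub_le_sup; [exists T|split=> //; rewrite b0].
  by apply: (Qadd _ b) => //; apply: H1 => //; rewrite b0.
have [sTlt|Ts] := ltP s T; last by rewrite (_ : T = s)//; apply/le_anti; rewrite sT Ts.
pose c := Num.min (s + r / 2) T.
have sc : s < c by rewrite /c lt_min sTlt ltrDl divr_gt0.
have cT : c <= T by rewrite /c ge_min lexx orbT.
have Q0c : Q 0 c.
  apply: (Qadd _ s) => //; first exact: ltW.
  apply: H2; first by rewrite ltW.
  by rewrite (@le_lt_trans _ _ (s + r / 2))// ?/c ?ge_min ?lexx// ltrD2l; lra.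
have : c <= s.
  by apply: ub_le_sup; [exists T|split=> //; rewrite cT (le_trans s0)// ltW].
by rewrite leNgt sc.
Qed.

(** Paths are unconstrained at negative times, so continuity refers to the
    half-line only. *)
Definition cont0 (f : R -> R) := forall x, 0 <= x -> forall e, 0 < e ->
  exists2 r, 0 < r & forall y, 0 <= y -> `|y - x| < r -> `|f y - f x| < e.

Lemma cont0_cadlag (f : R -> R) : cont0 f -> cadlag f.
Proof.
move=> cf; split=> [t t0|t t0].
  apply/cvgrPdist_lt => e e0; have [r r0 H] := cf t t0 e e0.
  rewrite near_withinE; apply/nbhs_ballP; exists r => // y.
  rewrite /ball/= distrC => yt ty; rewrite distrC; apply: H => //.
  by rewrite (le_trans t0)// ltW.
apply/cvg_ex; exists (f t).
apply/cvgrPdist_lt => e e0; have [r r0 H] := cf t (ltW t0) e e0.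
rewrite near_withinE; apply/nbhs_ballP; exists (Num.min r t) => /=.
  by rewrite lt_min r0.
move=> y; rewrite /ball/= distrC lt_min => /andP[yt1 yt2] yt.
rewrite distrC; apply: H => //; move: yt2; rewrite ltr_norml; lra.
Qed.

Lemma cadlag_bounded (f : R -> R) (T : R) : cadlag f -> 0 <= T ->
  exists2 K, 0 <= K & forall t, 0 <= t <= T -> `|f t| <= K.
Proof.
move=> [rf lf] T0.
suff [K HK] : exists K, forall t, 0 <= t <= T -> `|f t| <= K.
  exists (Num.max K 0); first by rewrite le_max lexx orbT.
  by move=> t /HK tK; rewrite le_max tK.
apply: (@real_induction T (fun a b => exists K, forall t, a <= t <= b -> `|f t| <= K)) => //.
  move=> a b c ab bc [K HK] [L HL]; exists (Num.max K L) => t /andP[ta tc].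
  rewrite le_max; have [tb|bt] := leP t b; first by rewrite HK ?ta.
  by rewrite HL ?orbT// ltW.
move=> x /andP[x0 xT].
have [r1 r10 H1] : exists2 r, 0 < r & forall a, 0 <= a <= x -> x - r < a ->
    exists K, forall t, a <= t <= x -> `|f t| <= K.
  have [x00|xn0] := eqVneq x 0.
    exists 1 => // a /andP[a0 ax] _; exists `|f x| => t /andP[ta tx].
    by have -> : t = x by apply/le_anti; rewrite tx x00 (le_trans a0).
  have {}x0 : 0 < x by rewrite lt_neqAle eq_sym xn0.
  have /cvg_ex[l /cvgrPdist_lt/(_ 1 ltr01)] := lf x x0.
  rewrite near_withinE => /nbhs_ballP[r /= r0 H]; exists r => // a /andP[a0 ax] xa.
  exists (Num.max (`|l| + 1) `|f x|) => t /andP[ta tx]; rewrite le_max.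
  move: tx; rewrite le_eqVlt => /orP[/eqP ->|tx]; first by rewrite lexx orbT.
  apply/orP; left; have := H t _ tx; rewrite /ball/= gtr0_norm ?subr_gt0//.
  have -> : x - t < r by lra.
  move=> /(_ isT) lt1; have := ler_normB (f t) l; have := ler_normD (f t - l) l.
  by rewrite subrK [`|f t - l|]distrC; lra.
have [r2 r20 H2] : exists2 r, 0 < r & forall b, x <= b <= T -> b < x + r ->
    exists K, forall t, x <= t <= b -> `|f t| <= K.
  have /cvgrPdist_lt/(_ 1 ltr01) := rf x x0.
  rewrite near_withinE => /nbhs_ballP[r /= r0 H]; exists r => // b _ br.
  exists (`|f x| + 1) => t /andP[xt tb].
  move: xt; rewrite le_eqVlt => /orP[/eqP <-|xt]; first by rewrite lerDl.
  have := H t _ xt; rewrite /ball/= distrC gtr0_norm ?subr_gt0//.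
  have -> : t - x < r by lra.
  move=> /(_ isT) lt1; have := ler_normD (f t - f x) (f x).
  by rewrite subrK [`|f t - f x|]distrC; lra.
exists (Num.min r1 r2); first by rewrite lt_min r10.
split=> [a ax xa|b xb bx].
  by apply: H1 => //; apply: le_lt_trans xa; rewrite lerD2l lerN2 ge_min lexx.
by apply: H2 => //; apply: (lt_le_trans bx); rewrite lerD2l ge_min lexx orbT.
Qed.

Lemma cont0_uniform (f : R -> R) (T : R) : cont0 f -> 0 <= T -> forall e, 0 < e ->
  exists2 r, 0 < r & forall x y, 0 <= x <= T -> 0 <= y <= T -> `|y - x| < r ->
    `|f y - f x| < e.
Proof.
move=> cf T0 e e0.
suff [r r0 H] : exists2 r, 0 < r & forall x, 0 <= x <= T ->
    forall y, 0 <= y <= T -> `|y - x| < r -> `|f y - f x| < e.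
  by exists r => // x y xT yT; exact: H.
pose Q a b := exists2 r, 0 < r & forall x, a <= x <= b ->
    forall y, 0 <= y <= T -> `|y - x| < r -> `|f y - f x| < e.
apply: (@real_induction T Q) => //.
  move=> a b c ab bc [r r0 H] [s s0 G]; exists (Num.min r s); first by rewrite lt_min r0.
  move=> x /andP[ax xc] y yT; rewrite lt_min => /andP[xr xs].
  have [xb|bx] := leP x b; first by apply: H => //; rewrite ax.
  by apply: G => //; rewrite xc ltW.
move=> x /andP[x0 xT]; have e2 : 0 < e / 2 by rewrite divr_gt0.
have [r r0 H] := cf x x0 _ e2.
have K u y : 0 <= u -> `|u - x| < r / 2 -> 0 <= y <= T -> `|y - u| < r / 2 ->
    `|f y - f u| < e.
  move=> u0 ux /andP[y0 _] yu.
  have F1 : `|f u - f x| < e / 2 by apply: H => //; lra.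
  have F2 : `|f y - f x| < e / 2.
    by apply: H => //; have := ler_normD (y - u) (u - x); rewrite addrA subrK; lra.
  have := ler_normD (f y - f x) (f x - f u); rewrite addrA subrK [`|f x - f u|]distrC.
  by lra.
exists (r / 2); first by rewrite divr_gt0.
split=> [a /andP[a0 ax] xa|b /andP[xb bT] bx].
  exists (r / 2); first by rewrite divr_gt0.
  move=> u /andP[au ux] y yT yu; apply: K yu => //; first exact: le_trans a0 au.
  by rewrite distrC ger0_norm ?subr_ge0//; lra.
exists (r / 2); first by rewrite divr_gt0.
move=> u /andP[xu ub] y yT yu; apply: K yu => //; first exact: le_trans x0 xu.
by rewrite ger0_norm ?subr_ge0//; lra.
Qed.

End RealInduction.

Section CadlagIntegral.
Context {R : realType}.
Local Notation leb := (@lebesgue_measure R).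

Lemma measurable_truncn : measurable_fun setT (@Num.truncn R).
Proof.
move=> _ Y _; rewrite setTI.
have -> : @Num.truncn R @^-1` Y = \bigcup_(k in Y) (@Num.truncn R @^-1` [set k]).
  by apply/seteqP; split=> [x /= Yx|x [k Yk /= ->//]]; exists (Num.truncn x).
apply: bigcup_measurable => -[_|k _].
  have -> : @Num.truncn R @^-1` [set 0%N] = `]-oo, 1[%classic.
    apply/seteqP; split=> x /=; rewrite in_itv/=.
      by move=> x0; rewrite -[1]/(1%:R) ltNge; apply/negP => x1; move: x0; apply/eqP; rewrite -lt0n truncn_gt0.
    by move=> x1; apply/eqP; rewrite -leqn0 leqNgt truncn_gt0 -ltNge.
  exact: measurable_itv.
have -> : @Num.truncn R @^-1` [set k.+1] = `[k.+1%:R, k.+2%:R[%classic.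
  apply/seteqP; split=> x /=; rewrite in_itv/=.
    move=> xk; have x0 : 0 <= x.
      by rewrite leNgt; apply/negP => x0; move: xk; rewrite truncn_floor; case: ifP => // x0'; rewrite leNgt x0 in x0'.
    by have := truncn_itv x0; rewrite xk.
  by move=> /truncn_def.
exact: measurable_itv.
Qed.

(** By right-continuity the path is the limit of the step functions that
    sample it at the next point of the grid of mesh 1/n. *)
Lemma cadlag_measurable (f : R -> R) (T : R) : cadlag f -> 0 < T ->
  measurable_fun `[0, T[ f.
Proof.
move=> [rf _] T0.
pose g n (t : R) := f ((Num.truncn (t * n%:R)).+1%:R / n%:R).
apply: (measurable_fun_cvg (h := g)).
- move=> n; apply: measurable_funTS.
  have -> : g n = (fun k : nat => f (k.+1%:R / n%:R)) \o (@Num.truncn R) \o (fun t => t * n%:R).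
    by [].
  apply: measurableT_comp; last exact: measurable_funM.
  by apply: measurableT_comp => //; exact: measurable_truncn.
- move=> t; rewrite /= in_itv/= => /andP[t0 tT].
  apply/cvgrPdist_lt => e e0.
  have /cvgrPdist_lt/(_ e e0) := rf t t0.
  rewrite near_withinE => /nbhs_ballP[r /= r0 H].
  near=> n.
  have n0 : (0 : R) < n%:R.
    by rewrite ltr0n; near: n; exact: nbhs_infty_gt.
  have rn : r^-1 < n%:R by near: n; exact: nbhs_infty_gtr.
  have nr : n%:R^-1 < r by rewrite -[r]invrK ltf_pV2 ?posrE ?invr_gt0.
  have /truncn_itv/andP[k1 k2] : 0 <= t * n%:R by rewrite mulr_ge0// ltW.
  rewrite /g; set u := _ / n%:R.
  have tu : t < u by rewrite /u ltr_pdivlMr.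
  have ut : u <= t + n%:R^-1.
    by rewrite /u ler_pdivrMr// mulrDl mulVf ?gt_eqF// -natr1 lerD2r.
  apply: H => //.
  by rewrite /ball/= distrC gtr0_norm ?subr_gt0//; lra.
Unshelve. all: by end_near. Qed.

Lemma cadlag_integrable (f : R -> R) (a b : R) : cadlag f -> 0 <= a -> a <= b ->
  leb.-integrable `[a, b] (EFin \o f).
Proof.
move=> cf a0 ab; apply: (@integrableS _ _ _ leb `[0, b]%classic) => //.
  by apply: subset_itvr; rewrite bnd_simp.
have b0 : 0 <= b by exact: le_trans ab.
have mf : measurable_fun `[0, b] f.
  have b1 : 0 < b + 1 by rewrite ltr_wpDl.
  apply: (measurable_funS (E := `[0, b + 1[%classic)) => //.
    by apply: subset_itvl; rewrite bnd_simp ltrDl.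
  exact: cadlag_measurable.
have [K K0 HK] := cadlag_bounded cf b0.
apply: measurable_bounded_integrable => //.
  by rewrite [X in (X < _)%E]lebesgue_measure_itv/=; case: ifP; rewrite ltry.
exists K; split; first exact: num_real.
by move=> M KM t; rewrite /= in_itv/= => /HK tK; rewrite (le_trans tK)// ltW.
Qed.

Lemma Rintegral_increment (f : R -> R) (a b : R) : cadlag f -> 0 <= a -> a <= b ->
  \int[leb]_(s in `[0, b]) f s - \int[leb]_(s in `[0, a]) f s =
  \int[leb]_(s in `[a, b]) f s.
Proof.
move=> cf a0 ab; rewrite (Rintegral_itvB (x := a)) ?bnd_simp//; last first.
  by apply: cadlag_integrable => //; exact: le_trans ab.
rewrite Rintegral_itv_obnd_cbnd//.
apply: (@integrableS _ _ _ leb `[a, b]%classic) => //.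
  by apply: subset_itvr; rewrite bnd_simp.
exact: cadlag_integrable.
Qed.

Lemma Rintegral_left_end (f : R -> R) (a b e : R) : cadlag f -> 0 <= a -> a <= b ->
  (forall s, a <= s <= b -> `|f s - f a| <= e) ->
  `|\int[leb]_(s in `[a, b]) f s - (b - a) * f a| <= e * (b - a).
Proof.
move=> cf a0 ab H.
have If := cadlag_integrable cf a0 ab.
have mfin : (leb `[a, b] < +oo)%E.
  by rewrite [X in (X < _)%E]lebesgue_measure_itv/=; case: ifP; rewrite ltry.
have len : fine (leb `[a, b]) = b - a.
  rewrite lebesgue_measure_itv/= lte_fin; case: ltP => //= ba.
  by have -> : a = b by [apply/le_anti; rewrite ab]; rewrite subrr.
have Icst (c : R) : leb.-integrable `[a, b] (EFin \o cst c).
  apply: cadlag_integrable => //; apply: cont0_cadlag => x _ r r0.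
  by exists 1 => // y _ _; rewrite /cst subrr normr0.
have mI : measurable (`[a, b]%classic : set (measurableTypeR R)) by exact: measurable_itv.
have -> : (b - a) * f a = \int[leb]_(s in `[a, b]) f a.
  by rewrite Rintegral_cst// len mulrC.
rewrite -RintegralB//; last exact: Icst.
have Id : leb.-integrable `[a, b] (EFin \o (fun s => f s - f a)).
  by have := integrableB mI If (Icst (f a)); apply: eq_integrable.
apply: (le_trans (le_normr_Rintegral mI Id)).
apply: (@le_trans _ _ (\int[leb]_(s in `[a, b]) e)); last first.
  by rewrite Rintegral_cst// len.
apply: le_Rintegral => //.
- have := integrable_norm Id; apply: eq_integrable => //.
- exact: Icst.
Qed.

End CadlagIntegral.

(** * Variation of constants along a time grid *)

Section Flow.
Context {R : realType}.
Local Notation leb := (@lebesgue_measure R).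

Lemma cadlag_lin (f g : R -> R) (a b : R) : cadlag f -> cadlag g ->
  cadlag (fun s => a * f s + b * g s).
Proof.
move=> [rf lf] [rg lg]; split=> t t0.
  by apply: cvgD; apply: cvgMr; [exact: rf|exact: rg].
by apply: is_cvgD; apply: is_cvgMr; [exact: lf|exact: lg].
Qed.

Lemma cont0_lin (f g : R -> R) (a b : R) : cont0 f -> cont0 g ->
  cont0 (fun s => a * f s + b * g s).
Proof.
move=> cf cg x x0 e e0.
have ea : 0 < e / 2 / (`|a| + 1) by rewrite !divr_gt0// ltr_wpDl.
have eb : 0 < e / 2 / (`|b| + 1) by rewrite !divr_gt0// ltr_wpDl.
have [r r0 Hr] := cf x x0 _ ea; have [s s0 Hs] := cg x x0 _ eb.
exists (Num.min r s); first by rewrite lt_min r0.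
move=> y y0; rewrite lt_min => /andP[/(Hr _ y0) fr /(Hs _ y0) gs].
have -> : a * f y + b * g y - (a * f x + b * g x) =
  a * (f y - f x) + b * (g y - g x) by ring.
have B (u v : R) : `|v| < e / 2 / (`|u| + 1) -> `|u * v| < e / 2.
  rewrite ltr_pdivlMr ?ltr_wpDl// mulrDr mulr1 => H.
  by rewrite normrM mulrC (le_lt_trans _ H)// lerDl.
have := ler_normD (a * (f y - f x)) (b * (g y - g x)).
have := B _ _ fr; have := B _ _ gs; lra.
Qed.

Lemma cont0_ext (f g : R -> R) : (forall t, 0 <= t -> f t = g t) -> cont0 g -> cont0 f.
Proof.
move=> fg cg x x0 e e0; have [r r0 H] := cg x x0 e e0; exists r => // y y0 yx.
by rewrite !fg//; exact: H.
Qed.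

Lemma cont0_cst (c : R) : cont0 (fun _ => c).
Proof. by move=> x _ e e0; exists 1 => // y _ _; rewrite subrr normr0. Qed.

Lemma cont0_derive (f : R -> R) (df : R -> R) :
  (forall t : R, is_derive t 1 f (df t)) -> cont0 f.
Proof.
move=> df' x _ e e0.
have : {for x, continuous f}.
  apply: differentiable_continuous; apply/derivable1_diffP; by case: (df' x).
move=> /cvgrPdist_lt/(_ e e0)/nbhs_ballP[r /= r0 H]; exists r => // y _ yx.
by rewrite distrC; apply: H; rewrite /ball/= distrC.
Qed.

Lemma cont0_integral (f : R -> R) : cadlag f ->
  cont0 (fun t => \int[leb]_(s in `[0, t]) f s).
Proof.
move=> cf x x0 e e0; have x1 : 0 <= x + 1 by rewrite addr_ge0.
have [K K0 HK] := cadlag_bounded cf x1.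
have main u v : 0 <= u -> u <= v -> v <= x + 1 ->
    `|\int[leb]_(s in `[0, v]) f s - \int[leb]_(s in `[0, u]) f s| <= 3 * K * (v - u).
  move=> u0 uv vx; rewrite Rintegral_increment//.
  have := @Rintegral_left_end R f u v (2 * K) cf u0 uv.
  have fu : `|f u| <= K by apply: HK; rewrite u0 (le_trans uv).
  have H : forall s, u <= s <= v -> `|f s - f u| <= 2 * K.
    move=> s /andP[us sv]; have fs : `|f s| <= K.
      by apply: HK; rewrite (le_trans u0 us) (le_trans sv vx).
    by have := ler_normB (f s) (f u); lra.
  move=> /(_ H) L; set I := Rintegral _ _ _ in L *.
  have := ler_normD (I - (v - u) * f u) ((v - u) * f u); rewrite subrK.
  have : `|(v - u) * f u| <= K * (v - u).
    by rewrite normrM ger0_norm ?subr_ge0// mulrC ler_wpM2r// subr_ge0.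
  by lra.
exists (Num.min 1 (e / (3 * K + 1))).
  by rewrite lt_min ltr01/= divr_gt0// ltr_wpDl// mulr_ge0.
move=> y y0; rewrite lt_min => /andP[yx1]; rewrite ltr_pdivlMr ?ltr_wpDl ?mulr_ge0// => yx2.
have G d : 0 <= d -> d * (3 * K + 1) < e -> 3 * K * d < e by move=> d0; lra.
have [xy|yx] := leP x y.
  apply: le_lt_trans (main x y x0 xy _) _.
    by move: yx1; rewrite ltr_norml; lra.
  by apply: G; [lra|move: yx2; rewrite ger0_norm ?subr_ge0].
rewrite distrC; apply: le_lt_trans (main y x y0 (ltW yx) _) _; first lra.
by apply: G; [lra|move: yx2; rewrite distrC ger0_norm ?subr_ge0// ltW].
Qed.

(** The functions e1, k, e2 are the entries of exp(t M) for the matrix M with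
    rows (a, m) and (0, c); the three groups say that it is a semigroup, that
    it starts at the identity and that its derivative is M exp(t M). *)
Definition is_flow (a m c : R) (e1 e2 k : R -> R) : Prop :=
  [/\ forall s u, e1 (s + u) = e1 s * e1 u, forall s u, e2 (s + u) = e2 s * e2 u
    & forall s u, k (s + u) = e1 s * k u + k s * e2 u] /\
  [/\ e1 0 = 1, e2 0 = 1 & k 0 = 0] /\
  [/\ forall t : R, is_derive t 1 e1 (a * e1 t),
      forall t : R, is_derive t 1 e2 (c * e2 t)
    & forall t : R, is_derive t 1 k (a * k t + m * e2 t)].

Lemma derive_at0 (f : R -> R) (d e : R) : is_derive (0 : R) (1 : R) f d -> 0 < e ->
  exists2 r, 0 < r & forall h, 0 <= h < r -> `|f h - f 0 - d * h| <= e * h.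
Proof.
move=> fd e0.
have : (fun h : R => h^-1 *: ((f \o shift 0) (h *: (1 : R)) - f 0)) @ 0^' --> d.
  have <- : 'D_1 f 0 = d by case: fd.
  by case: fd => + _; rewrite /derivable /derive.
move=> /cvgrPdist_lt/(_ e e0); rewrite near_withinE => /nbhs_ballP[r /= r0 H].
exists r => // h /andP[]; rewrite le_eqVlt => /orP[/eqP <- _|h0 hr].
  by rewrite subrr mulr0 subr0 normr0 mulr0.
have := H h; rewrite /ball/= sub0r normrN gtr0_norm// => /(_ hr (lt0r_neq0 h0)).
rewrite /shift/= addr0 [_ *: 1]mulr1 => {}H.
have -> : f h - f 0 - d * h = - (h * (d - h^-1 *: (f h - f 0))).
  by rewrite -[_ *: _]/(h^-1 * _) mulrBr mulrA mulfV ?gt_eqF// mul1r; ring.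
by rewrite normrN normrM gtr0_norm// mulrC ler_wpM2r// ltW.
Qed.

Definition grid (t : R) (n i : nat) : R := i%:R * (t / n%:R).

Definition conv_sum (t : R) (e1 k : R -> R) (s1 s2 : R) (b1 b2 : R -> R) (n : nat) : R :=
  \sum_(i < n) (e1 (t - grid t n i.+1) * (s1 * (b1 (grid t n i.+1) - b1 (grid t n i)))
    + k (t - grid t n i.+1) * (s2 * (b2 (grid t n i.+1) - b2 (grid t n i)))).

(** By the semigroup law, the difference between the two sides telescopes into
    one residual per step of the grid. A residual is o(t/n), uniformly in the
    step, as q and z are continuous by their equations and the flow is
    differentiable at 0. *)
Lemma path_limit (a m c s1 s2 : R) (e1 e2 k q z b1 b2 : R -> R) (t : R) :
  is_flow a m c e1 e2 k -> cadlag q -> cadlag z -> cont0 b1 -> cont0 b2 ->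
  (forall u, 0 <= u -> q u = q 0 + \int[leb]_(s in `[0, u]) (a * q s + m * z s) + s1 * b1 u) ->
  (forall u, 0 <= u -> z u = z 0 + \int[leb]_(s in `[0, u]) (c * z s) + s2 * b2 u) ->
  0 <= t ->
  conv_sum t e1 k s1 s2 b1 b2 n @[n --> \oo] --> q t - (e1 t * q 0 + k t * z 0).
Proof.
move=> [[e1D e2D kD] [[e10 e20 k0] [de1 de2 dk]]] cq cz cb1 cb2 Eq Ez t0.
pose f s := a * q s + m * z s; pose g s := c * z s.
have cf : cadlag f by exact: cadlag_lin.
have cg : cadlag g.
  have -> : g = fun s => c * z s + 0 * z s by apply/funext => s; rewrite mul0r addr0.
  exact: cadlag_lin.
have contz : cont0 z.
  apply: (@cont0_ext _ (fun u => 1 * (1 * z 0 + 1 * \int[leb]_(s in `[0, u]) g s) + s2 * b2 u)).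
    by move=> u u0; rewrite Ez// !mul1r.
  apply: cont0_lin => //; apply: cont0_lin; first exact: cont0_cst.
  exact: cont0_integral.
have contq : cont0 q.
  apply: (@cont0_ext _ (fun u => 1 * (1 * q 0 + 1 * \int[leb]_(s in `[0, u]) f s) + s1 * b1 u)).
    by move=> u u0; rewrite Eq// !mul1r.
  apply: cont0_lin => //; apply: cont0_lin; first exact: cont0_cst.
  exact: cont0_integral.
have contf : cont0 f by exact: cont0_lin.
have contg : cont0 g.
  apply: (@cont0_ext _ (fun s => c * z s + 0 * z s)); last exact: cont0_lin.
  by move=> s _; rewrite mul0r addr0.
have [K [K0 Kq Kz]] : exists K, [/\ 0 <= K, forall s, 0 <= s <= t -> `|q s| <= K
    & forall s, 0 <= s <= t -> `|z s| <= K].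
  have [Kq Kq0 HKq] := cadlag_bounded cq t0; have [Kz Kz0 HKz] := cadlag_bounded cz t0.
  exists (Kq + Kz); split; first exact: addr_ge0.
    by move=> s /HKq; lra.
  by move=> s /HKz; lra.
have [L [L0 Le Lk]] : exists L, [/\ 0 <= L, forall s, 0 <= s <= t -> `|e1 s| <= L
    & forall s, 0 <= s <= t -> `|k s| <= L].
  have [Le Le0 HLe] := cadlag_bounded (cont0_cadlag (cont0_derive de1)) t0.
  have [Lk Lk0 HLk] := cadlag_bounded (cont0_cadlag (cont0_derive dk)) t0.
  exists (Le + Lk); split; first exact: addr_ge0.
    by move=> s /HLe; lra.
  by move=> s /HLk; lra.
apply/cvgrPdist_le => e e0.
pose C := t * (L * (2 + 3 * K)) + 1.
have C0 : 0 < C by rewrite ltr_wpDl// !mulr_ge0// addr_ge0// mulr_ge0.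
pose eps := e / C; have eps0 : 0 < eps by rewrite divr_gt0.
have [r1 r10 H1] := cont0_uniform contf t0 eps0.
have [r2 r20 H2] := cont0_uniform contg t0 eps0.
have [r3 r30 H3] := derive_at0 (de1 0) eps0.
have [r4 r40 H4] := derive_at0 (de2 0) eps0.
have [r5 r50 H5] := derive_at0 (dk 0) eps0.
pose r := Num.min (Num.min r1 r2) (Num.min r3 (Num.min r4 r5)).
have r0 : 0 < r by rewrite !lt_min r10 r20 r30 r40 r50.
near=> n.
have n0 : (0 : R) < n%:R by rewrite ltr0n; near: n; exact: nbhs_infty_gt.
have hr : t / n%:R < r.
  rewrite ltr_pdivrMr// mulrC -ltr_pdivrMr//; near: n; exact: nbhs_infty_gtr.
pose h := t / n%:R; have h0 : 0 <= h by rewrite divr_ge0// ltW.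
have hn : n%:R * h = t by rewrite /h mulrC divfK// gt_eqF.
have {hr} : h < r by [].
rewrite !lt_min => /andP[/andP[h1 h2] /andP[h3 /andP[h4 h5]]].
pose s i := grid t n i.
have sS i : s i.+1 = s i + h by rewrite /s /grid -natr1 mulrDl mul1r.
have s0 : s 0%N = 0 by rewrite /s /grid mul0r.
have sn : s n = t by rewrite /s /grid.
have sle i : (i <= n)%N -> 0 <= s i <= t.
  move=> i_n; rewrite /s /grid mulr_ge0//= -[leRHS]hn ler_wpM2r//.
  by rewrite ler_nat.
pose A i := e1 (t - s i) * q (s i) + k (t - s i) * z (s i).
pose rq i := q (s i.+1) - e1 h * q (s i) - k h * z (s i) - s1 * (b1 (s i.+1) - b1 (s i)).
pose rz i := z (s i.+1) - e2 h * z (s i) - s2 * (b2 (s i.+1) - b2 (s i)).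
have step i : A i.+1 - A i =
    e1 (t - s i.+1) * (s1 * (b1 (s i.+1) - b1 (s i)))
    + k (t - s i.+1) * (s2 * (b2 (s i.+1) - b2 (s i)))
    + (e1 (t - s i.+1) * rq i + k (t - s i.+1) * rz i).
  have e1S : e1 (t - s i) = e1 (t - s i.+1) * e1 h by rewrite -e1D sS; congr e1; ring.
  have kS : k (t - s i) = e1 (t - s i.+1) * k h + k (t - s i.+1) * e2 h.
    by rewrite -kD sS; congr k; ring.
  by rewrite /A e1S kS /rq /rz; ring.
have tele : q t - (e1 t * q 0 + k t * z 0) - conv_sum t e1 k s1 s2 b1 b2 n =
    \sum_(i < n) (e1 (t - s i.+1) * rq i + k (t - s i.+1) * rz i).
  have -> : q t - (e1 t * q 0 + k t * z 0) = \sum_(i < n) (A i.+1 - A i).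
    rewrite -(big_mkord xpredT (fun i => A i.+1 - A i)) telescope_sumr//.
    by rewrite /A sn s0 subrr subr0 e10 k0 mul1r mul0r addr0.
  rewrite /conv_sum -sumrB; apply: eq_bigr => i _; rewrite step /s; ring.
rewrite tele.
have bnd i : (i < n)%N -> `|e1 (t - s i.+1) * rq i + k (t - s i.+1) * rz i| <=
    L * (2 + 3 * K) * eps * h.
  move=> i_n; have /andP[si0 sit] := sle i (ltnW i_n).
  have /andP[si1 sit1] := sle i.+1 i_n.
  have ss : s i <= s i.+1 by rewrite sS lerDl.
  have ssh : s i.+1 - s i = h by rewrite sS addrAC subrr add0r.
  have Bq : `|rq i| <= eps * h + eps * h * K + eps * h * K.
    have If := @Rintegral_left_end R f _ _ eps cf si0 ss.
    have {}If : `|\int[leb]_(u in `[s i, s i.+1]) f u - h * f (s i)| <= eps * h.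
      rewrite -ssh; apply: If => u /andP[su us]; apply/ltW/H1; first by rewrite si0.
        by rewrite (le_trans si0 su) (le_trans us).
      by rewrite ger0_norm ?subr_ge0//; apply: le_lt_trans h1; rewrite -ssh lerD2r.
    have inc : q (s i.+1) - q (s i) =
        \int[leb]_(u in `[s i, s i.+1]) f u + s1 * (b1 (s i.+1) - b1 (s i)).
      by rewrite -(Rintegral_increment cf si0 ss) (Eq _ si1) (Eq _ si0); ring.
    have -> : rq i = (\int[leb]_(u in `[s i, s i.+1]) f u - h * f (s i))
        - (e1 h - e1 0 - a * e1 0 * h) * q (s i)
        - (k h - k 0 - (a * k 0 + m * e2 0) * h) * z (s i).
      rewrite /rq -[q (s i.+1)](subrK (q (s i))) inc /f e10 e20 k0; ring.
    apply: le_trans (ler_normB _ _) _; apply: lerD.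
      apply: le_trans (ler_normB _ _) _; apply: lerD => //.
      by rewrite normrM ler_pM// ?H3 ?h0// Kq// si0.
    by rewrite normrM ler_pM// ?H5 ?h0// Kz// si0.
  have Bz : `|rz i| <= eps * h + eps * h * K.
    have If := @Rintegral_left_end R g _ _ eps cg si0 ss.
    have {}If : `|\int[leb]_(u in `[s i, s i.+1]) g u - h * g (s i)| <= eps * h.
      rewrite -ssh; apply: If => u /andP[su us]; apply/ltW/H2; first by rewrite si0.
        by rewrite (le_trans si0 su) (le_trans us).
      by rewrite ger0_norm ?subr_ge0//; apply: le_lt_trans h2; rewrite -ssh lerD2r.
    have inc : z (s i.+1) - z (s i) =
        \int[leb]_(u in `[s i, s i.+1]) g u + s2 * (b2 (s i.+1) - b2 (s i)).
      by rewrite -(Rintegral_increment cg si0 ss) (Ez _ si1) (Ez _ si0); ring.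
    have -> : rz i = (\int[leb]_(u in `[s i, s i.+1]) g u - h * g (s i))
        - (e2 h - e2 0 - c * e2 0 * h) * z (s i).
      rewrite /rz -[z (s i.+1)](subrK (z (s i))) inc /g e20; ring.
    apply: le_trans (ler_normB _ _) _; apply: lerD => //.
    by rewrite normrM ler_pM// ?H4 ?h0// Kz// si0.
  have ts : 0 <= t - s i.+1 <= t by lra.
  have := ler_pM (normr_ge0 _) (normr_ge0 _) (Le _ ts) Bq.
  have := ler_pM (normr_ge0 _) (normr_ge0 _) (Lk _ ts) Bz.
  have := ler_normD (e1 (t - s i.+1) * rq i) (k (t - s i.+1) * rz i).
  by rewrite !normrM; set u1 := `|_|; set u2 := _ * _; set u3 := _ * _; nra.
apply: le_trans (ler_norm_sum _ _ _) _.
apply: (@le_trans _ _ (\sum_(i < n) L * (2 + 3 * K) * eps * h)).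
  by apply: ler_sum => i _; exact: bnd.
rewrite sumr_const card_ord -[_ *+ n]mulr_natr.
have -> : L * (2 + 3 * K) * eps * h * n%:R = (t * (L * (2 + 3 * K))) * eps.
  by rewrite -[in RHS]hn; ring.
rewrite /eps mulrA ler_pdivrMr// mulrC ler_wpM2l//; first exact: ltW.
by rewrite /C lerDl.
Unshelve. all: by end_near. Qed.

End Flow.

(** * The flow of a triangular drift matrix and the limits of the variances *)

Section FlowVariance.
Context {R : realType}.

Lemma cvg_expR_lin (a : R) : a < 0 -> expR (a * t) @[t --> +oo] --> (0 : R).
Proof.
move=> a0; apply/cvgrPdist_lt => e e0; near=> t.
rewrite sub0r normrN gtr0_norm ?expR_gt0//.
have t0 : 0 < - a * t + 1.
  rewrite ltr_wpDl// mulr_ge0 ?oppr_ge0 ?(ltW a0)//; near: t; apply: nbhs_pinfty_ge; exact: num_real.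
have ineq : - a * t + 1 <= expR (- (a * t)).
  by rewrite addrC mulNr expR_ge1Dx.
have -> : expR (a * t) = (expR (- (a * t)))^-1 by rewrite -expRN opprK.
rewrite -[e]invrK ltf_pV2 ?posrE ?expR_gt0 ?invr_gt0//.
apply: lt_le_trans ineq.
rewrite -ltrBlDr mulrC -ltr_pdivrMr ?oppr_gt0//.
near: t; apply: nbhs_pinfty_gt; exact: num_real.
Unshelve. all: by end_near. Qed.

Lemma cvg_mul_expR_lin (a : R) : a < 0 -> t * expR (a * t) @[t --> +oo] --> (0 : R).
Proof.
move=> a0; have a20 : a / 2 < 0 by rewrite pmulr_llt0// invr_gt0.
have H : (- (a / 2))^-1 * expR (a / 2 * t) @[t --> +oo] --> (0 : R).
  by rewrite -[X in _ --> X](mulr0 (- (a / 2))^-1); apply: cvgMr; exact: cvg_expR_lin.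
apply: (squeeze_cvgr _ (cvg_cst (0 : R)) H).
near=> t.
have t0 : 0 <= t by near: t; apply: nbhs_pinfty_ge; exact: num_real.
rewrite mulr_ge0 ?expR_ge0//=.
have ineq : - (a / 2) * t <= expR (- (a / 2 * t)).
  by apply: le_trans (expR_ge1Dx _); rewrite mulNr lerDr.
have -> : expR (a * t) = expR (a / 2 * t) * expR (a / 2 * t) by rewrite -expRD; congr expR; field.
rewrite mulrA ler_wpM2r ?expR_ge0//.
rewrite -[X in _ <= X]mulr1 ler_pdivlMl ?oppr_gt0// mulrA.
rewrite [leRHS](_ : 1 = expR (- (a / 2 * t)) * expR (a / 2 * t)); last first.
  by rewrite -expRD addNr expR0.
by apply: ler_wpM2r => //; exact: expR_ge0.
Unshelve. all: by end_near. Qed.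

(** The entry k is m (e1 - e2) / (a - c), or m t e1 in the limiting case a =
    c. The second property expresses that M commutes with exp(t M). *)
Lemma flow_exists (a m c : R) : a < 0 -> c < 0 -> exists e1 e2 k : R -> R,
  [/\ is_flow a m c e1 e2 k, forall t, (a - c) * k t = m * (e1 t - e2 t),
      forall t, 0 < t -> e2 t ^+ 2 < 1 &
  [/\ e1 t @[t --> +oo] --> (0 : R), e2 t @[t --> +oo] --> (0 : R)
    & k t @[t --> +oo] --> (0 : R)] ].
Proof.
move=> a0 c0.
have lt1 (t : R) : 0 < t -> expR (c * t) ^+ 2 < 1.
  by move=> t0; rewrite expr_lt1 ?expR_ge0// expR_lt1 pmulr_llt0.
have D (b : R) : forall t : R, is_derive t 1 (fun t => expR (b * t)) (b * expR (b * t)).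
  move=> t; apply: is_derive_eq; rewrite /GRing.scale/=; ring.
exists (fun t => expR (a * t)), (fun t => expR (c * t)).
have [ac|ac] := eqVneq a c.
  exists (fun t => m * (t * expR (a * t))); split.
  - split; last split.
    + by split=> s u; rewrite ?mulrDr ?expRD// -ac; ring.
    + by rewrite /= !mulr0 expR0 mul0r mulr0.
    + by split=> t; rewrite -?ac; first [exact: D|apply: is_derive_eq; rewrite /GRing.scale/=; ring].
  - by move=> t; rewrite -ac !subrr !mulr0 mul0r.
  - exact: lt1.
  split.
  - exact: cvg_expR_lin.
  - exact: cvg_expR_lin.
  - by rewrite -[X in _ --> X](mulr0 m); apply: cvgMr; exact: cvg_mul_expR_lin.
have ac' : a - c != 0 by rewrite subr_eq0.
exists (fun t => m / (a - c) * (expR (a * t) - expR (c * t))); split.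
- split; last split.
  + by split=> s u; rewrite ?mulrDr ?expRD//; ring.
  + by rewrite /= !mulr0 expR0 subrr mulr0.
  + by split=> t; first [exact: D|apply: is_derive_eq; rewrite /GRing.scale/=; field].
- by move=> t; field.
- exact: lt1.
split.
- exact: cvg_expR_lin.
- exact: cvg_expR_lin.
- rewrite -[X in _ --> X](mulr0 (m / (a - c))); apply: cvgMr.
  by rewrite -[X in _ --> X](subrr 0); apply: cvgB; exact: cvg_expR_lin.
Qed.

Lemma riemann_sum (F f : R -> R) (t : R) :
  (forall s : R, is_derive s 1 F (f s)) -> cont0 f -> 0 <= t ->
  \sum_(i < n) (t / n%:R) * f (t - grid t n i.+1) @[n --> \oo] --> F t - F 0.
Proof.
move=> dF cf t0; apply/cvgrPdist_le => e e0.
have e10 : 0 < e / (t + 1) by rewrite divr_gt0// ltr_wpDl.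
have [r r0 Hr] := cont0_uniform cf t0 e10.
near=> n.
have n0 : (0 : R) < n%:R by rewrite ltr0n; near: n; exact: nbhs_infty_gt.
have hr : t / n%:R < r.
  rewrite ltr_pdivrMr// mulrC -ltr_pdivrMr//; near: n; exact: nbhs_infty_gtr.
set h := t / n%:R in hr *; have h0 : 0 <= h by rewrite divr_ge0// ltW.
have hn : n%:R * h = t by rewrite /h mulrC divfK// gt_eqF.
pose s i := grid t n i.
have sS i : s i.+1 = s i + h by rewrite /s /grid -natr1 mulrDl mul1r.
have s0 : s 0%N = 0 by rewrite /s /grid mul0r.
have sn : s n = t by rewrite /s /grid.
have sle i : (i <= n)%N -> 0 <= s i <= t.
  move=> i_n; rewrite /s /grid mulr_ge0//= -[leRHS]hn ler_wpM2r//.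
  by rewrite ler_nat.
have -> : F t - F 0 = \sum_(i < n) (F (t - s i) - F (t - s i.+1)).
  rewrite -(big_mkord xpredT (fun i => F (t - s i) - F (t - s i.+1))).
  under eq_bigr do rewrite -opprB.
  by rewrite sumrN telescope_sumr// sn s0 subrr subr0 opprB.
rewrite -sumrB; apply: le_trans (ler_norm_sum _ _ _) _.
apply: (@le_trans _ _ (\sum_(i < n) e / (t + 1) * h)); last first.
  rewrite sumr_const card_ord -[_ *+ n]mulr_natr -mulrA [h * _]mulrC hn.
  by rewrite mulrAC ler_pdivrMr ?ltr_wpDl// ler_wpM2l// ?(ltW e0)// lerDl.
apply: ler_sum => i _; have i_n := ltn_ord i.
have /andP[si0 sit] := sle i (ltnW i_n); have /andP[si1 sit1] := sle i.+1 i_n.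
move: h0; rewrite le_eqVlt => /orP[/eqP h0|h0].
  by rewrite -h0 mulr0 mul0r subr0 sS -h0 addr0 subrr normr0.
have u0 : 0 <= t - s i.+1 by rewrite subr_ge0.
have uE : t - s i = t - s i.+1 + h by rewrite sS; ring.
have uv : t - s i.+1 < t - s i by rewrite uE ltrDl.
have cF : {within `[t - s i.+1, t - s i], continuous F}.
  apply: continuous_subspaceT => x; apply: differentiable_continuous.
  by apply/derivable1_diffP; case: (dF x).
have [xi xiI ->] := MVT uv (fun x _ => dF x) cF.
move: xiI; rewrite in_itv/= => /andP[xi1 xi2].
have -> : t - s i - (t - s i.+1) = h by rewrite uE; ring.
rewrite -/(s i.+1) [f xi * h]mulrC -mulrBr normrM gtr0_norm// mulrC ler_wpM2r// ?(ltW h0)//.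
apply/ltW/Hr; [lra|lra|]; rewrite gtr0_norm ?subr_gt0//; apply: lt_trans hr; lra.
Unshelve. all: by end_near. Qed.

Lemma cont0M (f g : R -> R) : cont0 f -> cont0 g -> cont0 (fun s => f s * g s).
Proof.
move=> cf cg x x0 e e0.
pose K := `|f x| + `|g x| + 1.
have K0 : 0 < K by rewrite ltr_wpDl// addr_ge0.
have d0 : 0 < Num.min 1 (e / (2 * K)) by rewrite lt_min ltr01 divr_gt0// mulr_gt0.
have [r r0 Hr] := cf x x0 _ d0; have [s s0 Hs] := cg x x0 _ d0.
exists (Num.min r s); first by rewrite lt_min r0.
move=> y y0; rewrite lt_min => /andP[/(Hr _ y0) + /(Hs _ y0)].
rewrite !lt_min => /andP[f1 f2] /andP[g1 g2].
have -> : f y * g y - f x * g x = (f y - f x) * g y + f x * (g y - g x) by ring.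
have gy : `|g y| <= K.
  have := ler_normD (g y - g x) (g x); rewrite subrK /K.
  by have := normr_ge0 (f x); lra.
have fx : `|f x| <= K by rewrite /K; have := normr_ge0 (g x); lra.
have A1 : `|(f y - f x) * g y| <= `|f y - f x| * K by rewrite normrM ler_wpM2l.
have A2 : `|f x * (g y - g x)| <= `|g y - g x| * K by rewrite normrM mulrC ler_wpM2l.
move: f2 g2; rewrite !ltr_pdivlMr ?mulr_gt0// => f2 g2.
by have := ler_normD ((f y - f x) * g y) (f x * (g y - g x)); lra.
Qed.

(** Let Sigma have the entries A, C, C, B. By the Lyapunov equation M Sigma +
    Sigma M^T = - S S^T, the summand Phi S S^T Phi^T is the derivative of -
    Phi Sigma Phi^T. *)
Lemma convolution_variances (a m c s1 s2 A B C : R) (e1 e2 k : R -> R) (t : R) :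
  is_flow a m c e1 e2 k -> (forall t, (a - c) * k t = m * (e1 t - e2 t)) ->
  2 * (a * A + m * C) = - s1 ^+ 2 -> (a + c) * C + m * B = 0 ->
  2 * (c * B) = - s2 ^+ 2 -> 0 <= t ->
  [/\ \sum_(i < n) (t / n%:R) * ((e1 (t - grid t n i.+1) * s1) ^+ 2 + (k (t - grid t n i.+1) * s2) ^+ 2)
        @[n --> \oo] --> A - (e1 t ^+ 2 * A + 2 * (e1 t * k t) * C + k t ^+ 2 * B),
      \sum_(i < n) (t / n%:R) * (k (t - grid t n i.+1) * s2 * (e2 (t - grid t n i.+1) * s2))
        @[n --> \oo] --> C - (e1 t * e2 t * C + k t * e2 t * B)
    & \sum_(i < n) (t / n%:R) * (e2 (t - grid t n i.+1) * s2) ^+ 2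
        @[n --> \oo] --> B - e2 t ^+ 2 * B].
Proof.
move=> [_ [[e10 e20 k0] [de1 de2 dk]]] com L1 L2 L3 t0.
have c1 := cont0_derive de1; have c2 := cont0_derive de2; have ck := cont0_derive dk.
have cM (f : R -> R) s : cont0 f -> cont0 (fun u => f u * s).
  by move=> cf; apply: cont0M => //; exact: cont0_cst.
have cD (f g : R -> R) : cont0 f -> cont0 g -> cont0 (fun u => f u + g u).
  move=> cf cg; have := cont0_lin 1 1 cf cg; apply: cont0_ext => u _.
  by rewrite !mul1r.
have kE s : a * k s + m * e2 s = m * e1 s + c * k s by have := com s; lra.
have {}dk (s : R) : is_derive s 1 k (m * e1 s + c * k s) by rewrite -kE.
have E1 : s1 ^+ 2 = - (2 * (a * A + m * C)) by rewrite L1 opprK.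
have E3 : s2 ^+ 2 = - (2 * (c * B)) by rewrite L3 opprK.
split.
- pose F u := - (e1 u * e1 u * A + 2 * (e1 u * k u) * C + k u * k u * B).
  rewrite (_ : A - _ = F t - F 0); last by rewrite /F e10 k0; ring.
  apply: (riemann_sum (f := fun u => (e1 u * s1) ^+ 2 + (k u * s2) ^+ 2)) => //; last first.
    by apply: cD; apply: cont0M; exact: cM.
  move=> s; apply: is_derive_eq; rewrite /GRing.scale/= !exprMn E1 E3.
  by have := congr1 (fun x => 2 * e1 s * k s * x) L2; rewrite /= mulr0; lra.
- pose F u := - (e1 u * e2 u * C + k u * e2 u * B).
  rewrite (_ : C - _ = F t - F 0); last by rewrite /F e10 e20 k0; ring.
  apply: (riemann_sum (f := fun u => k u * s2 * (e2 u * s2))) => //; last by apply: cont0M; exact: cM.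
  move=> s; apply: is_derive_eq; rewrite /GRing.scale/=.
  have -> : k s * s2 * (e2 s * s2) = k s * e2 s * s2 ^+ 2 by ring.
  rewrite E3.
  by have := congr1 (fun x => e1 s * e2 s * x) L2; rewrite /= mulr0; lra.
- pose F u := - (e2 u * e2 u * B).
  rewrite (_ : B - _ = F t - F 0); last by rewrite /F e20; ring.
  apply: (riemann_sum (f := fun u => (e2 u * s2) ^+ 2)) => //; last by apply: cont0M; exact: cM.
  by move=> s; apply: is_derive_eq; rewrite /GRing.scale/= exprMn E3; ring.
Qed.

End FlowVariance.

(** * Laws on the plane are determined by bounded continuous functions *)

Section Plane.
Context {R : realType}.

Lemma measurable_floor_fiber (n : R) (k : int) :
  measurable [set x : R | Num.floor (n * x) = k].
Proof.
have -> : [set x : R | Num.floor (n * x) = k] =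
    (fun x => n * x) @^-1` `[k%:~R, (k + 1)%:~R[%classic.
  apply/seteqP; split=> x /=; rewrite in_itv/=.
    by move=> <-; exact: floor_itv.
  exact: floor_def.
rewrite -[X in measurable X]setTI.
have mM : measurable_fun setT (fun x : R => n * x) by exact: measurable_funM.
by apply: mM => //; exact: measurable_itv.
Qed.

Lemma continuous2_cvg (T : Type) (F : set_system T) {FF : Filter F} (f : R * R -> R)
    (u v : T -> R) (a b : R) : continuous f ->
  u x @[x --> F] --> a -> v x @[x --> F] --> b -> f (u x, v x) @[x --> F] --> f (a, b).
Proof.
move=> cf ua vb; apply: (@cvg_comp _ _ _ (fun x => (u x, v x)) f F (nbhs (a, b))).
  by apply: (@cvg_pair _ _ _ F (nbhs a) (nbhs b)).
exact: cf.
Qed.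

(** The function is the pointwise limit of the functions obtained by rounding
    the first coordinate down to the grid of mesh 1/n. *)
Lemma measurable_continuous2 (f : R * R -> R) : continuous f -> measurable_fun setT f.
Proof.
move=> cf.
have csec x : measurable_fun setT (fun y => f (x, y)).
  apply: continuous_measurable_fun => y.
  by apply: continuous2_cvg => //; exact: cvg_cst.
pose g n (z : R * R) := f ((Num.floor (n%:R * z.1))%:~R / n%:R, z.2).
apply: (measurable_fun_cvg (h := g)).
  move=> n _ Y mY; rewrite setTI.
  have -> : g n @^-1` Y = \bigcup_(k : int)
      ([set x : R | Num.floor (n%:R * x) = k] `*` ((fun y => f (k%:~R / n%:R, y)) @^-1` Y)).
    apply/seteqP; split=> [z /= Yz|z [k _ [/= <- //]]].
    by exists (Num.floor (n%:R * z.1)).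
  apply: countable_bigcupT_measurable => // k.
  apply: measurableX; first exact: measurable_floor_fiber.
  by rewrite -[X in measurable X]setTI; exact: csec.
move=> z _.
have : (Num.floor (n%:R * z.1))%:~R / n%:R @[n --> \oo] --> z.1.
  apply/cvgrPdist_lt => e e0; near=> n.
  have n0 : (0 : R) < n%:R by rewrite ltr0n; near: n; exact: nbhs_infty_gt.
  have en : e^-1 < n%:R by near: n; exact: nbhs_infty_gtr.
  have := floor_itv (n%:R * z.1); rewrite intrD/= => /andP[f1 f2].
  set F := (Num.floor _)%:~R in f1 f2 *.
  have -> : z.1 - F / n%:R = (n%:R * z.1 - F) / n%:R by field; rewrite gt_eqF.
  rewrite normrM normfV [`|n%:R|]gtr0_norm// ltr_pdivrMr//.
  have : 1 < e * n%:R by rewrite mulrC -ltr_pdivrMr// mul1r.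
  by rewrite ger0_norm ?subr_ge0//; lra.
move=> H; rewrite [z in f z]surjective_pairing.
by apply: continuous2_cvg => //; exact: cvg_cst.
Unshelve. all: by end_near. Qed.

(** Continuous approximations of the indicator of ]a, +oo[. *)
Definition ramp (a : R) (n : nat) (x : R) : R := Num.min 1 (n%:R * Num.max 0 (x - a)).

Lemma ramp_ge0 a n x : 0 <= ramp a n x.
Proof. by rewrite le_min ler01 mulr_ge0// le_max lexx. Qed.

Lemma ramp_le1 a n x : ramp a n x <= 1.
Proof. by rewrite ge_min lexx. Qed.

Lemma ramp_continuous a n : continuous (ramp a n).
Proof.
move=> x; apply: (@continuous_min R R (cst 1) (fun x => n%:R * Num.max 0 (x - a))).
  exact: cvg_cst.
apply: cvgMr; apply: (@continuous_max R R (cst 0) (fun x => x - a)); first exact: cvg_cst.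
by apply: cvgB; [exact: cvg_id|exact: cvg_cst].
Qed.

Lemma ramp_cvg a x : ramp a n x @[n --> \oo] --> (\1_(`]a, +oo[) x : R).
Proof.
apply: cvg_near_cst; rewrite indicE.
have [ax|xa] := ltP a x; last first.
  rewrite memNset ?/ramp /=; last by rewrite in_itv/= ltNge xa.
  apply: nearW => n; rewrite /ramp max_l ?subr_le0// mulr0 min_r//.
rewrite mem_set /=; last by rewrite in_itv/= ax.
near=> n; rewrite /ramp max_r ?subr_ge0 ?(ltW ax)// min_l//.
rewrite -ler_pdivrMr ?subr_gt0// mul1r ltW//; near: n; exact: nbhs_infty_gtr.
Unshelve. all: by end_near. Qed.

End Plane.

Lemma bounded_cvg_integral {R : realType} d (T : measurableType d)
    (mu : {measure set T -> \bar R}) (g : nat -> T -> R) (h : T -> R) (K : R) :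
  (mu setT < +oo)%E ->
  (forall n, measurable_fun setT (g n)) -> measurable_fun setT h ->
  (forall n w, `|g n w| <= K) ->
  {ae mu, forall w, g n w @[n --> \oo] --> h w} ->
  (\int[mu]_w (g n w)%:E @[n --> \oo] --> \int[mu]_w (h w)%:E)%E.
Proof.
move=> fin mg mh gK gh.
have ae1 : {ae mu, forall w, setT w -> (g ^~ w n)%:E @[n --> \oo] --> (h w)%:E}.
  by apply: filterS gh => w gw _; apply/cvg_EFin; [exact: nearW|exact: gw].
have ae2 : {ae mu, forall w n, setT w -> (`|(g n w)%:E| <= K%:E)%E}.
  by apply: aeW => w n _; rewrite lee_fin.
have iK : mu.-integrable setT (fun _ => K%:E).
  apply: measurable_bounded_integrable => //; exists `|K|; split; first exact: num_real.
  by move=> M KM t _; exact: ltW.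
have [_ _] := @dominated_convergence _ T R mu setT measurableT
  (fun n w => (g n w)%:E) (fun w => (h w)%:E) (fun _ => K%:E)
  (fun n => (measurable_EFinP _ _).2 (mg n)) ((measurable_EFinP _ _).2 mh) ae1 iK ae2.
exact.
Qed.

Section Approximable.
Context {R : realType}.

(** Events whose measure is determined by the integrals of continuous
    functions. They are closed under intersection and include the half-planes,
    hence generate the Borel sets. *)
Definition approximable (E : set (R * R)) : Prop := measurable E /\
  exists f : nat -> R * R -> R, [/\ forall n, continuous (f n),
    forall n z, 0 <= f n z <= 1 & forall z, f n z @[n --> \oo] --> (\1_E z : R)].

Lemma approximableT : approximable setT.
Proof.
split=> //; exists (fun _ => cst 1); split.
- by move=> n z; exact: cvg_cst.
- by move=> n z; rewrite ler01 lexx.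
- by move=> z; rewrite indicT; exact: cvg_cst.
Qed.

Lemma approximableI : setI_closed approximable.
Proof.
move=> A B [mA [f [cf f01 fA]]] [mB [g [cg g01 gB]]]; split; first exact: measurableI.
exists (fun n z => f n z * g n z); split.
- by move=> n z; apply: cvgM; [exact: cf|exact: cg].
- move=> n z; have /andP[f0 f1] := f01 n z; have /andP[g0 g1] := g01 n z.
  by rewrite mulr_ge0//= mulr_ile1.
- by move=> z; rewrite indicI; apply: cvgM; [exact: fA|exact: gB].
Qed.

Lemma approximable_ray (h : R * R -> R) (a : R) : continuous h ->
  approximable (h @^-1` `]a, +oo[).
Proof.
move=> ch; split.
  rewrite -[X in measurable X]setTI; apply: measurable_continuous2 => //.
exists (fun n z => ramp a n (h z)); split.
- by move=> n z; apply: (@continuous_comp _ _ _ h (ramp a n)); [exact: ch|exact: ramp_continuous].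
- by move=> n z; rewrite ramp_ge0 ramp_le1.
- by move=> z; exact: ramp_cvg.
Qed.

Lemma approximable_generates : @measurable _ (R * R)%type = <<s approximable >>.
Proof.
apply/seteqP; split; last by apply: smallest_sub; [exact: sigma_algebra_measurable|move=> A []].
have gen (h : R * R -> R) : continuous h ->
    @measurable_fun _ _ (g_sigma_algebraType approximable) R setT h.
  move=> ch; apply: (measurability _ (RGenOInfty.measurableE R)) => // _ [_ [a ->] <-].
  by rewrite setTI; apply: sub_sigma_algebra; exact: approximable_ray.
have cfst : continuous (@fst R R) by move=> z; exact: cvg_fst.
have csnd : continuous (@snd R R) by move=> z; exact: cvg_snd.
move=> A mA; rewrite -[A]setTI.
have := @measurable_fun_pair _ _ _ (g_sigma_algebraType approximable) _ _ _ _
  (gen _ cfst) (gen _ csnd).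
have -> : (fun z : R * R => (z.1, z.2)) = idfun by apply/funext => -[].
by move=> /(_ measurableT _ mA).
Qed.

End Approximable.

Lemma same_law_test {R : realType} d1 d2 (T1 : measurableType d1) (T2 : measurableType d2)
    (mu1 : {measure set T1 -> \bar R}) (mu2 : {measure set T2 -> \bar R})
    (X1 : T1 -> R * R) (X2 : T2 -> R * R) :
  (mu1 setT < +oo)%E -> (mu2 setT < +oo)%E ->
  measurable_fun setT X1 -> measurable_fun setT X2 ->
  (forall f : R * R -> R, continuous f -> (forall z, 0 <= f z <= 1) ->
     (\int[mu1]_w (f (X1 w))%:E = \int[mu2]_w (f (X2 w))%:E)%E) ->
  same_law mu1 X1 mu2 X2.
Proof.
move=> fin1 fin2 mX1 mX2 H A mA.
have Hap E : approximable E -> mu1 (X1 @^-1` E) = mu2 (X2 @^-1` E).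
  move=> [mE [f [cf f01 fE]]].
  have L d (T : measurableType d) (mu : {measure set T -> \bar R}) (X : T -> R * R) :
      (mu setT < +oo)%E -> measurable_fun setT X ->
      (\int[mu]_w (f n (X w))%:E @[n --> \oo] --> mu (X @^-1` E))%E.
    move=> fin mX.
    have mXE : measurable (X @^-1` E) by rewrite -[X in measurable X]setTI; exact: mX.
    rewrite -[X @^-1` E]setIT -(integral_indic mu measurableT mXE).
    apply: (@bounded_cvg_integral _ _ _ mu (fun n w => f n (X w)) _ 1) => //.
    - by move=> n; apply: measurableT_comp => //; exact: measurable_continuous2.
    - by move=> n w; have /andP[f0 f1] := f01 n (X w); rewrite ger0_norm.
    - by apply: aeW => w; exact: fE.
  have L1 := L _ _ mu1 X1 fin1 mX1; have L2 := L _ _ mu2 X2 fin2 mX2.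
  apply: cvg_unique L1 _ => //; apply: cvg_trans L2; apply: near_eq_cvg.
  by apply: nearW => n; rewrite H.
apply: (@measure_unique _ R (R * R)%type approximable (fun _ => setT)
  approximable_generates approximableI _ _ (pushforward mu1 (mfun_Sub (mem_set mX1)))
  (pushforward mu2 (mfun_Sub (mem_set mX2)))) => //.
- by move=> _; exact: approximableT.
- by apply/seteqP; split=> // w _; exists 0%N.
Qed.

(** Integrals of bounded continuous functions pass to the limit on both sides
    by dominated convergence. The measures are not assumed to be
    probabilities: for the restriction of P to an event E, the conclusion also
    yields independence of E. *)
Lemma same_law_limit {R : realType} d1 d2 (T1 : measurableType d1) (T2 : measurableType d2)
    (mu1 : {measure set T1 -> \bar R}) (mu2 : {measure set T2 -> \bar R})
    (X1 Y1 : nat -> T1 -> R) (X Y : T1 -> R)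
    (X2 Y2 : nat -> T2 -> R) (X' Y' : T2 -> R) :
  (mu1 setT < +oo)%E -> (mu2 setT < +oo)%E ->
  (forall n, measurable_fun setT (X1 n) /\ measurable_fun setT (Y1 n)) ->
  (forall n, measurable_fun setT (X2 n) /\ measurable_fun setT (Y2 n)) ->
  measurable_fun setT X /\ measurable_fun setT Y ->
  measurable_fun setT X' /\ measurable_fun setT Y' ->
  {ae mu1, forall w, X1 n w @[n --> \oo] --> X w /\ Y1 n w @[n --> \oo] --> Y w} ->
  {ae mu2, forall w, X2 n w @[n --> \oo] --> X' w /\ Y2 n w @[n --> \oo] --> Y' w} ->
  (\forall n \near \oo, same_law mu1 (fun w => (X1 n w, Y1 n w)) mu2 (fun w => (X2 n w, Y2 n w))) ->
  same_law mu1 (fun w => (X w, Y w)) mu2 (fun w => (X' w, Y' w)).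
Proof.
move=> fin1 fin2 m1 m2 [mX mY] [mX' mY'] ae1 ae2 laws.
apply: same_law_test => //; [exact: measurable_fun_pair|exact: measurable_fun_pair|].
move=> f cf f01; have mf := measurable_continuous2 cf.
have L d (T : measurableType d) (mu : {measure set T -> \bar R}) (U V : nat -> T -> R) (U' V' : T -> R) :
    (mu setT < +oo)%E -> (forall n, measurable_fun setT (U n) /\ measurable_fun setT (V n)) ->
    measurable_fun setT U' -> measurable_fun setT V' ->
    {ae mu, forall w, U n w @[n --> \oo] --> U' w /\ V n w @[n --> \oo] --> V' w} ->
    (\int[mu]_w (f (U n w, V n w))%:E @[n --> \oo] --> \int[mu]_w (f (U' w, V' w))%:E)%E.
  move=> fin mUV mU mV aeUV.
  apply: (@bounded_cvg_integral _ _ _ mu (fun n w => f (U n w, V n w)) _ 1) => //.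
  - by move=> n; have [mUn mVn] := mUV n; apply: measurableT_comp => //; exact: measurable_fun_pair.
  - by apply: measurableT_comp => //; exact: measurable_fun_pair.
  - by move=> n w; have /andP[f0 f1] := f01 (U n w, V n w); rewrite ger0_norm.
  - by apply: filterS aeUV => w [Uw Vw]; exact: continuous2_cvg.
have L1 := L _ _ _ _ _ _ _ fin1 m1 mX mY ae1.
have L2 := L _ _ _ _ _ _ _ fin2 m2 mX' mY' ae2.
apply: cvg_unique L1 _ => //; apply: cvg_trans L2; apply: near_eq_cvg.
apply: filterS laws => n law; have [mXn mYn] := m1 n; have [mX'n mY'n] := m2 n.
apply/esym; apply: (same_law_ge0 (f := fun z => (f z)%:E) _ _ law).
- exact: measurable_fun_pair.
- exact: measurable_fun_pair.
- exact/measurable_EFinP.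
- by move=> v; rewrite lee_fin; have /andP[] := f01 v.
Qed.

(** * The discretized noise *)

Section DiscreteNoise.
Context {R : realType} {d : measure_display} {Om : measurableType d}.
Variable P : probability Om R.
Variables (W1 W2 : R -> Om -> R) (F0 : set (set Om)).
Hypothesis bW1 : standard_brownian P W1.
Hypothesis bW2 : standard_brownian P W2.
Hypothesis piF0 : pi_system F0.
Hypothesis iW : mutually_independent P [:: F0; process_sigma W1; process_sigma W2].

Let W (b : bool) := if b then W2 else W1.

Let bW b : standard_brownian P (W b).
Proof. by case: b. Qed.

Let iWo : indep P (fun o : option bool => if o is Some b then process_sigma (W b) else F0).
Proof.
move/mutually_independentP : iW => /= iW'.
pose h (o : option bool) : 'I_3 :=
  if o is Some b then (if b then inord 2 else inord 1) else ord0.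
have hi : injective h.
  by move=> [[|]|] [[|]|] // /(congr1 val) /=; rewrite ?inordK.
have piW b : pi_system (process_sigma (W b)).
  by apply: process_sigma_pi; case: (bW b).
have pi3 (i : 'I_3) : pi_system (nth set0 [:: F0; process_sigma W1; process_sigma W2] i).
  by move: i => [[|[|[|]]]] //= _; [exact: (piW false)|exact: (piW true)].
have := indep_inj hi pi3 iW'; apply: indep_sub => -[[|]|] //=; by rewrite inordK.
Qed.

Variable t : R.
Hypothesis t0 : 0 <= t.

Let tg0 n : 0 <= grid t n 0.
Proof. by rewrite /grid mul0r. Qed.

Let tgS n k : grid t n k <= grid t n k.+1.
Proof. by rewrite /grid ler_wpM2r ?divr_ge0// ler_nat. Qed.

Let dWb n (jk : bool * 'I_n) := dB W (fun _ => 1) (grid t n) jk.1 jk.2.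

Let dWb_normal n (jk : bool * 'I_n) : centered_normal P (dWb jk) (t / n%:R).
Proof.
have -> : t / n%:R = 1 * grid t n jk.2.+1 - 1 * grid t n jk.2.
  by rewrite /grid -natr1; ring.
apply: brownian_increment; first exact: bW.
by rewrite !mul1r tgS andbT /grid mulr_ge0// divr_ge0.
Qed.

(** The Boolean selects the Brownian motion, the ordinal the step of the grid.
    *)
Lemma conv_sumE (e k : R -> R) (s1 s2 : R) n w :
  conv_sum t e k s1 s2 (W1 ^~ w) (W2 ^~ w) n =
  \sum_(jk : bool * 'I_n) (if jk.1 then k (t - grid t n jk.2.+1) * s2
     else e (t - grid t n jk.2.+1) * s1) * dWb jk w.
Proof.
rewrite /conv_sum big_split/= addrC.
rewrite -(pair_bigA _ (fun j (i : 'I_n) => (if j then k (t - grid t n i.+1) * s2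
     else e (t - grid t n i.+1) * s1) * dWb (j, i) w)) big_bool/=.
by congr (_ + _); apply: eq_bigr => i _; rewrite mulrA /dWb/= /dB !mul1r.
Qed.

Let sum_bool n (F : bool * 'I_n -> R) :
  \sum_jk F jk = \sum_(i < n) (F (false, i) + F (true, i)).
Proof.
rewrite big_split/= addrC (eq_bigr (fun jk => F (jk.1, jk.2))); last by move=> [].
by rewrite -(pair_bigA _ (fun j i => F (j, i))) big_bool.
Qed.

Lemma conv_sum_binlaw (e k e' k' : R -> R) (s1 s2 : R) n :
  exists p q r : R, [/\ 0 <= p, 0 <= r,
    [/\ p ^+ 2 + q ^+ 2 = \sum_(i < n) (t / n%:R) *
          ((e (t - grid t n i.+1) * s1) ^+ 2 + (k (t - grid t n i.+1) * s2) ^+ 2),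
        q * r = \sum_(i < n) (t / n%:R) *
          (e (t - grid t n i.+1) * s1 * (e' (t - grid t n i.+1) * s1)
           + k (t - grid t n i.+1) * s2 * (k' (t - grid t n i.+1) * s2))
      & r ^+ 2 = \sum_(i < n) (t / n%:R) *
          ((e' (t - grid t n i.+1) * s1) ^+ 2 + (k' (t - grid t n i.+1) * s2) ^+ 2)] &
    binlaw P (fun w => conv_sum t e k s1 s2 (W1 ^~ w) (W2 ^~ w) n)
      (fun w => conv_sum t e' k' s1 s2 (W1 ^~ w) (W2 ^~ w) n) p q r].
Proof.
have iG := indep_increments bW (fun _ => ler01) piF0 iWo (tg0 n) (tgS n) (n := n).
have iG' : indep P (fun jk : bool * 'I_n => rvs (dWb jk)).
  have iS : injective (@Some (bool * 'I_n)) by move=> x y [].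
  apply: (indep_inj iS _ iG) => -[jk|//]; apply: rvs_pi.
  by case: (dWb_normal jk).
pose a (e k : R -> R) (jk : bool * 'I_n) := if jk.1 then k (t - grid t n jk.2.+1) * s2
     else e (t - grid t n jk.2.+1) * s1.
have [p [q [r [p0 r0 [E1 E2 E3] law]]]] :=
  gauss_sums (a e k) (a e' k') iG' (@dWb_normal n).
exists p, q, r; split=> //; last first.
  move=> A mA; have := law A mA; congr (_ = _); congr (P (_ @^-1` A)).
  by apply/funext => w; rewrite !conv_sumE.
by rewrite E1 E2 E3 !sum_bool; split; apply: eq_bigr => i _; rewrite /a/=; ring.
Qed.

Lemma conv_sum_measurable (e k : R -> R) (s1 s2 : R) n :
  measurable_fun setT (fun w => conv_sum t e k s1 s2 (W1 ^~ w) (W2 ^~ w) n).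
Proof.
under eq_fun do rewrite conv_sumE.
apply: measurable_sum => jk; apply: measurable_funM => //.
by case: (dWb_normal jk).
Qed.

Lemma conv_sum_indep (e k e' k' : R -> R) (s1 s2 : R) n E A : F0 E -> measurable A ->
  let N w := (conv_sum t e k s1 s2 (W1 ^~ w) (W2 ^~ w) n,
     conv_sum t e' k' s1 s2 (W1 ^~ w) (W2 ^~ w) n) in
  P (N @^-1` A `&` E) = (P E * P (N @^-1` A))%E.
Proof.
move=> F0E mA N.
have mdWb (jk : bool * 'I_n) : measurable_fun setT (dWb jk) by case: (dWb_normal jk).
have iG := indep_increments bW (fun _ => ler01) piF0 iWo (tg0 n) (tgS n) (n := n).
pose h (o : option (bool * 'I_n)) := isSome o.
have piG o : pi_system (if o is Some jk then rvs (@dWb n jk) else F0).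
  by case: o => [jk|//]; exact: rvs_pi.
have iH := indep_group (h := h) piG iG.
set H := (fun b : bool => _) in iH.
have gN (e1 k1 : R -> R) : gmeas (\bigcup_(i in [set i | h i = true])
     (if i is Some jk then rvs (@dWb n jk) else F0))
     (fun w => conv_sum t e1 k1 s1 s2 (W1 ^~ w) (W2 ^~ w) n).
  have -> := funext (conv_sumE e1 k1 s1 s2 n).
  by apply: gmeas_sum => jk _; apply: gmeas_rvs => B gB; exists (Some jk).
have HN : H true (N @^-1` A).
  by apply: gmeas_preimage mA; apply: measurable_fun_pair; exact: gN.
have HE : H false E.
  by apply: sub_sigma_algebra; exists None.
pose E' (b : bool) := if b then N @^-1` A else E.
have := iH E'; rewrite !big_bool /E'; move=> -> ; last by case.
have mE : measurable E by case: piF0 => _ _; apply.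
have mN : measurable (N @^-1` A).
  rewrite -[X in measurable X]setTI; apply: measurable_fun_pair mA => //; exact: conv_sum_measurable.
by rewrite EFinM !fineK ?fin_num_measure// muleC.
Qed.

End DiscreteNoise.

Section NoiseLaw.
Context {R : realType}.

(** The Cholesky factor of the covariance matrix with rows (A, C) and (C, B),
    applied to z. *)
Definition chol (A C B : R) (z : R * R) : R * R :=
  (Num.sqrt (A - C ^+ 2 / B) * z.1 + C / Num.sqrt B * z.2, Num.sqrt B * z.2).

(** For B > 0 the triangular factor is a continuous function of the
    covariance, so the convergence of covariances implies that of the factors.
    *)
Lemma chol_unique (p q r A C B : R) : 0 <= p -> 0 <= r -> 0 < B ->
  p ^+ 2 + q ^+ 2 = A -> q * r = C -> r ^+ 2 = B ->
  [/\ p = Num.sqrt (A - C ^+ 2 / B), q = C / Num.sqrt B & r = Num.sqrt B].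
Proof.
move=> p0 r0 B0 <- <- BE.
have rE : r = Num.sqrt B by rewrite -BE sqrtr_sqr ger0_norm.
have rn0 : r != 0 by rewrite rE gt_eqF// sqrtr_gt0.
split=> //; last by rewrite -rE mulfK.
rewrite -BE exprMn mulfK ?expf_neq0// addrK sqrtr_sqr ger0_norm//.
Qed.

Lemma measurable_chol1 (A C B : R) : measurable_fun setT (fun z => (chol A C B z).1).
Proof. by apply: measurable_funD; apply: measurable_funM. Qed.

Lemma measurable_chol2 (A C B : R) : measurable_fun setT (fun z => (chol A C B z).2).
Proof. exact: measurable_funM. Qed.

Lemma chol_cvg (A C B : nat -> R) (A' C' B' : R) (z : R * R) : 0 < B' ->
  A n @[n --> \oo] --> A' -> C n @[n --> \oo] --> C' -> B n @[n --> \oo] --> B' ->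
  (chol (A n) (C n) (B n) z).1 @[n --> \oo] --> (chol A' C' B' z).1 /\
  (chol (A n) (C n) (B n) z).2 @[n --> \oo] --> (chol A' C' B' z).2.
Proof.
move=> B0 cA cC cB.
have sB : Num.sqrt (B n) @[n --> \oo] --> Num.sqrt B'.
  by apply: cvg_comp cB _; exact: sqrt_continuous.
split; last by apply: cvgMl.
apply: cvgD; apply: cvgMl.
  have cD : A n - C n ^+ 2 / B n @[n --> \oo] --> A' - C' ^+ 2 / B'; last first.
    by apply: cvg_comp cD _; exact: sqrt_continuous.
  apply: cvgB => //; apply: cvgM; first by apply: cvgM.
  by apply: cvgV => //; rewrite gt_eqF.
by apply: cvgM => //; apply: cvgV => //; rewrite gt_eqF// sqrtr_gt0.
Qed.

Context {d : measure_display} {Om : measurableType d}.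
Variable P : probability Om R.
Variables (W1 W2 : R -> Om -> R) (F0 : set (set Om)).
Hypothesis bW1 : standard_brownian P W1.
Hypothesis bW2 : standard_brownian P W2.
Hypothesis piF0 : pi_system F0.
Hypothesis iW : mutually_independent P [:: F0; process_sigma W1; process_sigma W2].
Variables (t : R) (e k e' k' : R -> R) (s1 s2 : R) (A C B : R) (NQ NZ : Om -> R).
Hypotheses (t0 : 0 <= t) (B0 : 0 < B).
Hypotheses (mNQ : measurable_fun setT NQ) (mNZ : measurable_fun setT NZ).
Hypothesis cN : {ae P, forall w,
  conv_sum t e k s1 s2 (W1 ^~ w) (W2 ^~ w) n @[n --> \oo] --> NQ w /\
  conv_sum t e' k' s1 s2 (W1 ^~ w) (W2 ^~ w) n @[n --> \oo] --> NZ w}.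
Hypothesis cA : \sum_(i < n) (t / n%:R) *
    ((e (t - grid t n i.+1) * s1) ^+ 2 + (k (t - grid t n i.+1) * s2) ^+ 2)
  @[n --> \oo] --> A.
Hypothesis cC : \sum_(i < n) (t / n%:R) *
    (e (t - grid t n i.+1) * s1 * (e' (t - grid t n i.+1) * s1)
      + k (t - grid t n i.+1) * s2 * (k' (t - grid t n i.+1) * s2))
  @[n --> \oo] --> C.
Hypothesis cB : \sum_(i < n) (t / n%:R) *
    ((e' (t - grid t n i.+1) * s1) ^+ 2 + (k' (t - grid t n i.+1) * s2) ^+ 2)
  @[n --> \oo] --> B.

(** [same_law_limit] is applied to the restriction of P to E and to the
    multiple P(E) of the standard law of the plane. This gives the law of the
    limit and its independence of E at once. *)
Lemma noise_law E D : F0 E -> measurable D ->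
  P ((fun w => (NQ w, NZ w)) @^-1` D `&` E) = (P E * std2 (chol A C B @^-1` D))%E.
Proof.
move=> F0E mD.
have mE : measurable E by case: piF0 => _ _; apply.
have c0 : 0 <= fine (P E) by exact: fine_ge0.
pose c : {nonneg R} := NngNum c0.
pose mu1 := mrestr P mE; pose mu2 := mscale c (@std2 R).
have fin1 : (mu1 setT < +oo)%E.
  by rewrite /mu1/= /mrestr setTI ltey_eq fin_num_measure.
have fin2 : (mu2 setT < +oo)%E.
  rewrite /mu2/= /mscale/= (_ : std2 setT = 1%E); last exact: probability_setT.
  by rewrite mule1 ltry.
move: cA cC cB; set An := fun n : nat => \sum_(i < n) _; set Cn := fun n : nat => \sum_(i < n) _.
set Bn := fun n : nat => \sum_(i < n) _ => cAn cCn cBn.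
have := @same_law_limit R _ _ _ _ mu1 mu2
  (fun n w => conv_sum t e k s1 s2 (W1 ^~ w) (W2 ^~ w) n)
  (fun n w => conv_sum t e' k' s1 s2 (W1 ^~ w) (W2 ^~ w) n) NQ NZ
  (fun n z => (chol (An n) (Cn n) (Bn n) z).1)
  (fun n z => (chol (An n) (Cn n) (Bn n) z).2)
  (fun z => (chol A C B z).1) (fun z => (chol A C B z).2) fin1 fin2.
move=> H; have {}H := H _ _ (conj mNQ mNZ) (conj (measurable_chol1 A C B) (measurable_chol2 A C B)).
have {H} law : same_law mu1 (fun w => (NQ w, NZ w)) mu2 (chol A C B).
  apply: H.
  - by move=> n; split; exact: (conv_sum_measurable bW1 bW2 t0).
  - by move=> n; split; [exact: measurable_chol1|exact: measurable_chol2].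
  - have [N [mN N0 HN]] := cN; exists N; split => //.
    rewrite /mu1/= /mrestr; apply/eqP; rewrite eq_le measure_ge0 andbT -N0.
    by apply: le_measure; rewrite ?inE//; exact: measurableI.
  - by apply: aeW => z; exact: chol_cvg.
  - have : \forall n \near \oo, 0 < Bn n by exact: cvgr_gt cBn _ B0.
    apply: filterS => n Bn0 D' mD'.
    have [p [q [r [p0 r0 [E1 E2 E3] law]]]] :=
      conv_sum_binlaw bW1 bW2 piF0 iW t0 e k e' k' s1 s2 n.
    have [pE qE rE] := chol_unique p0 r0 Bn0 E1 E2 E3.
    rewrite /mu1/= /mrestr (conv_sum_indep bW1 bW2 piF0 iW t0 e k e' k' s1 s2 n F0E mD').
    rewrite /mscale/= fineK ?fin_num_measure//; congr (_ * _)%E.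
    by rewrite (law _ mD') pE qE rE.
have := law _ mD; rewrite /mu1/= /mrestr => ->.
by rewrite /mscale/= fineK// fin_num_measure.
Qed.

End NoiseLaw.

(** * Second moments of normal variables *)

Section GaussianMoments.
Context {R : realType}.
Local Notation leb := (@lebesgue_measure R).
Local Open Scope ereal_scope.

(** The integrand times the density at x is the density at sqrt(1 + h) x. *)
Lemma std1_expR_sqr (h : R) : (0 <= h)%R ->
  \int[@std1 R]_x (expR (- (h * (x ^+ 2 / 2))))%:E = ((Num.sqrt (1 + h))^-1)%:E.
Proof.
move=> h0; set s := Num.sqrt _.
have s2 : (s ^+ 2 = 1 + h)%R by rewrite sqr_sqrtr// addr_ge0.
have s0 : (0 < s)%R by rewrite sqrtr_gt0 ltr_wpDr.
have mf : measurable_fun setT (fun x : R => (expR (- (h * (x ^+ 2 / 2))))%:E).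
  apply/measurable_EFinP; apply: measurableT_comp => //.
  apply: measurableT_comp => //; apply: measurable_funM => //.
  by apply: measurable_funM => //; exact: measurable_funX.
have mphi : measurable_fun setT (fun x : R => (normal_pdf 0 1 x)%:E).
  by apply/measurable_EFinP; exact: measurable_normal_pdf.
have f0 (x : R) : 0 <= (expR (- (h * (x ^+ 2 / 2))))%:E by rewrite lee_fin expR_ge0.
rewrite (std1_integral mf f0) (ge0_integral_normal 0 1 mf f0).
have E (x : R) : (expR (- (h * (x ^+ 2 / 2))))%:E * (normal_pdf 0 1 x)%:E =
    (normal_pdf 0 1 (s * x))%:E.
  rewrite -EFinM /normal_pdf oner_eq0 /normal_fun mulrCA -expRD.
  by congr (_ * expR _)%:E; rewrite !subr0 exprMn s2 expr1n; field.
under eq_integral do rewrite E.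
have N : \int[leb]_x (normal_pdf 0 1 x)%:E = 1 by apply: integral_normal_pdf; rewrite oner_neq0.
have := ge0_integral_scale s0 mphi (fun x => normal_pdf_ge0 0 1 x).
rewrite N => /(congr1 (fun e => (s^-1)%:E * e)).
by rewrite mule1 muleA -EFinM mulVf ?gt_eqF// mul1e => <-.
Qed.

(** With y = x^2 / 2, the quotients (1 - exp(- h y)) / h increase to y as h =
    2^-n decreases to 0. By monotone convergence, the mean of y is the limit
    of (1 - (1 + h)^(-1/2)) / h, which is 1/2. *)
Lemma std1_second_moment : \int[@std1 R]_x (x ^+ 2)%:E = 1.
Proof.
pose h n : R := (2 ^- n)%R.
have h0 n : (0 < h n)%R by rewrite invr_gt0 exprn_gt0.
have hS n : (h n.+1 = h n / 2)%R by rewrite /h exprS invfM mulrC.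
have h_cvg : h n @[n --> \oo] --> 0%R.
  have -> : h = (fun n => (2^-1) ^+ n)%R by apply/funext => n; rewrite exprVn.
  by apply: cvg_expr; rewrite gtr0_norm ?invr_gt0// invf_lt1// ltr1n.
pose y (x : R) : R := (x ^+ 2 / 2)%R.
have y0 x : (0 <= y x)%R by rewrite divr_ge0// sqr_ge0.
pose g n x : R := ((1 - expR (- (h n * y x))) / h n)%R.
have my : measurable_fun setT y by apply: measurable_funM => //; exact: measurable_funX.
have me n : measurable_fun setT (fun x => expR (- (h n * y x))).
  apply: measurableT_comp => //; apply: measurableT_comp => //.
  exact: measurable_funM.
have mg n : measurable_fun setT (fun x => (g n x)%:E).
  apply/measurable_EFinP; apply: measurable_funM => //; exact: measurable_funB.
have e1 n x : (expR (- (h n * y x)) <= 1)%R.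
  by rewrite expR_le1 oppr_le0 mulr_ge0// ltW.
have g0 n x : (0 <= g n x)%R by rewrite divr_ge0 ?(ltW (h0 n))// subr_ge0.
have nd x : {homo (fun n => (g n x)%:E) : n m / (n <= m)%N >-> n <= m}.
  apply/nondecreasing_seqP => n; rewrite lee_fin /g hS.
  set u := expR (- (h n / 2 * y x)).
  have -> : expR (- (h n * y x)) = (u * u)%R by rewrite -expRD; congr expR; field.
  have u1 : (u <= 1)%R by rewrite /u -hS.
  rewrite ler_pdivrMr// (_ : ((1 - u) / (h n / 2) * h n = 2 * (1 - u))%R); last first.
    by field; rewrite gt_eqF.
  have := expR_ge0 (- (h n / 2 * y x)); rewrite -/u; nra.
have gy x : (g n x)%:E @[n --> \oo] --> (y x)%:E.
  apply/cvg_EFin; first exact: nearW.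
  have L : (y x / (1 + h n * y x))%R @[n --> \oo] --> y x.
    rewrite -[X in _ --> X]mulr1 -[X in (_ * X)%R](invr1); apply: cvgM; first exact: cvg_cst.
    apply: cvgV; first exact: oner_neq0.
    rewrite -[X in _ --> X]addr0 -[X in (1 + X)%R](mul0r (y x)).
    by apply: cvgD; [exact: cvg_cst|apply: cvgMl].
  apply: (squeeze_cvgr _ L (cvg_cst (y x))).
  apply: nearW => n; have hy : (0 <= h n * y x)%R by rewrite mulr_ge0// ltW.
  have p0 : (0 < 1 + h n * y x)%R by rewrite ltr_wpDr.
  apply/andP; split; last first.
    rewrite /= /g ler_pdivrMr//; rewrite [leRHS]mulrC /=; have := expR_ge1Dx (- (h n * y x)); lra.
  rewrite /= /g ler_pdivlMr// mulrAC ler_pdivrMr//.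
  have := expR_ge1Dx (h n * y x).
  have : (expR (- (h n * y x)) * expR (h n * y x) = 1)%R by rewrite -expRD addNr expR0.
  have := expR_ge0 (- (h n * y x)).
  by set a := expR _; set b := expR _; nra.
have I1 n : \int[@std1 R]_x (g n x)%:E =
    ((1 - (Num.sqrt (1 + h n))^-1) / h n)%:E.
  have iE : std1.-integrable setT (fun x => (expR (- (h n * y x)))%:E).
    apply: measurable_bounded_integrable => //.
      by rewrite ltey_eq fin_num_measure.
    exists 1%R; split; first exact: num_real.
    by move=> M M1 x _ /=; rewrite ger0_norm ?expR_ge0// (le_trans (e1 n x))// ltW.
  have i1 : std1.-integrable setT (fun _ : R => 1%:E) by exact: finite_measure_integrable_cst.
  under eq_integral do rewrite /g mulrC EFinM.
  rewrite ge0_integralZl//.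
  - under eq_integral do rewrite EFinB.
    rewrite integralB// integral_prob_cst std1_expR_sqr ?ltW//.
    by rewrite -EFinB -EFinM mulrC.
  - by apply/measurable_EFinP; exact: measurable_funB.
  - by move=> x _; rewrite lee_fin subr_ge0.
  - by rewrite lee_fin invr_ge0 ltW.
have I2 : (((1 - (Num.sqrt (1 + h n))^-1) / h n)%:E @[n --> \oo] --> (1 / 2)%:E).
  apply/cvg_EFin; first exact: nearW.
  have sc : Num.sqrt (1 + h n) @[n --> \oo] --> (1 : R)%R.
    rewrite -[X in _ --> X](@sqrtr1 R) -[X in Num.sqrt X]addr0.
    have c : (1 + h n)%R @[n --> \oo] --> (1 + 0 : R)%R by apply: cvgD => //; exact: cvg_cst.
    by apply: cvg_comp c _; exact: sqrt_continuous.
  have : ((Num.sqrt (1 + h n) * (Num.sqrt (1 + h n) + 1))^-1)%R @[n --> \oo] --> ((1 * (1 + 1))^-1 : R)%R.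
    apply: cvgV; first by rewrite mul1r.
    by apply: cvgM => //; apply: cvgD => //; exact: cvg_cst.
  rewrite mul1r => H; rewrite div1r; apply: cvg_trans H; apply: near_eq_cvg; apply: nearW => n /=.
  set s := Num.sqrt _.
  have s2 : (s ^+ 2 = 1 + h n)%R by rewrite sqr_sqrtr// addr_ge0// ltW.
  have s0 : (0 < s)%R by rewrite sqrtr_gt0 ltr_wpDr// ltW.
  have hE : h n = ((s - 1) * (s + 1))%R by rewrite -subr_sqr_1 s2; ring.
  have := h0 n; rewrite hE => /lt0r_neq0; rewrite mulf_eq0 negb_or => /andP[s1 s1'].
  by field; rewrite ?s1 ?s1' ?gt_eqF.
have L := @cvg_monotone_convergence _ _ R std1 setT measurableT
  (fun n x => (g n x)%:E) mg (fun n x _ => g0 n x) (fun x _ => nd x).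
have {L} I3 : \int[@std1 R]_x (y x)%:E = (1 / 2)%:E.
  have L' : \int[@std1 R]_x (g n x)%:E @[n --> \oo] --> (1 / 2)%:E.
    by apply: cvg_trans I2; apply: near_eq_cvg; apply: nearW => n; rewrite I1.
  have L0 := cvg_unique _ L L'; rewrite -{}L0 //.
  by apply: eq_integral => x _; apply/esym/cvg_lim => //; exact: gy.
under eq_integral do rewrite -[(_ ^+ 2)%R](@divfK _ 2)// mulrC EFinM.
have my' : measurable_fun setT (fun x => (y x)%:E) by exact/measurable_EFinP.
have y0' x : setT x -> 0 <= (y x)%:E by rewrite lee_fin.
rewrite (ge0_integralZl std1 measurableT my' y0') ?lee_fin//.
by rewrite I3 -EFinM; congr EFin; field.
Qed.

Lemma measurable_negR : measurable_fun setT (fun x : R => (- x)%R).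
Proof. by rewrite (_ : (fun x => _) = (fun x : R => -1 * x)%R); [exact: measurable_funM|apply/funext => x; rewrite mulN1r]. Qed.

(** A quarter turn of the Gaussian plane changes the sign of one coordinate.
    *)
Lemma std1_symmetric (A : set R) : measurable A ->
  std1 A = std1 ((fun x : R => (- x)%R) @^-1` A).
Proof.
move=> mA.
have mN : measurable ((fun x : R => (- x)%R) @^-1` A).
  rewrite -[X in measurable X]setTI.
  exact: measurable_negR.
have ind B : measurable B -> std1 B = \int[@std1 R]_x (\1_B x)%:E.
  by move=> mB; rewrite integral_indic ?setIT.
have mI : measurable_fun setT (fun z : R * R => (\1_A z.2)%:E : \bar R).
  apply/measurable_EFinP; apply: measurableT_comp => //; exact: measurable_indic.
have := gauss_rotate (c := 0%R) (s := 1%R) (f := fun z => (\1_A z.2)%:E) (lexx _).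
rewrite expr0n expr1n add0r => /(_ erefl mI) H.
have f0 (x : R * R) : 0 <= (\1_A x.2 : R)%:E by rewrite lee_fin.
have {H f0} /esym /= := H f0; rewrite integral_prob_cst -(ind _ mA) => ->.
rewrite (ind _ mN); apply: eq_integral => x _ /=.
under eq_integral do rewrite mul0r addr0 mulN1r.
by rewrite integral_prob_cst.
Qed.

Lemma Lfun2_intro d (Om : measurableType d) (P : probability Om R) (X : Om -> R) (v : R) :
  measurable_fun setT X -> \int[P]_w (X w ^+ 2)%:E = v%:E -> X \in Lfun P 2%:E.
Proof.
move=> mX E2; rewrite inE; apply/andP; split; rewrite inE//=.
rewrite /finite_norm ltey; apply/negP => /eqP N.
have := powR_Lnorm P (EFin \o X) (@lt0r_neq0 R 2%R (ltr0Sn _ _)); rewrite N poweRyr//.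
suff -> : \int[P]_x `|(EFin \o X) x| `^ 2%R = v%:E by [].
rewrite -E2; apply: eq_integral => x _ /=.
by rewrite powR_mulrn// real_normK// num_real.
Qed.

Lemma std1_centered : 'E_(@std1 R)[@idfun R] = 0.
Proof.
have L2 : @idfun R \in Lfun std1 2%:E.
  exact: (Lfun2_intro (@measurable_id _ _ setT) std1_second_moment).
have L1 : @idfun R \in Lfun std1 1 by apply: Lfun_subset12 L2; exact: fin_num_measure.
have mN : measurable_fun setT (fun x : R => (- x)%R) by exact: measurable_negR.
have law : same_law std1 (@idfun R) std1 (fun x : R => (- x)%R).
  by move=> A mA; exact: std1_symmetric.
have := same_law_expectation (f := @idfun R) _ mN law _ _.
move=> /(_ (@measurable_id _ _ setT) (@measurable_id _ _ setT)) H.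
have {H} := H ((Lfun1_integrable _ _).1 L1).
have -> : idfun \o (fun x : R => (- x)%R) = (-1)%R \o* (@idfun R).
  by apply/funext => x /=; rewrite mulrN1.
rewrite (expectationZl _ L1); have := expectation_fin_num L1.
rewrite -[idfun \o idfun]/(@idfun R); case: ('E_std1[idfun]) => // r _ [/eqP].
by rewrite mulN1r -subr_eq0 opprK -mulr2n mulrn_eq0/= => /eqP ->.
Qed.

Lemma centered_normal_moments d (Om : measurableType d) (P : probability Om R)
    (X : Om -> R) (v : R) : centered_normal P X v ->
  X \in Lfun P 2%:E /\ 'V_P[X] = v%:E.
Proof.
move=> /centered_normalP[v0 mX law].
have sqv : (Num.sqrt v ^+ 2 = v)%R by rewrite sqr_sqrtr.
have ms : measurable_fun setT (fun z : R => (Num.sqrt v * z)%R) by exact: measurable_funM.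
have mX2 : measurable_fun setT (fun x : R => (x ^+ 2)%:E).
  by apply/measurable_EFinP; exact: measurable_funX.
have E2 : \int[P]_w (X w ^+ 2)%:E = v%:E.
  have X20 x : 0 <= (x ^+ 2 : R)%:E by rewrite lee_fin sqr_ge0.
  rewrite (same_law_ge0 mX ms law mX2 X20).
  under eq_integral do rewrite exprMn sqv EFinM.
  rewrite (ge0_integralZl std1 measurableT mX2 (fun x _ => X20 x)) ?lee_fin//.
  by rewrite std1_second_moment mule1.
have L2 : X \in Lfun P 2%:E by exact: Lfun2_intro E2.
have L1 : X \in Lfun P 1 by apply: Lfun_subset12 L2; exact: fin_num_measure.
have E0 : 'E_P[X] = 0.
  have := same_law_expectation (f := @idfun R) mX ms law (@measurable_id _ _ setT).
  move=> /(_ ((Lfun1_integrable _ _).1 L1)).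
  rewrite -[idfun \o X]/X => ->.
  have -> : idfun \o (fun z : R => Num.sqrt v * z)%R = Num.sqrt v \o* (@idfun R).
    by apply/funext => z /=; rewrite mulrC.
  have i2 : @idfun R \in Lfun std1 2%:E.
    exact: (Lfun2_intro (@measurable_id _ _ setT) std1_second_moment).
  rewrite expectationZl ?std1_centered ?mule0//.
  by apply: Lfun_subset12 i2; exact: fin_num_measure.
by split=> //; rewrite varianceE// E0 expe2 mule0 sube0 unlock.
Qed.

(** By polarization, from the variance of the sum. *)
Lemma normal_pair_moments d (Om : measurableType d) (P : probability Om R)
    (X Y : Om -> R) (vx vy vs c : R) :
  centered_normal P X vx -> centered_normal P Y vy ->
  centered_normal P (X \+ Y)%R vs -> (vs = vx + vy + 2 * c)%R ->
  [/\ 'V_P[X] = vx%:E, 'V_P[Y] = vy%:E & covariance P X Y = c%:E].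
Proof.
move=> /centered_normal_moments[X2 VX] /centered_normal_moments[Y2 VY].
move=> /centered_normal_moments[_ VS] vsE; split=> //.
have := varianceD X2 Y2; rewrite VX VY VS vsE.
have : covariance P X Y \is a fin_num.
  apply: covariance_fin_num; [apply: Lfun_subset12 X2|apply: Lfun_subset12 Y2|exact: Lfun2_mul_Lfun1]; exact: fin_num_measure.
case: (covariance P X Y) => // r _.
by rewrite -EFinM -!EFinD => -[E]; congr EFin; lra.
Qed.

End GaussianMoments.

(** * Gaussian noise independent of a given pair *)

Section IndependentNoise.
Context {R : realType}.

Lemma sum_over_bool (F : bool -> R) : \sum_b F b = F false + F true.
Proof. by rewrite big_bool addrC. Qed.

Lemma std2_normal (x y : R) :
  centered_normal (@std2 R) (fun z => x * z.1 + y * z.2) (x ^+ 2 + y ^+ 2).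
Proof.
pose g (b : bool) (z : R * R) := if b then z.2 else z.1.
have mg b : measurable_fun setT (g b) by case: b; [exact: measurable_snd|exact: measurable_fst].
have fstX (A : set R) : (@fst R R) @^-1` A = A `*` setT by apply/seteqP; split=> z //= -[].
have sndX (A : set R) : (@snd R R) @^-1` A = setT `*` A by apply/seteqP; split=> z //= -[].
have std2X (A B : set R) : measurable A -> measurable B ->
  std2 (A `*` B) = (std1 A * std1 B)%E by exact: product_measure1E.
have s1T : @std1 R setT = 1%E by exact: probability_setT.
have law b : centered_normal std2 (g b) 1.
  apply/centered_normalP; split=> // A mA; rewrite sqrtr1.
  rewrite (_ : (fun z : R => 1 * z) = idfun); last by apply/funext => z; rewrite mul1r.
  rewrite preimage_id; have E2 : std2 ((@snd R R) @^-1` A) = std1 A.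
    by rewrite sndX (std2X _ _ measurableT mA) s1T mul1e.
  have E1 : std2 ((@fst R R) @^-1` A) = std1 A.
    by rewrite fstX (std2X _ _ mA measurableT) s1T mule1.
  by case: b; [exact: E2|exact: E1].
have ig : indep (@std2 R) (fun b => rvs (g b)).
  move=> E HE; rewrite !big_bool /=.
  have [A mA EA] := HE true; have [B mB EB] := HE false.
  rewrite EA EB /g fstX sndX.
  have -> : (setT `*` A) `&` (B `*` setT) = B `*` A.
    by apply/seteqP; split=> z /= => [[[_ ?] [? _]]|[]].
  rewrite !std2X// s1T mul1e mule1 EFinM !fineK ?fin_num_measure//.
  by rewrite muleC.
have := normal_sum (fun b : bool => if b then y else x) ig law.
rewrite sum_over_bool !mulr1; congr (centered_normal _ _ _).
by apply/funext => z; rewrite sum_over_bool.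
Qed.

Context {d : measure_display} {Om : measurableType d}.
Variable P : probability Om R.

Lemma linear_law_normal (X Y : Om -> R) (p q r : R) :
  measurable_fun setT X -> measurable_fun setT Y -> binlaw P X Y p q r ->
  forall a b, centered_normal P (fun w => a * X w + b * Y w)
    ((a * p) ^+ 2 + (a * q + b * r) ^+ 2).
Proof.
move=> mX mY law a b; apply/centered_normalP.
have /centered_normalP[v0 _ lawL] := std2_normal (a * p) (a * q + b * r).
split=> //; first exact: measurable_affine2.
move=> A mA; rewrite -(lawL _ mA).
pose l (z : R * R) := a * z.1 + b * z.2.
have mA' : measurable (l @^-1` A).
  rewrite -[X in measurable X]setTI.
  by apply: (measurable_affine2 a b (@measurable_fst _ _ R R) (@measurable_snd _ _ R R)).
have -> : (fun z : R * R => a * p * z.1 + (a * q + b * r) * z.2) =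
    l \o (fun z => (p * z.1 + q * z.2, r * z.2)).
  by apply/funext => z; rewrite /l /=; ring.
exact: (law _ mA').
Qed.

Lemma mutually_independent2 (F G : set (set Om)) :
  F `<=` measurable -> G `<=` measurable ->
  (forall A B, F A -> G B -> P (B `&` A) = (P A * P B)%E) ->
  mutually_independent P [:: F; G].
Proof.
move=> mF mG H E HE; rewrite !big_ord_recl !big_ord0/= setIT mulr1 setIC.
have F0 := HE 0%N isT; have G1 := HE 1%N isT.
by rewrite H// EFinM !fineK ?fin_num_measure//; [exact: mG|exact: mF].
Qed.

Lemma mutually_independent2E (F G : set (set Om)) A B :
  F `<=` measurable -> G `<=` measurable ->
  mutually_independent P [:: F; G] -> F A -> G B -> P (A `&` B) = (P A * P B)%E.
Proof.
move=> mF mG H FA GB.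
have := H (fun i => if i is 0%N then A else B).
rewrite !big_ord_recl !big_ord0/= setIT mulr1 => ->; last by case=> [|[|]].
by rewrite EFinM !fineK ?fin_num_measure//; [exact: mG|exact: mF].
Qed.

Lemma pair_sigma_measurable (X Y : Om -> R) :
  measurable_fun setT X -> measurable_fun setT Y -> pair_sigma X Y `<=` measurable.
Proof.
move=> mX mY; apply: sigma_measurable => _ [A mA [->|->]];
  rewrite -[X in measurable X]setTI; [exact: mX|exact: mY].
Qed.

Lemma pair_sigma_gmeas (X Y : Om -> R) (G := [set E | exists2 A : set R, measurable A
    & E = X @^-1` A \/ E = Y @^-1` A]) : gmeas G X /\ gmeas G Y.
Proof.
by split; apply: gmeas_rvs => _ [A mA ->]; exists A => //; [left|right].
Qed.

(** The preimages of Borel sets of the plane are a sigma-algebra that contains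
    the generators. *)
Lemma pair_sigma_sub (X Y : Om -> R) E : pair_sigma X Y E ->
  exists2 D : set (R * R), measurable D & E = (fun w => (X w, Y w)) @^-1` D.
Proof.
apply: (smallest_sub (X := [set E | exists2 D : set (R * R), measurable D
   & E = (fun w => (X w, Y w)) @^-1` D])); last first.
  move=> _ [A mA [->|->]].
    by exists (A `*` setT); [exact: measurableX|apply/seteqP; split=> w //= -[]].
  by exists (setT `*` A); [exact: measurableX|apply/seteqP; split=> w //= -[]].
split.
- by exists set0 => //; rewrite preimage_set0.
- move=> A [D mD ->]; exists (~` D); first exact: measurableC.
  by rewrite setTD.
- move=> F HF; have [D HD] := @choice nat (set (R * R))
    (fun k D => measurable D /\ F k = (fun w => (X w, Y w)) @^-1` D)
    (fun k => let: ex_intro2 D mD E := HF k in ex_intro _ D (conj mD E)).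
  exists (\bigcup_k D k); first by apply: bigcup_measurable => k _; case: (HD k).
  by rewrite preimage_bigcup; apply: eq_bigcupr => k _; case: (HD k).
Qed.

Lemma gaussian_plus_noise (X Y U : Om -> R) (N1 N2 : Om -> R) (a b a' b' v v' : R) :
  measurable_fun setT X -> measurable_fun setT Y ->
  measurable_fun setT N1 -> measurable_fun setT N2 ->
  mutually_independent P [:: pair_sigma X Y; pair_sigma N1 N2] ->
  centered_normal P (fun w => a * X w + b * Y w) v ->
  centered_normal P (fun w => a' * N1 w + b' * N2 w) v' ->
  (forall w, U w = (a * X w + b * Y w) + (a' * N1 w + b' * N2 w)) ->
  centered_normal P U (v + v').
Proof.
move=> mX mY mN1 mN2 ind nX nN UE.
pose g (e : bool) w := if e then a' * N1 w + b' * N2 w else a * X w + b * Y w.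
have ng e : centered_normal P (g e) (if e then v' else v).
  by case: e; [exact: nN|exact: nX].
have ig : indep P (fun e => rvs (g e)).
  move=> E HE; rewrite !big_bool /= setIC.
  have gF : pair_sigma X Y (E false).
    have [m1 m2] := pair_sigma_gmeas X Y.
    apply: (@gmeas_sub _ _ _ _ (g false)) (HE false).
    by apply: measurable_funD; apply: measurable_funM.
  have gT : pair_sigma N1 N2 (E true).
    have [m1 m2] := pair_sigma_gmeas N1 N2.
    apply: (@gmeas_sub _ _ _ _ (g true)) (HE true).
    by apply: measurable_funD; apply: measurable_funM.
  have mP := pair_sigma_measurable mX mY; have mP' := pair_sigma_measurable mN1 mN2.
  rewrite (mutually_independent2E mP mP' ind gF gT) EFinM !fineK ?fin_num_measure//.
  - by rewrite muleC.
  - exact: mP.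
  - exact: mP'.
have H := normal_sum (fun=> 1) ig ng.
have E1 : \sum_(e : bool) 1 ^+ 2 * (if e then v' else v) = v + v'.
  by rewrite sum_over_bool expr1n !mul1r.
have E2 : (fun w => \sum_e 1 * g e w) = U.
  by apply/funext => w; rewrite sum_over_bool !mul1r UE.
by rewrite E1 E2 in H.
Qed.

End IndependentNoise.

(** * The linear stochastic differential equation *)

(** This reduces bounded test functions to nonnegative ones. *)
Lemma expectation_shift {R : realType} d (Om : measurableType d) (P : probability Om R)
    (g : Om -> R) (K : R) : measurable_fun setT g -> (forall w, `|g w| <= K) ->
  [/\ (\int[P]_w (g w + K)%:E \is a fin_num)%E &
      ('E_P[g] = \int[P]_w (g w + K)%:E - K%:E)%E].
Proof.
move=> mg gK.
have fin : (P setT < +oo)%E by rewrite ltey_eq fin_num_measure.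
have ig : P.-integrable setT (EFin \o g).
  apply: measurable_bounded_integrable => //.
  by exists K; split; [exact: num_real|move=> M KM w _; exact: le_trans (gK w) (ltW KM)].
have iK : P.-integrable setT (EFin \o cst K) by exact: finite_measure_integrable_cst.
have E : (\int[P]_w (g w + K)%:E = \int[P]_w (g w)%:E + K%:E)%E.
  under eq_integral do rewrite EFinD.
  rewrite (integralD measurableT ig iK); congr (_ + _)%E.
  exact: (integral_prob_cst P K%:E).
have fg : (\int[P]_w (g w)%:E \is a fin_num)%E by exact: (integrable_fin_num measurableT ig).
rewrite E unlock; split; first by rewrite fin_numD fg.
by rewrite addeK.
Qed.

Section LinearSDE.
Context {R : realType} {d : measure_display} {Om : measurableType d}.
Local Notation leb := (@lebesgue_measure R).
Variable P : probability Om R.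
Variables (W1 W2 Q Z : R -> Om -> R) (a m c s1 s2 A C B : R) (e1 e2 k : R -> R).
Hypotheses (a0 : a < 0) (c0 : c < 0) (s20 : s2 != 0).
Hypothesis flow : is_flow a m c e1 e2 k.
Hypothesis flow_comm : forall t, (a - c) * k t = m * (e1 t - e2 t).
Hypothesis e2_lt1 : forall t, 0 < t -> e2 t ^+ 2 < 1.
Hypothesis e1_cvg : e1 t @[t --> +oo] --> (0 : R).
Hypothesis e2_cvg : e2 t @[t --> +oo] --> (0 : R).
Hypothesis k_cvg : k t @[t --> +oo] --> (0 : R).
(* M Sigma + Sigma M^T + S S^T = 0, entry by entry *)
Hypothesis lyapA : 2 * (a * A + m * C) = - s1 ^+ 2.
Hypothesis lyapC : (a + c) * C + m * B = 0.
Hypothesis lyapB : 2 * (c * B) = - s2 ^+ 2.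
Hypothesis bW1 : standard_brownian P W1.
Hypothesis bW2 : standard_brownian P W2.
Hypothesis iW : mutually_independent P
  [:: pair_sigma (Q 0) (Z 0); process_sigma W1; process_sigma W2].
Hypothesis mQZ : forall t, 0 <= t -> measurable_fun setT (Q t) /\ measurable_fun setT (Z t).
Hypothesis paths : forall w, cadlag (fun t => Q t w) /\ cadlag (fun t => Z t w).
Hypothesis sde : {ae P, forall w t, 0 <= t ->
  Q t w = Q 0 w + \int[leb]_(s in `[0, t]) (a * Q s w + m * Z s w) + s1 * W1 t w /\
  Z t w = Z 0 w + \int[leb]_(s in `[0, t]) (c * Z s w) + s2 * W2 t w}.

(** The first coordinate of N(t) = X(t) - Phi(t) X(0). *)
Definition noiseQ (e1 k : R -> R) t w := Q t w - (e1 t * Q 0 w + k t * Z 0 w).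
Definition noiseZ (e2 : R -> R) t w := Z t w - e2 t * Z 0 w.

(** The entries of Sigma - Phi Sigma Phi^T are [covA], [covC] and [covB]. *)
Definition covA t := A - (e1 t ^+ 2 * A + 2 * (e1 t * k t) * C + k t ^+ 2 * B).
Definition covC t := C - (e1 t * e2 t * C + k t * e2 t * B).
Definition covB t := B - e2 t ^+ 2 * B.

Let F0 := pair_sigma (Q 0) (Z 0).

Let mQ0 : measurable_fun setT (Q 0). Proof. by case: (mQZ (lexx 0)). Qed.
Let mZ0 : measurable_fun setT (Z 0). Proof. by case: (mQZ (lexx 0)). Qed.

Let piF0 : pi_system F0.
Proof.
apply: sigma_pi_system => _ [D mD [->|->]]; rewrite -[X in measurable X]setTI.
  exact: mQ0.
exact: mZ0.
Qed.

Let mF0 : F0 `<=` measurable. Proof. by case: piF0. Qed.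

Let B0 : 0 < B.
Proof.
have s2p : 0 < s2 ^+ 2 by rewrite lt_neqAle sqr_ge0 eq_sym sqrf_eq0 s20.
rewrite ltNge; apply/negP => Bn.
by have := mulr_le0 (ltW c0) Bn; have := lyapB; lra.
Qed.

Let covB_gt0 t : 0 < t -> 0 < covB t.
Proof. by move=> /e2_lt1 H; rewrite /covB subr_gt0 gtr_pMl. Qed.

Let mnoise t : 0 <= t -> measurable_fun setT (noiseQ e1 k t) /\ measurable_fun setT (noiseZ e2 t).
Proof.
move=> /mQZ[mQ mZ]; split.
  by apply: measurable_funB => //; apply: measurable_funD; apply: measurable_funM.
by apply: measurable_funB => //; apply: measurable_funM.
Qed.

Let cont_brownian (W : R -> Om -> R) w : standard_brownian P W -> cont0 (W ^~ w).
Proof. by case=> _ /(_ w) /continuous0P. Qed.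

Lemma noise_limit t : 0 <= t -> {ae P, forall w,
  conv_sum t e1 k s1 s2 (W1 ^~ w) (W2 ^~ w) n @[n --> \oo] --> noiseQ e1 k t w /\
  conv_sum t (fun=> 0) e2 s1 s2 (W1 ^~ w) (W2 ^~ w) n @[n --> \oo] --> noiseZ e2 t w}.
Proof.
move=> t0; apply: filterS sde => w Ew.
have [cq cz] := paths w.
have cb1 := cont_brownian w bW1; have cb2 := cont_brownian w bW2.
split.
  exact: (path_limit flow cq cz cb1 cb2 (fun u u0 => (Ew u u0).1) (fun u u0 => (Ew u u0).2) t0).
(* The equation of Z alone is the case m = 0, k = 0. *)
have flow0 : is_flow c 0 c e2 e2 (fun=> 0).
  case: flow => -[_ e2D _] [[_ e20 _] [_ de2 _]].
  split; first by split=> // s u; rewrite mulr0 mul0r addr0.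
  split=> //; split=> // t'; rewrite mulr0 mul0r addr0; exact: is_derive_cst.
have Ez u : 0 <= u -> Z u w = Z 0 w + \int[leb]_(s in `[0, u]) (c * Z s w + 0 * Z s w) + s2 * W2 u w.
  by move=> u0; under eq_Rintegral do rewrite mul0r addr0; exact: (Ew u u0).2.
have := path_limit (s1 := s2) (s2 := s2) flow0 cz cz cb2 cb2 Ez (fun u u0 => (Ew u u0).2) t0.
rewrite /noiseZ mul0r addr0; apply: cvg_trans; apply: near_eq_cvg; apply: nearW => n.
by apply: eq_bigr => i _; rewrite !mul0r addr0 add0r.
Qed.

Lemma noise_transient t E D : 0 < t -> F0 E -> measurable D ->
  P ((fun w => (noiseQ e1 k t w, noiseZ e2 t w)) @^-1` D `&` E) =
  (P E * std2 (chol (covA t) (covC t) (covB t) @^-1` D))%E.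
Proof.
move=> t0 F0E mD; have [mNQ mNZ] := mnoise (ltW t0).
have [cA cC cB] := convolution_variances flow flow_comm lyapA lyapC lyapB (ltW t0).
apply: (noise_law bW1 bW2 piF0 iW (ltW t0) (covB_gt0 t0) mNQ mNZ (noise_limit (ltW t0)) cA) => //.
- apply: cvg_trans cC; apply: near_eq_cvg; apply: nearW => n.
  by apply: eq_bigr => i _; rewrite mul0r mulr0 add0r.
- apply: cvg_trans cB; apply: near_eq_cvg; apply: nearW => n.
  by apply: eq_bigr => i _; rewrite mul0r expr0n add0r.
Qed.

(** At time 0 the noise vanishes. The case is separate since [chol] is the
    factor of a covariance with covB t > 0, that is t > 0. *)
Lemma noise_factor t : 0 <= t -> exists p q r : R, forall E D, F0 E -> measurable D ->
  P ((fun w => (noiseQ e1 k t w, noiseZ e2 t w)) @^-1` D `&` E) =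
  (P E * std2 ((fun z : R * R => (p * z.1 + q * z.2, r * z.2)%R) @^-1` D))%E.
Proof.
rewrite le_eqVlt => /orP[/eqP <-|t0]; last first.
  exists (Num.sqrt (covA t - covC t ^+ 2 / covB t)), (covC t / Num.sqrt (covB t)),
    (Num.sqrt (covB t)) => E D; exact: noise_transient.
exists 0, 0, 0 => E D F0E mD.
case: flow => _ [[e10 e20 k0] _].
have -> : (fun w => (noiseQ e1 k 0 w, noiseZ e2 0 w)) = cst (0, 0).
  by apply/funext => w; rewrite /noiseQ /noiseZ e10 e20 k0 !mul1r mul0r addr0 !subrr.
have -> : (fun z : R * R => (0 * z.1 + 0 * z.2, 0 * z.2)) = cst (0, 0).
  by apply/funext => z; rewrite !mul0r addr0.
rewrite !preimage_cst; case: ifP => _; last by rewrite set0I !measure0 mule0.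
by rewrite setTI -[LHS]mule1; congr (_ * _)%E; apply/esym; exact: probability_setT.
Qed.

Lemma noise_binlaw t : 0 <= t -> exists p q r : R,
  binlaw P (noiseQ e1 k t) (noiseZ e2 t) p q r.
Proof.
move=> /noise_factor[p [q [r law]]]; exists p, q, r => D mD.
have F0T : F0 setT by case: piF0.
have := law _ _ F0T mD; rewrite setIT => H; rewrite [LHS]H.
by rewrite probability_setT mul1e.
Qed.

Lemma noise_normal t : 0 <= t -> centered_binormal P (noiseQ e1 k t) (noiseZ e2 t).
Proof.
move=> t0 x y; have [mNQ mNZ] := mnoise t0; have [p [q [r law]]] := noise_binlaw t0.
by eexists; exact: (linear_law_normal mNQ mNZ law).
Qed.

Lemma noise_product t E D : 0 <= t -> F0 E -> measurable D ->
  let N := fun w => (noiseQ e1 k t w, noiseZ e2 t w) in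
  P (N @^-1` D `&` E) = (P E * P (N @^-1` D))%E.
Proof.
move=> t0 F0E mD N; have [p [q [r law]]] := noise_factor t0.
have F0T : F0 setT by case: piF0.
rewrite (law _ _ F0E mD); congr (_ * _)%E.
by have := law _ _ F0T mD; rewrite setIT => ->; rewrite probability_setT mul1e.
Qed.

Lemma noise_independent t : 0 <= t -> mutually_independent P
  [:: pair_sigma (Q 0) (Z 0); pair_sigma (noiseQ e1 k t) (noiseZ e2 t)].
Proof.
move=> t0; have [mNQ mNZ] := mnoise t0.
apply: mutually_independent2 => //; first exact: pair_sigma_measurable.
by move=> E D F0E /pair_sigma_sub[D' mD' ->]; exact: noise_product.
Qed.

Lemma marginal_normal : centered_binormal P (Q 0) (Z 0) ->
  forall t, 0 <= t -> centered_binormal P (Q t) (Z t).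
Proof.
move=> n0 t t0 x y; have [mNQ mNZ] := mnoise t0.
have [v nv] := n0 (x * e1 t) (x * k t + y * e2 t).
have [v' nv'] := noise_normal t0 x y.
exists (v + v'); apply: (gaussian_plus_noise mQ0 mZ0 mNQ mNZ (noise_independent t0) nv nv').
by move=> w; rewrite /noiseQ /noiseZ; ring.
Qed.

Let A_ge : 0 <= A - C ^+ 2 / B.
Proof.
rewrite subr_ge0 ler_pdivrMr//.
have ac0 : 0 < - (a + c) by have := a0; have := c0; lra.
have s1p := sqr_ge0 s1.
have CE : C * - (a + c) = m * B by have := lyapC; lra.
have mB2 : 0 <= C ^+ 2 * (- c) by rewrite mulr_ge0 ?sqr_ge0// oppr_ge0 ltW.
(* as C * - (a + c) = m * B and - a <= - (a + c) *)
have H : C ^+ 2 * (- a) <= A * B * (- a).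
  have -> : A * B * - a = s1 ^+ 2 / 2 * B + (m * B) * C.
    have -> : s1 ^+ 2 = - (2 * (a * A + m * C)) by rewrite lyapA opprK.
    by field.
  have : 0 <= s1 ^+ 2 / 2 * B by apply: mulr_ge0; [exact: divr_ge0|exact: ltW].
  by rewrite -CE; lra.
by move: H; rewrite ler_pM2r// oppr_gt0.
Qed.

Let mchol A' C' B' : measurable_fun setT (chol A' C' B' : R * R -> R * R).
Proof.
have := measurable_fun_pair (measurable_chol1 A' C' B') (measurable_chol2 A' C' B').
by rewrite (_ : (fun x => _) = chol A' C' B')//; apply/funext => z; rewrite -surjective_pairing.
Qed.

Definition steady_law : probability (R * R)%type R :=
  distribution (@std2 R) (mfun_Sub (mem_set (mchol A C B))).

Let steady_binlaw : binlaw steady_law fst snd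
  (Num.sqrt (A - C ^+ 2 / B)) (C / Num.sqrt B) (Num.sqrt B).
Proof.
move=> D mD; rewrite (_ : (fun w => (w.1, w.2)) = idfun) ?preimage_id//.
by apply/funext => -[].
Qed.

(** X(0) and N(t) are independent, so the law of X(t) = Phi(t) X(0) + N(t) is
    an image of a product law. *)
Lemma expectation_transient t (f : R * R -> R) K : 0 < t -> continuous f ->
  (forall z, 0 <= f z <= K) ->
  (\int[P]_w (f (Q t w, Z t w))%:E = \int[(P \x @std2 R)%E]_z
   (f (e1 t * Q 0 z.1 + k t * Z 0 z.1 + (chol (covA t) (covC t) (covB t) z.2).1,
       e2 t * Z 0 z.1 + (chol (covA t) (covC t) (covB t) z.2).2))%:E)%E.
Proof.
move=> t0 cf fK; have mf := measurable_continuous2 cf.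
have [mNQ mNZ] := mnoise (ltW t0).
have f0 z : (0 <= (f z)%:E)%E by rewrite lee_fin; case/andP: (fK z).
pose N w := (noiseQ e1 k t w, noiseZ e2 t w).
pose X0 w := (Q 0 w, Z 0 w).
pose F (v : (R * R) * (R * R)) : \bar R :=
  (f (e1 t * v.1.1 + k t * v.1.2 + v.2.1, e2 t * v.1.2 + v.2.2))%:E.
have m1 (g : R * R -> R) : measurable_fun setT g -> measurable_fun setT (fun v : (R * R) * (R * R) => g v.1).
  by move=> mg; apply: measurableT_comp => //; exact: measurable_fst.
have m2 (g : R * R -> R) : measurable_fun setT g -> measurable_fun setT (fun v : (R * R) * (R * R) => g v.2).
  by move=> mg; apply: measurableT_comp => //; exact: measurable_snd.
have mF : measurable_fun setT F.
  apply/measurable_EFinP; apply: measurableT_comp => //.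
  have m11 := m1 _ (@measurable_fst _ _ R R); have m12 := m1 _ (@measurable_snd _ _ R R).
  have m21 := m2 _ (@measurable_fst _ _ R R); have m22 := m2 _ (@measurable_snd _ _ R R).
  apply: measurable_fun_pair.
    apply: measurable_funD => //; exact: measurable_affine2.
  by apply: measurable_funD => //; apply: measurable_funM.
have F0' v : (0 <= F v)%E by exact: f0.
have mN : measurable_fun setT N by exact: measurable_fun_pair.
have mX0 : measurable_fun setT X0 by exact: measurable_fun_pair.
have indX D D' : measurable D -> measurable D' ->
    (P (X0 @^-1` D `&` N @^-1` D') = P (X0 @^-1` D) * P (N @^-1` D'))%E.
  move=> mD mD'; rewrite setIC; apply: noise_product => //; first exact: ltW.
  have [g1 g2] := pair_sigma_gmeas (Q 0) (Z 0).
  by apply: gmeas_preimage mD; exact: measurable_fun_pair.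
have -> : (\int[P]_w (f (Q t w, Z t w))%:E = \int[P]_w F (X0 w, N w))%E.
  apply: eq_integral => w _; rewrite /F /N /X0 /noiseQ /noiseZ /=.
  by congr (f (_, _))%:E; ring.
rewrite (independent_integral mX0 mN indX mF F0').
set L := chol (covA t) (covC t) (covB t).
have mL : measurable_fun setT L by exact: mchol.
have lawN : same_law P N std2 L.
  move=> D mD; have F0T : F0 setT by case: piF0.
  have := noise_transient t0 F0T mD; rewrite setIT => H; rewrite [LHS]H.
  by rewrite probability_setT mul1e.
pose G (z : Om * (R * R)) := F (X0 z.1, L z.2).
have mG : measurable_fun setT G.
  apply: measurableT_comp => //; apply: measurable_fun_pair.
    by apply: (measurableT_comp mX0); exact: measurable_fst.
  by apply: (measurableT_comp mL); exact: measurable_snd.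
transitivity (\int[P]_w \int[@std2 R]_z G (w, z))%E; last first.
  by apply/esym; exact: (@fubini_tonelli1 _ _ _ _ R P (@std2 R) G mG (fun z => F0' _)).
apply: eq_integral => w _; rewrite /G.
apply: (same_law_ge0 (f := fun v => F (X0 w, v)) mN mL lawN); last by move=> v; exact: F0'.
by apply: measurableT_comp => //; apply: measurable_fun_pair => //; exact: measurable_cst.
Qed.

(** In [expectation_transient] the factor Phi(t) tends to 0 and the covariance
    of N(t) tends to Sigma. *)
Lemma steady_cvg_ge0 (f : R * R -> R) K (u : nat -> R) : continuous f ->
  (forall z, 0 <= f z <= K) -> u n @[n --> \oo] --> +oo ->
  (\int[P]_w (f (Q (u n) w, Z (u n) w))%:E @[n --> \oo] --> \int[steady_law]_z (f z)%:E)%E.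
Proof.
move=> cf fK uoo; have mf := measurable_continuous2 cf.
have f0 z : (0 <= (f z)%:E)%E by rewrite lee_fin; case/andP: (fK z).
have fin : ((P \x @std2 R)%E setT < +oo)%E.
  have E1 : ((P \x @std2 R) (setT `*` setT) = P setT * std2 setT)%E.
    exact: product_measure1E.
  rewrite -setXTT [X in (X < _)%E]E1 probability_setT mul1e.
  by rewrite ltey_eq fin_num_measure.
pose g n (z : Om * (R * R)) := f (e1 (u n) * Q 0 z.1 + k (u n) * Z 0 z.1 +
  (chol (covA (u n)) (covC (u n)) (covB (u n)) z.2).1,
  e2 (u n) * Z 0 z.1 + (chol (covA (u n)) (covC (u n)) (covB (u n)) z.2).2).
pose h (z : Om * (R * R)) := f (chol A C B z.2).
have mQ1 : measurable_fun setT (fun z : Om * (R * R) => Q 0 z.1).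
  by apply: (measurableT_comp mQ0); exact: measurable_fst.
have mZ1 : measurable_fun setT (fun z : Om * (R * R) => Z 0 z.1).
  by apply: (measurableT_comp mZ0); exact: measurable_fst.
have mc1 A' C' B' : measurable_fun setT (fun z : Om * (R * R) => (chol A' C' B' z.2).1).
  by apply: (measurableT_comp (measurable_chol1 A' C' B')); exact: measurable_snd.
have mc2 A' C' B' : measurable_fun setT (fun z : Om * (R * R) => (chol A' C' B' z.2).2).
  by apply: (measurableT_comp (measurable_chol2 A' C' B')); exact: measurable_snd.
have mg n : measurable_fun setT (g n).
  apply: (measurableT_comp mf); apply: measurable_fun_pair.
    by apply: measurable_funD => //; exact: measurable_affine2.
  by apply: measurable_funD => //; apply: measurable_funM.
have mh : measurable_fun setT h.
  apply: (measurableT_comp mf); apply: (measurableT_comp (mchol A C B)).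
  exact: measurable_snd.
have gK n z : `|g n z| <= K.
  by have /andP[g0 g1] := fK (e1 (u n) * Q 0 z.1 + k (u n) * Z 0 z.1 +
  (chol (covA (u n)) (covC (u n)) (covB (u n)) z.2).1,
  e2 (u n) * Z 0 z.1 + (chol (covA (u n)) (covC (u n)) (covB (u n)) z.2).2); rewrite ger0_norm.
have ce1 : e1 (u n) @[n --> \oo] --> (0 : R) by exact: cvg_comp uoo e1_cvg.
have ce2 : e2 (u n) @[n --> \oo] --> (0 : R) by exact: cvg_comp uoo e2_cvg.
have ck : k (u n) @[n --> \oo] --> (0 : R) by exact: cvg_comp uoo k_cvg.
have cA : covA (u n) @[n --> \oo] --> A.
  rewrite -[X in _ --> X]subr0; apply: cvgB; first exact: cvg_cst.
  rewrite [X in _ --> X](_ : 0 = 0 * 0 * A + 2 * (0 * 0) * C + 0 * 0 * B); last by ring.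
  apply: cvgD; last by apply: cvgMl; apply: cvgM.
  by apply: cvgD; apply: cvgMl; [apply: cvgM|apply: cvgMr; apply: cvgM].
have cC : covC (u n) @[n --> \oo] --> C.
  rewrite -[X in _ --> X]subr0; apply: cvgB; first exact: cvg_cst.
  rewrite [X in _ --> X](_ : 0 = 0 * 0 * C + 0 * 0 * B); last by ring.
  by apply: cvgD; apply: cvgMl; apply: cvgM.
have cB : covB (u n) @[n --> \oo] --> B.
  rewrite -[X in _ --> X]subr0; apply: cvgB; first exact: cvg_cst.
  rewrite [X in _ --> X](_ : 0 = 0 * 0 * B); last by ring.
  by apply: cvgMl; apply: cvgM.
have gh : {ae (P \x @std2 R)%E, forall z, g n z @[n --> \oo] --> h z}.
  apply: aeW => z; rewrite /h [in X in _ --> X](surjective_pairing (chol A C B z.2)).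
  have [l1 l2] := chol_cvg z.2 B0 cA cC cB.
  apply: continuous2_cvg => //.
    rewrite -[X in _ --> X]add0r; apply: cvgD => //.
    rewrite -[X in _ --> X]addr0 -[X in _ --> X + _](mul0r (Q 0 z.1)) -[X in _ --> _ + X](mul0r (Z 0 z.1)).
    by apply: cvgD; apply: cvgMl.
  rewrite -[X in _ --> X]add0r; apply: cvgD => //.
  by rewrite -[X in _ --> X](mul0r (Z 0 z.1)); apply: cvgMl.
have L := bounded_cvg_integral fin mg mh gK gh.
have <- : (\int[(P \x @std2 R)%E]_z (h z)%:E = \int[steady_law]_z (f z)%:E)%E.
  have mh' : measurable_fun setT (fun z => (h z)%:E) by exact/measurable_EFinP.
  have mf' : measurable_fun setT (fun z => (f z)%:E) by exact/measurable_EFinP.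
  apply: etrans (@fubini_tonelli1 _ _ _ _ R P (@std2 R) _ mh' (fun z => f0 _)) _.
  rewrite /fubini_F /h /= integral_prob_cst.
  exact: (esym (@ge0_integral_distribution _ _ _ _ R (@std2 R) (mfun_Sub (mem_set (mchol A C B))) _ mf' f0)).
apply: cvg_trans L; apply: near_eq_cvg.
move/cvgryPgt : uoo => /(_ 0).
by apply: filterS => n un; rewrite (expectation_transient un cf fK).
Qed.

Lemma steady_cvg : cvg_law_for (@bounded_continuous R (R * R)%type) (pinfty_nbhs R)
  (fun _ : R => P) (fun t w => (Q t w, Z t w)) steady_law id.
Proof.
move=> f [cf [K fK]].
have K0 : 0 <= K := le_trans (normr_ge0 _) (fK (0, 0)).
pose f' z := f z + K.
have cf' : continuous f' by move=> z; apply: cvgD; [exact: cf|exact: cvg_cst].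
have f'K z : 0 <= f' z <= K + K.
  by have := fK z; rewrite ler_norml /f' => /andP[]; lra.
have mf := measurable_continuous2 cf.
pose r t := fine (\int[P]_w (f' (Q t w, Z t w))%:E)%E.
have [finS ES] := @expectation_shift _ _ _ steady_law _ _ mf fK.
have E1 t : 0 <= t -> ('E_P[fun w => f (Q t w, Z t w)] = (r t - K)%:E)%E.
  move=> /mQZ[mQ mZ].
  have mft : measurable_fun setT (fun w => f (Q t w, Z t w)).
    by apply: (measurableT_comp mf); exact: measurable_fun_pair.
  have [fin ->] := @expectation_shift _ _ _ P _ _ mft (fun w => fK (Q t w, Z t w)).
  by rewrite /r EFinB fineK.
have cr : r t @[t --> +oo] --> fine (\int[steady_law]_z (f' z)%:E)%E.
  apply/cvg_pinftyP => u uoo; apply: fine_cvg; rewrite fineK//.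
  exact: steady_cvg_ge0.
have -> : ('E_steady_law[fun w => f (id w)] = (fine (\int[steady_law]_z (f' z)%:E) - K)%:E)%E.
  by rewrite ES EFinB fineK.
apply: (cvg_trans _ (cvg_EFin (F := +oo) (nearW _ (fun t => erefl : ((r t - K)%:E \is a fin_num))) (cvgB cr (cvg_cst K)))).
apply: near_eq_cvg; have : \forall t \near +oo, (0 : R) <= t by apply: nbhs_pinfty_ge; exact: num_real.
by apply: filterS => t t0; rewrite E1.
Qed.

(** A limit law is determined by its integrals of bounded continuous
    functions, so it is [steady_law]. *)
Lemma steady_unique (ninf : probability (R * R)%type R) :
  cvg_law_for (@bounded_continuous R (R * R)%type) (pinfty_nbhs R)
    (fun _ : R => P) (fun t w => (Q t w, Z t w)) ninf id ->
  [/\ centered_binormal ninf fst snd, ('V_ninf[fst] = A%:E)%E,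
      ('V_ninf[snd] = B%:E)%E & covariance ninf fst snd = C%:E].
Proof.
move=> st.
have law : same_law ninf (fun w => (w.1, w.2)) steady_law (fun w => (w.1, w.2)).
  have idE : (fun w : R * R => (w.1, w.2)) = id by apply/funext => -[].
  rewrite idE; apply: same_law_test => //.
  - by rewrite ltey_eq fin_num_measure.
  - by rewrite ltey_eq fin_num_measure.
  move=> f cf f01; have bf : bounded_continuous f.
    split=> //; exists 1 => z; have /andP[f0 f1] := f01 z; by rewrite ger0_norm.
  have := cvg_unique _ (st f bf) (steady_cvg bf); rewrite unlock; exact.
have bl : binlaw ninf fst snd (Num.sqrt (A - C ^+ 2 / B)) (C / Num.sqrt B) (Num.sqrt B).
  by move=> D mD; rewrite (law _ mD); exact: steady_binlaw.
have lin := linear_law_normal (@measurable_fst _ _ R R) (@measurable_snd _ _ R R) bl.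
have sB : Num.sqrt B ^+ 2 = B by rewrite sqr_sqrtr// ltW.
have sA : Num.sqrt (A - C ^+ 2 / B) ^+ 2 = A - C ^+ 2 / B by rewrite sqr_sqrtr.
have sB0 : Num.sqrt B != 0 by rewrite gt_eqF// sqrtr_gt0.
have qE : (C / Num.sqrt B) ^+ 2 = C ^+ 2 / B by rewrite expr_div_n sB.
have E1 : (fun w : R * R => 1 * w.1 + 0 * w.2) = fst.
  by apply/funext => w; rewrite mul1r mul0r addr0.
have E2 : (fun w : R * R => 0 * w.1 + 1 * w.2) = snd.
  by apply/funext => w; rewrite mul1r mul0r add0r.
have E3 : (fun w : R * R => 1 * w.1 + 1 * w.2) = fst \+ snd.
  by apply/funext => w; rewrite !mul1r.
have n1 : centered_normal ninf fst A.
  by have := lin 1 0; rewrite E1 !mul1r mul0r addr0 sA qE subrK.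
have n2 : centered_normal ninf snd B.
  by have := lin 0 1; rewrite E2 !mul0r !mul1r add0r expr0n/= add0r sB.
have n3E : (1 * Num.sqrt (A - C ^+ 2 / B)) ^+ 2 +
    (1 * (C / Num.sqrt B) + 1 * Num.sqrt B) ^+ 2 = A + B + 2 * C.
  by rewrite !mul1r sA sqrrD qE sB (divfK sB0) -mulr_natl; ring.
have n3 := lin 1 1; rewrite n3E E3 in n3.
have [V1 V2 V3] := normal_pair_moments n1 n2 n3 erefl.
split; [|exact: V1|exact: V2|exact: V3].
move=> x y; exact (ex_intro _ _ (lin x y)).
Qed.

End LinearSDE.

(** * Stationary laws of chains on the integers *)

Section Esum.
Context {R : realType} {S : choiceType}.
Implicit Types (a : S -> R) (A : set S) (s : seq S).

Lemma esum_seq_le a A s : uniq s -> (forall x, x \in s -> A x) ->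
  ((\sum_(x <- s) a x)%:E <= \esum_(x in A) (a x)%:E)%E.
Proof.
move=> us sA; apply: esum_ge; exists [set` s].
  by split; [exact: finite_seq|move=> x /=; exact: sA].
by rewrite -fsbig_seq// sumEFin.
Qed.

Lemma esum_le_seq a A (b : R) :
  (forall s, uniq s -> (forall x, x \in s -> A x) -> \sum_(x <- s) a x <= b) ->
  (\esum_(x in A) (a x)%:E <= b%:E)%E.
Proof.
move=> H; apply: ge_ereal_sup => _ [F [finF FA] <-].
rewrite fsbig_finite//= sumEFin lee_fin; apply: H; first exact: finmap.fset_uniq.
by move=> x; rewrite in_fset_set// => /set_mem; exact: FA.
Qed.

Lemma esum_near a A (b e : R) : (\esum_(x in A) (a x)%:E = b%:E)%E -> 0 < e ->
  exists s, [/\ uniq s, (forall x, x \in s -> A x) & b - e < \sum_(x <- s) a x].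
Proof.
move=> ab e0; apply: contrapT => H.
have : (\esum_(x in A) (a x)%:E <= (b - e)%:E)%E.
  apply: esum_le_seq => s us sA; rewrite leNgt; apply/negP => bs; apply: H.
  by exists s.
by rewrite ab lee_fin leNgt ltrBlDr ltrDl e0.
Qed.

End Esum.

Section Balance.
Context {R : realType} {S : choiceType}.
Variables (jumps : S -> seq (R * S)) (C : R).
Hypothesis rate_ge0 : forall x j, j \in jumps x -> 0 <= j.1.
Hypothesis rate_le : forall x, \sum_(j <- jumps x) j.1 <= C.

Let C0 (x : S) : 0 <= C.
Proof.
apply: le_trans (rate_le x); rewrite big_seq; apply: sumr_ge0 => j; exact: rate_ge0.
Qed.

Definition generator (f : S -> R) (x : S) : R :=
  \sum_(j <- jumps x) j.1 * (f j.2 - f x).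

Section Transition.
Variable p : R -> S -> S -> R.
Hypothesis tp : transition_function jumps p.

Let p_ge0 t x y : 0 <= t -> 0 <= p t x y. Proof. by case: tp => + _ _ _ _; apply. Qed.

Let p_le1 t x y : 0 <= t -> p t x y <= 1.
Proof.
move=> t0; case: tp => _ + _ _ _ => /(_ t x t0) s1; rewrite -lee_fin -s1.
have := @esum_seq_le _ _ (p t x) setT [:: y] isT (fun _ _ => I).
by rewrite big_seq1.
Qed.

Let p_mvt t x y : 0 < t -> exists2 c, 0 < c < t &
  p t x y - p 0 x y = generator (fun z => p c z y) x * t.
Proof.
move=> t0; case: tp => _ _ p0 p0c pd.
have [||c] := @MVT R (fun u => p u x y) (fun u => generator (fun z => p u z y) x) 0 t t0.
- by move=> u; rewrite in_itv/= => /andP[u0 _]; exact: pd.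
- apply/continuous_within_itvP => //; split.
  + move=> u; rewrite in_itv/= => /andP[u0 _].
    by apply: differentiable_continuous; apply/derivable1_diffP; case: (pd u x y u0).
  + exact: p0c.
  + apply: cvg_at_left_filter.
    by apply: differentiable_continuous; apply/derivable1_diffP; case: (pd t x y t0).
by rewrite in_itv/= subr0 => ct E; exists c.
Qed.

Let p_small t x y : 0 < t -> x != y -> p t x y <= C * t.
Proof.
move=> t0 xy; have [c /andP[c0 _]] := p_mvt x y t0.
case: tp => _ _ -> _ _; rewrite (negbTE xy) subr0 => ->.
apply: ler_wpM2r; first exact: ltW.
apply: le_trans (rate_le x); rewrite /generator big_seq [leRHS]big_seq.
apply: ler_sum => j jx; apply: ler_piMr; first exact: rate_ge0 jx.
by rewrite lerBlDr (le_trans (p_le1 _ _ (ltW c0)))// lerDl p_ge0// ltW.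
Qed.

Let p_deriv0 x y : (p t x y - p 0 x y) / t @[t --> 0^'+] -->
  generator (fun z => p 0 z y) x.
Proof.
have cD : generator (fun z => p t z y) x @[t --> 0^'+] -->
    generator (fun z => p 0 z y) x.
  rewrite /generator; apply: cvg_big; [exact: add_continuous|move=> j _; apply: cvgMr]; apply: cvgB.
    by case: tp.
  by case: tp.
apply/cvgrPdist_lt => e e0; move/cvgrPdist_lt : cD => /(_ e e0).
rewrite !near_withinE => /nbhs_ballP[r /= r0 H]; apply/nbhs_ballP; exists r => // t.
rewrite /ball/= sub0r normrN => tr t0; have [c /andP[c0 ct] ->] := p_mvt x y t0.
rewrite mulfK ?gt_eqF//; apply: H => //=.
by rewrite /ball/= sub0r normrN gtr0_norm// (lt_trans ct)// -(gtr0_norm t0).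
Qed.

(** The invariance sum_x nu x * p t x y = nu y is differentiated at t = 0.
    Differentiation under the infinite sum is justified by the bound C on the
    rates: outside a finite set of mass at least 1 - e, the difference
    quotients contribute at most C e. *)
Lemma balance_p (nu : S -> R) (y : S) (F : seq S) :
  (forall x, 0 <= nu x) -> (\esum_(x in [set: S]) (nu x)%:E = 1)%E ->
  (forall t, 0 <= t -> (\esum_(x in [set: S]) (nu x * p t x y)%:E = (nu y)%:E)%E) ->
  uniq F -> y \in F ->
  (forall x, x \notin F -> generator (fun z => (z == y)%:R) x = 0) ->
  \sum_(x <- F) nu x * generator (fun z => (z == y)%:R) x = 0.
Proof.
move=> nu0 nu1 inv uF yF gF; set g := generator _.
have p0E : p 0 = fun x y => (x == y)%:R.
  by apply/funext => u; apply/funext => v; case: tp.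
have main e : 0 < e -> `|\sum_(x <- F) nu x * g x| <= C * e.
  move=> e0; have [s [us _ se]] := esum_near nu1 e0.
  (* F' carries mass at least 1 - e and contains all the states that jump to y *)
  pose F' := undup (F ++ s).
  have uF' : uniq F' by exact: undup_uniq.
  have inF' x : (x \in F') = (x \in F) || (x \in s) by rewrite mem_undup mem_cat.
  have -> : \sum_(x <- F) nu x * g x = \sum_(x <- F') nu x * g x.
    rewrite [RHS](bigID (fun x => x \in F))/= [X in _ + X]big1 ?addr0; last first.
      by move=> x xF; rewrite /g gF// mulr0.
    rewrite -[RHS]big_filter; apply: perm_big; apply: uniq_perm => //.
      exact: filter_uniq.
    by move=> x; rewrite mem_filter inF'; case: (x \in F).
  have F'e : 1 - e <= \sum_(x <- F') nu x.
    apply: (le_trans (ltW se)).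
    rewrite [leRHS](bigID (fun x => x \in s))/= ler_wpDr ?sumr_ge0//.
    rewrite -[leRHS]big_filter le_eqVlt; apply/orP; left; apply/eqP.
    apply: perm_big; apply: uniq_perm => //; first exact: filter_uniq.
    by move=> x; rewrite mem_filter inF' orbC; case: (x \in s).
  have F'1 s' : uniq s' -> (forall x, x \in s' -> x \notin F') ->
      \sum_(x <- s') nu x <= e.
    move=> us' s'F; rewrite -(lerD2l (\sum_(x <- F') nu x)).
    apply: (@le_trans _ _ 1); last by rewrite -lerBlDr.
    rewrite -big_cat/= -lee_fin -nu1; apply: esum_seq_le => //.
    rewrite cat_uniq uF' us' andbT/=; apply/hasPn => x; exact: s'F.
  have step t : 0 < t -> - (C * e) <=
      \sum_(x <- F') nu x * ((p t x y - p 0 x y) / t) <= 0.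
    move=> t0.
    have -> : \sum_(x <- F') nu x * ((p t x y - p 0 x y) / t) =
        (\sum_(x <- F') nu x * p t x y - nu y) / t.
      rewrite (eq_bigr (fun x => nu x * p t x y / t - nu x * (x == y)%:R / t)); last first.
        by move=> x _; rewrite p0E; ring.
      rewrite sumrB -!mulr_suml -mulrBl; congr ((_ - _) / _).
      have yF' : y \in F' by rewrite inF' yF.
      rewrite (bigD1_seq y)//= eqxx mulr1 big1 ?addr0// => x /negbTE ->.
      by rewrite mulr0.
    rewrite ler_pdivlMr// ler_pdivrMr// mul0r subr_le0; apply/andP; split; last first.
      by rewrite -lee_fin -(inv t (ltW t0)); exact: esum_seq_le.
    rewrite lerBrDr mulNr addrC lerBlDr -lee_fin -(inv t (ltW t0)).
    apply: esum_le_seq => s' us' _; rewrite (bigID (fun x => x \in F'))/=.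
    apply: lerD.
      rewrite [leRHS](bigID (fun x => x \in s'))/= ler_wpDr//.
        by apply: sumr_ge0 => x _; rewrite mulr_ge0// p_ge0// ltW.
      rewrite -big_filter -[leRHS]big_filter le_eqVlt; apply/orP; left; apply/eqP.
      apply: perm_big; apply: uniq_perm; rewrite ?filter_uniq//.
      by move=> x; rewrite !mem_filter andbC.
    apply: (@le_trans _ _ (\sum_(x <- s' | x \notin F') nu x * (C * t))).
      apply: ler_sum => x xF'; rewrite ler_wpM2l// p_small//.
      by apply: contra xF' => /eqP ->; rewrite inF' yF.
    rewrite -mulr_suml -big_filter (_ : C * e * t = e * (C * t)); last by ring.
    apply: ler_wpM2r; first by apply: mulr_ge0; [exact: (C0 y)|exact: ltW].
    by apply: F'1; rewrite ?filter_uniq// => x; rewrite mem_filter => /andP[].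
  have lim : \sum_(x <- F') nu x * ((p t x y - p 0 x y) / t) @[t --> 0^'+] -->
      \sum_(x <- F') nu x * g x.
    apply: cvg_big; [exact: add_continuous|move=> x _; apply: cvgMr].
    have <- : generator (fun z => p 0 z y) x = g x by rewrite p0E.
    exact: p_deriv0.
  rewrite ler_norml; apply/andP; split.
    apply: (cvgr_to_ge lim); near=> t.
    have /step/andP[] // : 0 < t by near: t; exact: nbhs_right_gt.
  apply: (@le_trans _ _ 0); last by apply: mulr_ge0; [exact: (C0 y)|exact: ltW].
  apply: (cvgr_to_le lim); near=> t.
  have /step/andP[] // : 0 < t by near: t; exact: nbhs_right_gt.
apply/eqP; rewrite -normr_le0; apply/ler_addgt0Pr => e e0.
rewrite add0r (le_trans (main (e / (C + 1)) _))//.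
  by rewrite divr_gt0// ltr_wpDl// (C0 y).
by rewrite mulrCA ger_pMr// ler_pdivrMr ?ltr_wpDl ?(C0 y)// mul1r lerDl.
Unshelve. all: by end_near. Qed.

End Transition.

Lemma stationary_balance (nu : S -> R) (y : S) (F : seq S) :
  stationary_law jumps nu -> uniq F -> y \in F ->
  (forall x, x \notin F -> generator (fun z => (z == y)%:R) x = 0) ->
  \sum_(x <- F) nu x * generator (fun z => (z == y)%:R) x = 0.
Proof.
move=> [nu0 nu1 [p tp inv]]; apply: (balance_p tp) => // t; exact: inv.
Qed.

(** A finitely supported f is a finite combination of indicators of points, so
    [stationary_balance] extends by linearity. *)
Lemma stationary_generator (nu f : S -> R) (s F : seq S) :
  stationary_law jumps nu -> uniq s -> uniq F -> {subset s <= F} ->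
  (forall x, x \notin s -> f x = 0) ->
  (forall x j, x \notin F -> j \in jumps x -> j.2 \notin s) ->
  \sum_(x <- F) nu x * generator f x = 0.
Proof.
move=> snu us uF sF f0 jF.
have fE x : f x = \sum_(y <- s) f y * (x == y)%:R.
  have [xs|xs] := boolP (x \in s).
    rewrite (bigD1_seq x)//= eqxx mulr1 big1 ?addr0// => y yx.
    by rewrite eq_sym (negbTE yx) mulr0.
  rewrite f0// big_seq big1// => y ys; case: eqP => [xy|]; last by rewrite mulr0.
  by rewrite xy ys in xs.
have gE x : generator f x = \sum_(y <- s) f y * generator (fun z => (z == y)%:R) x.
  rewrite /generator; under [RHS]eq_bigr do rewrite mulr_sumr.
  rewrite exchange_big/=; apply: eq_bigr => j _.
  rewrite (fE j.2) (fE x) -sumrB mulr_sumr; apply: eq_bigr => y _.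
  by rewrite -mulrBr mulrCA.
under eq_bigr do rewrite gE mulr_sumr.
rewrite exchange_big/= big_seq big1// => y ys.
under eq_bigr do rewrite mulrCA.
rewrite -mulr_sumr stationary_balance ?mulr0//; first exact: sF.
move=> x xF; rewrite /generator big_seq big1// => j jx.
case: eqP => [jy|_]; first by have := jF x j xF jx; rewrite jy ys.
case: eqP => [xy|_]; first by rewrite xy sF in xF.
by rewrite subrr mulr0.
Qed.

End Balance.

Section IntChain.
Context {R : realType}.
Variables (jumps : int -> seq (R * int)) (C : R) (K : nat).
Hypothesis rate_ge0 : forall x j, j \in jumps x -> 0 <= j.1.
Hypothesis rate_le : forall x, \sum_(j <- jumps x) j.1 <= C.
Hypothesis jump_le : forall x j, j \in jumps x -> `|j.2 - x| <= K%:Z.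
Variable nu : int -> R.
Hypothesis snu : stationary_law jumps nu.

Definition win (M : nat) : seq int := [seq k%:Z - M%:Z | k <- iota 0 (2 * M).+1].

Lemma mem_win M x : (x \in win M) = (`|x| <= M%:Z).
Proof.
apply/mapP/idP => [[k]|xM].
  by rewrite mem_iota add0n ltnS => /andP[_ kM] ->; lia.
exists (absz (x + M%:Z)); last by lia.
by rewrite mem_iota; lia.
Qed.

Lemma win_uniq M : uniq (win M).
Proof. by rewrite map_inj_uniq ?iota_uniq// => k l; lia. Qed.

(** A finitely supported substitute for the identity, still 1-Lipschitz: the
    identity on [-N, N], then folded back to 0 at distance 2 N. *)
Definition tent (N : nat) (k : int) : int :=
  if `|k| <= N%:Z then k
  else if 0 < k then (if k <= (2 * N)%:Z then (2 * N)%:Z - k else 0)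
  else (if - (2 * N)%:Z <= k then - (2 * N)%:Z - k else 0).

Lemma tent_lip N k l : `|tent N k - tent N l| <= `|k - l|.
Proof.
rewrite /tent; case: (leP `|k| N%:Z); case: (leP `|l| N%:Z);
  case: (ltP 0 k); case: (ltP 0 l); case: (leP k (2 * N)%:Z);
  case: (leP l (2 * N)%:Z); case: (leP (- (2 * N)%:Z) k);
  case: (leP (- (2 * N)%:Z) l); lia.
Qed.

Definition drift (x : int) : R := \sum_(j <- jumps x) j.1 * (j.2 - x)%:~R.

(** As nu may have no mean, the identity is not an admissible test function;
    [tent] is. Its generator is the drift inside the window and at most C K in
    absolute value outside. *)
Lemma drift_window M :
  `|\sum_(x <- win M) nu x * drift x| <= C * K%:R * (1 - \sum_(x <- win M) nu x).
Proof.
have [nu0 nu1 _] := snu.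
(* jumps are at most K long: the function tent N is the identity around the
   states of the window M, and its generator vanishes outside the window M' *)
pose N := (M + K)%N; pose M' := (2 * N + K)%N.
pose f (k : int) : R := (tent N k)%:~R.
have E : \sum_(x <- win M') nu x * generator jumps f x = 0.
  apply: (stationary_generator rate_ge0 rate_le snu (win_uniq (2 * N)%N)).
  - exact: win_uniq.
  - by move=> x; rewrite !mem_win /M'; lia.
  - move=> x; rewrite mem_win => xN; rewrite /f.
    have -> : tent N x = 0 by rewrite /tent; case: ifP; [lia|do !case: ifP; lia].
    by [].
  - move=> x j; rewrite !mem_win => xM jx; move: (jump_le jx) xM; rewrite /M'.
    by move: (j.2 : int) (x : int) => y z; lia.
have gdrift x : x \in win M -> generator jumps f x = drift x.
  rewrite mem_win => xM; rewrite /generator /drift !big_seq; apply: eq_bigr => j jx.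
  congr (_ * _); rewrite /f -intrB; congr _%:~R.
  have xN : `|x| <= N%:Z by rewrite /N; move: (x : int) xM => z; lia.
  have jN : `|j.2| <= N%:Z.
    by rewrite /N; move: xM (jump_le jx); move: (j.2 : int) (x : int) => y z; lia.
  by rewrite /tent xN jN.
have gbound x : `|generator jumps f x| <= C * K%:R.
  apply: (le_trans (ler_norm_sum _ _ _)).
  apply: (@le_trans _ _ (\sum_(j <- jumps x) j.1 * K%:R)).
    rewrite !big_seq; apply: ler_sum => j jx.
    rewrite normrM ger0_norm ?(rate_ge0 jx)//; apply: ler_wpM2l; first exact: rate_ge0 jx.
    rewrite /f -intrB -intr_norm -[K%:R]/(K%:Z%:~R) ler_int.
    exact: le_trans (tent_lip _ _ _) (jump_le jx).
  by rewrite -mulr_suml ler_wpM2r.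
have subM : {subset win M <= win M'} by move=> x; rewrite !mem_win /M' /N; lia.
have splitW (g : int -> R) : \sum_(x <- win M') g x =
    \sum_(x <- win M) g x + \sum_(x <- win M' | x \notin win M) g x.
  rewrite (bigID (fun x => x \in win M))/=; congr (_ + _).
  rewrite -big_filter; apply: perm_big; apply: uniq_perm.
  - by rewrite filter_uniq// win_uniq.
  - exact: win_uniq.
  - by move=> x; rewrite mem_filter andb_idr//; exact: subM.
have := E; rewrite splitW => /eqP; rewrite addr_eq0 => /eqP E'.
have -> : \sum_(x <- win M) nu x * drift x =
    \sum_(x <- win M) nu x * generator jumps f x.
  by rewrite !big_seq; apply: eq_bigr => x xM; rewrite gdrift.
rewrite E' normrN (le_trans (ler_norm_sum _ _ _))//.
apply: (@le_trans _ _ (\sum_(x <- win M' | x \notin win M) C * K%:R * nu x)).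
  by apply: ler_sum => x _; rewrite normrM (ger0_norm (nu0 x)) mulrC ler_wpM2r.
rewrite -mulr_sumr; apply: ler_wpM2l.
  exact: le_trans (normr_ge0 _) (gbound 0).
rewrite lerBrDl -splitW -lee_fin -nu1.
by apply: esum_seq_le => //; exact: win_uniq.
Qed.

Lemma win_cvg (A : pred int) (L : R) :
  (\esum_(x in [set x | A x]) (nu x)%:E = L%:E)%E ->
  \sum_(x <- win M | A x) nu x @[M --> \oo] --> L.
Proof.
move=> AL; have [nu0 nu1 _] := snu.
apply/cvgrPdist_le => e e0; have [s [us sA se]] := esum_near AL e0.
pose M0 := \max_(x <- s) `|x|%N.
near=> M.
have M0M : (M0 <= M)%N by near: M; exact: nbhs_infty_ge.
have le1 : \sum_(x <- win M | A x) nu x <= L.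
  rewrite -lee_fin -AL -big_filter; apply: esum_seq_le.
    by rewrite filter_uniq// win_uniq.
  by move=> x; rewrite mem_filter => /andP[].
have le2 : \sum_(x <- s) nu x <= \sum_(x <- win M | A x) nu x.
  rewrite [leRHS](bigID (fun x => x \in s))/=.
  apply: ler_wpDr; first exact: sumr_ge0.
  rewrite -[leRHS]big_filter le_eqVlt; apply/orP; left; apply/eqP.
  apply: perm_big; apply: uniq_perm => //; first by rewrite filter_uniq// win_uniq.
  move=> x; rewrite mem_filter mem_win; have [xs|] := boolP (x \in s); last first.
    by rewrite andbF.
  rewrite (sA x xs)/=; apply/esym.
  have : (`|x| <= M0)%N.
    exact: (@leq_bigmax_seq _ s xpredT (fun x : int => absz x) x xs).
  by lia.
by rewrite ger0_norm ?subr_ge0//; lra.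
Unshelve. all: by end_near. Qed.

Lemma drift_zero (dp dm : R) :
  (forall x, drift x = if 0 < x then dp else dm) ->
  let pi := fine (\esum_(k in [set k : int | 0 < k]) (nu k)%:E) in
  dp * pi + dm * (1 - pi) = 0.
Proof.
move=> driftE pi; have [nu0 nu1 _] := snu.
have sub1 (A : pred int) :
    (\esum_(k in [set k : int | A k]) (nu k)%:E)%E \is a fin_num.
  rewrite ge0_fin_numE; last by apply: esum_ge0 => x _; rewrite lee_fin.
  apply: (@le_lt_trans _ _ 1%E); last by rewrite ltry.
  by apply: esum_le_seq => s us _; rewrite -lee_fin -nu1; exact: esum_seq_le.
have piE : (\esum_(k in [set k : int | (0 < k)%R]) (nu k)%:E)%E = pi%:E.
  by rewrite fineK// (sub1 (fun k => 0 < k)).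
have cp := win_cvg (A := fun k => 0 < k) piE.
have c1 : \sum_(x <- win M) nu x @[M --> \oo] --> (1 : R).
  by apply: (win_cvg (A := xpredT)); rewrite -nu1; congr esum; apply/seteqP.
have cm : \sum_(x <- win M | ~~ (0 < x)) nu x @[M --> \oo] --> 1 - pi.
  apply: cvg_trans (cvgB c1 cp); apply: near_eq_cvg; near=> M.
  rewrite !fctE /= [X in X - _](bigID (fun x : int => 0 < x))/=.
  by rewrite addrAC subrr add0r.
have cd : \sum_(x <- win M) nu x * drift x @[M --> \oo] --> dp * pi + dm * (1 - pi).
  apply: cvg_trans (cvgD (cvgMr cp) (cvgMr cm)); apply: near_eq_cvg; near=> M.
  rewrite !fctE /= [RHS](bigID (fun x : int => 0 < x))/= !mulr_sumr; congr (_ + _).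
    by apply: eq_bigr => x x0; rewrite driftE x0 mulrC.
  by apply: eq_bigr => x /negbTE x0; rewrite driftE x0 mulrC.
have c0 : C * K%:R * (1 - \sum_(x <- win M) nu x) @[M --> \oo] --> (0 : R).
  have := cvgMr (a := C * K%:R) (cvgB (cvg_cst (1 : R)) c1).
  by move=> h; rewrite subrr mulr0 in h; exact: h.
have : \sum_(x <- win M) nu x * drift x @[M --> \oo] --> (0 : R).
  apply/norm_cvg0P; apply: (squeeze_cvgr _ (cvg_cst 0) c0).
  by near=> M; rewrite normr_ge0/= drift_window.
by move=> /(cvg_unique _ cd); apply.
Unshelve. all: by end_near. Qed.

End IntChain.

(** * The equilibrium of the fluid limit *)

Section Equilibrium.
Context {R : realType}.
Variables (p : xparams R) (nu : fstate R -> int -> R).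
Hypothesis hrates : rates_positive p.
Hypothesis lm0 : [/\ 0 < lam1 p, 0 < lam2 p, 0 < m1 p & 0 < m2 p].
Hypothesis A2 : assumption2 p.
Hypothesis r0 : 0 < r12 p.
Hypothesis gA : bbA p (xstar p).
Hypothesis snu : stationary_law (ftsp_jumps p (xstar p)) (nu (xstar p)).
Local Notation g := (xstar p).
Local Notation pi := (ftsp_pi nu g).
Local Notation z := (zstar p).

Let mu11_gt0 : 0 < mu11 p. Proof. by case: hrates => -[]. Qed.
Let mu12_gt0 : 0 < mu12 p. Proof. by case: hrates => -[]. Qed.
Let mu22_gt0 : 0 < mu22 p. Proof. by case: hrates => -[]. Qed.
Let th1_gt0 : 0 < th1 p. Proof. by case: hrates => _ []. Qed.
Let th2_gt0 : 0 < th2 p. Proof. by case: hrates => _ []. Qed.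
Let lam1_gt0 : 0 < lam1 p. Proof. by case: lm0. Qed.
Let lam2_gt0 : 0 < lam2 p. Proof. by case: lm0. Qed.
Let m1_gt0 : 0 < m1 p. Proof. by case: lm0. Qed.
Let m2_gt0 : 0 < m2 p. Proof. by case: lm0. Qed.

Lemma rr_gt0 : 0 < rr p.
Proof. by rewrite /rr ltr0q. Qed.

Lemma q1star_ge0 : 0 <= q1star p. Proof. by case: gA. Qed.
Lemma q2star_ge0 : 0 <= q2star p. Proof. by case: gA. Qed.

Lemma zstar_ge0 : 0 <= z. Proof. by case: gA => _ _ /andP[]. Qed.
Lemma zstar_le : z <= m2 p. Proof. by case: gA => _ _ /andP[]. Qed.
Lemma q1star_eq : q1star p = rr p * q2star p. Proof. by case: gA. Qed.

Lemma th1q1 : th1 p * q1star p = lam1 p - m1 p * mu11 p - mu12 p * z.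
Proof. by rewrite mulrC divfK// gt_eqF. Qed.

Lemma th2q2 : th2 p * q2star p = lam2 p - mu22 p * (m2 p - z).
Proof. by rewrite mulrC divfK// gt_eqF. Qed.

Lemma zstar_gt0 : 0 < z.
Proof.
rewrite /zstar lt_min m2_gt0 andbT divr_gt0//; last first.
  by rewrite addr_gt0// mulr_gt0// mulr_gt0// rr_gt0.
pose a := Num.max (lam1 p - mu11 p * m1 p) 0.
pose b := Num.max (lam2 p - mu22 p * m2 p) 0.
have ab : rr p * (b / th2 p) < a / th1 p by case: A2.
rewrite subr_gt0.
have a0 : 0 < lam1 p - mu11 p * m1 p.
  have : 0 < a / th1 p.
    apply: le_lt_trans ab; rewrite mulr_ge0 ?(ltW rr_gt0)//.
    by rewrite divr_ge0 ?(ltW th2_gt0)// le_max lexx orbT.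
  by rewrite pmulr_lgt0 ?invr_gt0// /a lt_max ltxx orbF.
have aE : a = lam1 p - m1 p * mu11 p.
  by rewrite /a (max_idPl (ltW a0)) [m1 p * _]mulrC.
have b1 : lam2 p - m2 p * mu22 p <= b by rewrite /b le_max mulrC lexx.
move: ab; rewrite aE ltr_pdivlMr// mulrA mulrAC ltr_pdivrMr// => ab.
have : rr p * (lam2 p - m2 p * mu22 p) * th1 p <= rr p * b * th1 p.
  apply: ler_wpM2r; first exact: ltW.
  by apply: ler_wpM2l => //; rewrite ltW// rr_gt0.
by move: ab; rewrite mulrAC [_ * th2 p]mulrC [X in _ -> X <= _ -> _]mulrAC; lra.
Qed.

Let rate_max := lam1 p + lam2 p + (mu11 p * m1 p + th1 p * q1star p)
  + pool2_rate p g + th2 p * q2star p.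

Lemma pool2_ge0 : 0 <= pool2_rate p g.
Proof.
by rewrite addr_ge0// mulr_ge0 ?(ltW mu12_gt0) ?(ltW mu22_gt0) ?zstar_ge0 ?subr_ge0 ?zstar_le.
Qed.

Lemma pool2_gt0 : 0 < pool2_rate p g.
Proof.
rewrite /pool2_rate/= ltr_wpDr ?mulr_gt0 ?zstar_gt0//.
by rewrite mulr_ge0 ?(ltW mu22_gt0) ?subr_ge0 ?zstar_le.
Qed.

Let loss_gt0 : 0 < mu11 p * m1 p + th1 p * q1star p.
Proof. by rewrite ltr_wpDr ?mulr_gt0// mulr_ge0 ?q1star_ge0// ltW. Qed.

Let aban_ge0 : 0 <= th2 p * q2star p.
Proof. by rewrite mulr_ge0 ?q2star_ge0// ltW. Qed.

Let rate_ge0 x j : j \in ftsp_jumps p g x -> 0 <= j.1.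
Proof.
have pool0 := pool2_ge0.
rewrite /ftsp_jumps; case: ifP => _; rewrite !inE => /or4P[] /eqP -> /=.
- exact: ltW.
- exact: ltW.
- by rewrite ltW// ltr_wpDr.
- exact: aban_ge0.
- exact: ltW.
- exact: ltW.
- exact: ltW.
- by rewrite addr_ge0.
Qed.

Let rate_le x : \sum_(j <- ftsp_jumps p g x) j.1 <= rate_max.
Proof.
rewrite /ftsp_jumps /rate_max; case: ifP => _; rewrite !big_cons big_nil/=.
  by rewrite /fq1 /fq2/=; lra.
by rewrite /fq1 /fq2/=; lra.
Qed.

Let K := (absz (numq (r12 p)) + absz (denq (r12 p)))%N.

Let jump_le x j : j \in ftsp_jumps p g x -> `|j.2 - x| <= K%:Z.
Proof.
have D := denq_gt0 (r12 p); rewrite /ftsp_jumps /K.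
move: (numq (r12 p)) (denq (r12 p)) D => a d D; case: ifP => _.
  by rewrite !inE => /orP[/eqP ->|/orP[/eqP ->|/orP[/eqP ->|/eqP ->]]] /=;
    clear -D; lia.
by rewrite !inE => /orP[/eqP ->|/orP[/eqP ->|/orP[/eqP ->|/eqP ->]]] /=;
  clear -D; lia.
Qed.

Let b : R := (denq (r12 p))%:~R.

Let b_gt0 : 0 < b. Proof. by rewrite ltr0z denq_gt0. Qed.

Let aE : (numq (r12 p))%:~R = rr p * b.
Proof. by rewrite /rr /ratr divfK// gt_eqF. Qed.

(** The drift at xstar takes two values, one for the positive states and one
    for the others, and its stationary mean is 0. *)
Lemma pi_balance : pi * (mu22 p * (m2 p - z)) = (1 - pi) * (mu12 p * z).
Proof.
have driftE x : drift (ftsp_jumps p g) x =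
   if 0 < x then - (b * (1 + rr p) * (mu22 p * (m2 p - z)))
   else b * (1 + rr p) * (mu12 p * z).
  have t1 := th1q1; have t2 := th2q2.
  rewrite /drift /ftsp_jumps; case: ifP => _; rewrite !big_cons big_nil/= addr0.
    rewrite ![x + _]addrC !addrK !intrN aE -/b /pool2_rate /fq1 /fq2 /fz/=.
    by rewrite t1 t2; ring.
  rewrite ![x + _]addrC !addrK !intrN aE -/b /pool2_rate /fq1 /fq2 /fz/=.
  by rewrite t1 t2; ring.
have := drift_zero rate_ge0 rate_le jump_le snu driftE; rewrite -/(ftsp_pi nu g) => H.
have br : b * (1 + rr p) != 0 by rewrite mulf_neq0 ?gt_eqF// addr_gt0// rr_gt0.
apply: (mulfI br); apply/eqP; rewrite -subr_eq0 -oppr_eq0; apply/eqP.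
by rewrite -[RHS]H; ring.
Qed.

Lemma pi_star : pi = mu12 p * z / (mu12 p * z + mu22 p * (m2 p - z)).
Proof.
have := pool2_gt0; rewrite /pool2_rate/= /fz/= => D.
apply: (mulIf (lt0r_neq0 D)); rewrite divfK ?gt_eqF//.
by have := pi_balance; lra.
Qed.

(** Balance at k: as nothing leaves a state of mass 0, nothing enters it,
    whereas the state k + denq (r12 p) jumps to k at a positive rate. *)
Lemma stationary_shift k : nu g k = 0 -> nu g (k + denq (r12 p)) = 0.
Proof.
move=> nuk.
have D := denq_gt0 (r12 p).
have [nu0 _ _] := snu.
set kb := k + denq (r12 p).
have [F [uF kF kbF Fout]] : exists F : seq int, [/\ uniq F, k \in F, kb \in F &
    forall x j, x \notin F -> j \in ftsp_jumps p g x -> (x != k) && (j.2 != k)].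
  exists (win (absz k + 2 * K)); split; first exact: win_uniq.
  - by rewrite mem_win; clear; lia.
  - by rewrite mem_win /kb /K; clear -D; lia.
  - move=> x j; rewrite mem_win => xF /jump_le; move: (j.2 : int) (x : int) xF => u v.
    by clear; lia.
have := stationary_balance rate_ge0 rate_le snu uF kF.
rewrite (bigD1_seq kb kbF uF)/= => H.
have nonneg x : x != k -> 0 <= nu g x * generator (ftsp_jumps p g) (fun y => (y == k)%:R) x.
  move=> xk; rewrite mulr_ge0// /generator big_seq; apply: sumr_ge0 => j jx.
  by rewrite (negbTE xk) subr0 mulr_ge0// (rate_ge0 jx).
have kbk : kb != k by rewrite /kb; clear -D; lia.
have rest : 0 <= \sum_(x <- F | x != kb) nu g x * generator (ftsp_jumps p g) (fun y => (y == k)%:R) x.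
  apply: sumr_ge0 => x _; have [->|xk] := eqVneq x k; first by rewrite nuk mul0r.
  exact: nonneg.
have {}H : nu g kb * generator (ftsp_jumps p g) (fun y => (y == k)%:R) kb = 0.
  apply/eqP; rewrite eq_le nonneg// andbT -(ler_pM2l (ltr01)) !mul1r.
  rewrite -(lerD2r (\sum_(x <- F | x != kb) nu g x * generator (ftsp_jumps p g) (fun y => (y == k)%:R) x)).
  rewrite H ?add0r// => x xF.
  rewrite /generator big_seq big1// => j jx.
  by have /andP[/negbTE -> /negbTE ->] := Fout x j xF jx; rewrite subrr mulr0.
move/eqP : H; rewrite mulf_eq0 => /orP[/eqP //|/eqP H].
suff : 0 < generator (ftsp_jumps p g) (fun y => (y == k)%:R) kb by rewrite H ltxx.
rewrite /generator; apply: (@lt_le_trans _ _ (mu11 p * m1 p + th1 p * q1star p)); first by [].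
have pool0 := pool2_ge0.
have nn (u v : int) (c : R) : 0 <= c -> 0 <= c * ((u == k)%:R - (kb == k)%:R).
  by move=> c0; rewrite (negbTE kbk) subr0 mulr_ge0.
rewrite /ftsp_jumps; case: ifP => _; rewrite !big_cons big_nil/= addr0.
  have -> : kb - denq (r12 p) == k by rewrite /kb addrK.
  have H1 := nn (kb + denq (r12 p)) 0 _ (ltW lam1_gt0).
  have H2 := nn (kb - numq (r12 p)) 0 _ (ltW lam2_gt0).
  have H3 := nn (kb + numq (r12 p)) 0 _ aban_ge0.
  by move: H1 H2 H3; rewrite (negbTE kbk) /fq1 /fq2 !subr0 /= ?mulr1n ?mulr1; lra.
have -> : kb - denq (r12 p) == k by rewrite /kb addrK.
have H1 := nn (kb + denq (r12 p)) 0 _ (ltW lam1_gt0).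
have H2 := nn (kb - numq (r12 p)) 0 _ (ltW lam2_gt0).
have H3 := nn (kb + numq (r12 p)) 0 _ (addr_ge0 pool0 aban_ge0).
by move: H1 H2 H3; rewrite (negbTE kbk) /fq1 /fq2 !subr0 /= ?mulr1n ?mulr1; lra.
Qed.

(** If z = m2 then pi12 = 1 and the nonpositive states have mass 0. By
    [stationary_shift] all states then have mass 0. *)
Lemma zstar_lt : z < m2 p.
Proof.
rewrite lt_neqAle zstar_le andbT; apply/eqP => zm.
have pi1 : pi = 1.
  by rewrite pi_star zm subrr mulr0 addr0 divff// gt_eqF// mulr_gt0.
have D := denq_gt0 (r12 p).
have [nu0 nu1 _] := snu.
have neg k : k <= 0 -> nu g k = 0.
  move=> k0; apply/eqP; rewrite eq_le nu0 andbT.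
  apply/ler_addgt0Pr => e e0; rewrite add0r.
  have fin : (\esum_(k in [set k : int | (0 < k)%R]) (nu g k)%:E)%E = 1%:E.
    rewrite -pi1 fineK// ge0_fin_numE; last by apply: esum_ge0 => x _; rewrite lee_fin.
    apply: (@le_lt_trans _ _ 1%E); last by rewrite ltry.
    by apply: esum_le_seq => s us _; rewrite -lee_fin -nu1; exact: esum_seq_le.
  have [s [us sA se]] := esum_near fin e0.
  have : \sum_(x <- k :: s) nu g x <= 1.
    rewrite -lee_fin -nu1; apply: esum_seq_le => //=; rewrite us andbT.
    by apply/negP => /sA /=; rewrite ltNge k0.
  by rewrite big_cons; lra.
have all0 n k : k <= n%:Z -> nu g k = 0.
  elim: n k => [|n IH] k kn; first exact: neg.
  rewrite -[k](subrK (denq (r12 p))); apply: stationary_shift; apply: IH; clear -kn D; lia.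
have : (\esum_(x in [set: int]) (nu g x)%:E <= 0%:E)%E.
  apply: esum_le_seq => s _ _; rewrite big1// => x _.
  by apply: (all0 (absz x)); clear; lia.
by rewrite nu1 lee_fin ler10.
Qed.

Lemma pi_range : 0 <= pi <= 1.
Proof.
have D := pool2_gt0; rewrite /pool2_rate/= /fz/= in D.
have z0 := zstar_gt0; have z1 := zstar_lt.
have H1 : 0 <= mu12 p * z by rewrite mulr_ge0// ltW.
have H2 : 0 <= mu22 p * (m2 p - z) by rewrite mulr_ge0 ?subr_ge0// ltW.
by rewrite pi_star divr_ge0 ?addr_ge0//= ler_pdivrMr// mul1r lerDl.
Qed.

End Equilibrium.

(** * The coefficients *)

Section Coefficients.
Context {R : realType}.
Variables (p : xparams R) (nu : fstate R -> int -> R) (sig2 : fstate R -> R).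
Hypothesis hrates : rates_positive p.
Hypothesis lm0 : [/\ 0 < lam1 p, 0 < lam2 p, 0 < m1 p & 0 < m2 p].
Hypothesis A2 : assumption2 p.
Hypothesis r0 : 0 < r12 p.
Hypothesis gA : bbA p (xstar p).
Hypothesis snu : stationary_law (ftsp_jumps p (xstar p)) (nu (xstar p)).
Hypothesis sig2_ge0 : 0 <= sig2 (xstar p).
Local Notation pi12 := (ftsp_pi nu).
Local Notation g := (xstar p).
Local Notation z := (zstar p).

Let mu12_gt0 : 0 < mu12 p. Proof. by case: hrates => -[]. Qed.
Let mu22_gt0 : 0 < mu22 p. Proof. by case: hrates => -[]. Qed.
Let th1_gt0 : 0 < th1 p. Proof. by case: hrates => _ []. Qed.
Let th2_gt0 : 0 < th2 p. Proof. by case: hrates => _ []. Qed.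
Let m2_gt0 : 0 < m2 p. Proof. by case: lm0. Qed.
Let z_gt0 : 0 < z. Proof. exact: zstar_gt0. Qed.
Let z_lt : z < m2 p. Proof. exact: (zstar_lt hrates lm0 A2 r0 gA snu). Qed.
Let rr0 : 0 < rr p. Proof. exact: rr_gt0. Qed.

Local Notation D := (mu12 p * z + mu22 p * (m2 p - z)).

Let D_gt0 : 0 < D.
Proof. by rewrite addr_gt0// mulr_gt0// subr_gt0. Qed.

Let piE : pi12 g = mu12 p * z / D.
Proof. exact: (pi_star hrates lm0 A2 r0 gA snu). Qed.

Let balance : pi12 g * (mu22 p * (m2 p - z)) = (1 - pi12 g) * (mu12 p * z).
Proof. by apply: pi_balance. Qed.

Let pi01 : 0 <= pi12 g <= 1.
Proof. exact: (pi_range hrates lm0 A2 r0 gA snu). Qed.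

Lemma M11_lt0 : M11 p < 0.
Proof.
rewrite /M11 oppr_lt0 addr_gt0// mulr_gt0// /p1 /p2 divr_gt0// addr_gt0//.
Qed.

Lemma M22_lt0 : M22 p < 0.
Proof. by rewrite /M22 mulNr oppr_lt0 divr_gt0// !mulr_gt0. Qed.

Lemma M22_drift : M22 p = - ((mu22 p - mu12 p) * pi12 g + mu12 p).
Proof. by rewrite piE /M22; field; rewrite gt_eqF. Qed.

Lemma eta_balance : eta12 p pi12 = eta22 p pi12.
Proof. by rewrite /eta12 /eta22; have := balance; lra. Qed.

(** As q1star = r * q2star, the weights p1 and p2 recover q1star and q2star
    from their sum; the abandonment rates th1 * q1star and th2 * q2star are
    given by the definition of xstar. *)
Lemma xi1_gamma : xi1 p = lam1 p + lam2 p + m1 p * mu11 p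
  + (p1 p * th1 p + p2 p * th2 p) * fqs g.
Proof.
have q := q1star_eq gA; have t1 := th1q1 hrates; have t2 := th2q2 hrates.
rewrite /fqs /fq1 /fq2 /=.
have rr1 : 1 + rr p != 0 by rewrite gt_eqF// addr_gt0.
have E1 : p1 p * (q1star p + q2star p) = q1star p by rewrite q /p1; field.
have E2 : p2 p * (q1star p + q2star p) = q2star p by rewrite q /p2; field.
rewrite mulrDl mulrAC E1 [p2 p * _ * _]mulrAC E2 [q1star p * _]mulrC t1.
by rewrite [q2star p * _]mulrC t2 /xi1; ring.
Qed.

Lemma xi1_ge0 : 0 <= xi1 p.
Proof.
have [/ltW l1 /ltW l2 /ltW k1 _] := lm0; have mu11_gt0 : 0 < mu11 p by case: hrates => -[].
rewrite xi1_gamma addr_ge0//; first by rewrite !addr_ge0// mulr_ge0// ltW.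
have /ltW P0 : 0 < p1 p * th1 p + p2 p * th2 p by have := M11_lt0; rewrite /M11 oppr_lt0.
by rewrite mulr_ge0// addr_ge0//; case: gA.
Qed.

Lemma rates_ge0 : [/\ 0 <= xi12 p pi12, 0 <= xi22 p pi12, 0 <= eta12 p pi12,
  0 <= eta22 p pi12 & 0 <= xi2 p sig2].
Proof.
have /andP[p0 p1] := pi01; have dz : 0 <= m2 p - z by rewrite subr_ge0 ltW.
have q0 : 0 <= 1 - pi12 g by rewrite subr_ge0.
have z0 := ltW z_gt0; have u1 := ltW mu12_gt0; have u2 := ltW mu22_gt0.
by split; apply: mulr_ge0 => //; first [exact: mulr_ge0|exact: sqr_ge0].
Qed.

Let S11_sum : xi1 p + xi12 p pi12 + xi22 p pi12 + eta12 p pi12 + eta22 p pi12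
  = 2 * (lam1 p + lam2 p).
Proof. by rewrite /xi1 /xi12 /xi22 /eta12 /eta22; ring. Qed.

Let lam_gt0 : 0 < 2 * (lam1 p + lam2 p).
Proof. by case: lm0 => *; rewrite mulr_gt0// addr_gt0. Qed.

Lemma S11_sqr : S11 p pi12 ^+ 2
  = xi1 p + xi12 p pi12 + xi22 p pi12 + eta12 p pi12 + eta22 p pi12.
Proof. by rewrite sqr_sqrtr// S11_sum ltW. Qed.

Lemma S11_sqr_lam : S11 p pi12 ^+ 2 = 2 * (lam1 p + lam2 p).
Proof. by rewrite S11_sqr S11_sum. Qed.

Lemma S11_gt0 : 0 < S11 p pi12.
Proof. by rewrite sqrtr_gt0 S11_sum. Qed.

Lemma xi4E : xi4 p pi12 = 2 * mu12 p * mu22 p * z * (m2 p - z)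
                   / (mu12 p * z + (m2 p - z) * mu22 p).
Proof.
rewrite [(m2 p - z) * mu22 p]mulrC /xi4 /eta12 /eta22 piE; field.
by rewrite gt_eqF.
Qed.

Lemma xi4_gt0 : 0 < xi4 p pi12.
Proof.
rewrite xi4E divr_gt0//; first by rewrite !mulr_gt0// subr_gt0.
by rewrite [(m2 p - z) * mu22 p]mulrC.
Qed.

Let S22_sum : 0 < xi2 p sig2 + xi4 p pi12.
Proof. by rewrite ltr_wpDl ?xi4_gt0//; case: rates_ge0. Qed.

Lemma S22_sqr : S22 p pi12 sig2 ^+ 2 = xi2 p sig2 + xi4 p pi12.
Proof. by rewrite sqr_sqrtr// ltW. Qed.

Lemma S22_gt0 : 0 < S22 p pi12 sig2.
Proof. by rewrite sqrtr_gt0. Qed.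

Lemma calZ1E : calZ1 p pi12 = z * (1 - z / m2 p).
Proof.
rewrite /calZ1 xi4E ltr0_norm ?M22_lt0// /M22 [(m2 p - z) * mu22 p]mulrC.
by field; rewrite ?(gt_eqF D_gt0) ?gt_eqF// !mulr_gt0.
Qed.

Lemma lyapunov :
  [/\ 2 * (M11 p * (calQ1 p pi12 + calQ2 p pi12 sig2) + M12 p * covQZ p pi12 sig2)
        = - S11 p pi12 ^+ 2,
      (M11 p + M22 p) * covQZ p pi12 sig2 + M12 p * varZ p pi12 sig2 = 0
    & 2 * (M22 p * varZ p pi12 sig2) = - S22 p pi12 sig2 ^+ 2].
Proof.
have a0 := M11_lt0; have c0 := M22_lt0; have ac : M11 p + M22 p < 0 by lra.
rewrite /calQ1 /calQ2 /covQZ /xi5 /varZ !ltr0_norm//.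
move: (M11 p) (M22 p) (M12 p) (S11 p pi12) (S22 p pi12 sig2) a0 c0 ac => a c m s1 s2 a0 c0 ac.
have [an cn acn] : [/\ a != 0, c != 0 & a + c != 0] by rewrite !lt_eqF.
by split; field; rewrite ?an ?cn ?acn.
Qed.

End Coefficients.

Section TimeChanges.
Context {R : realType}.

Lemma Rintegral_eq_cst (f : R -> R) (c t : R) : 0 <= t ->
  (forall s, 0 <= s <= t -> f s = c) ->
  \int[lebesgue_measure]_(s in `[0, t]) f s = c * t.
Proof.
move=> t0 fc; rewrite (@eq_Rintegral _ _ _ _ _ (cst c)); last first.
  by move=> s; rewrite inE/= in_itv/= => /fc.
rewrite Rintegral_cst//.
rewrite [X in fine X]lebesgue_measure_itv/= lte_fin; congr (c * _); case: ltP => /= t0'; first by rewrite subr0.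
by apply/le_anti; rewrite t0 t0'.
Qed.

Lemma occupation_variance_ge0 (S : choiceType) (jumps : S -> seq (R * S))
    (nu : S -> R) (U : pred S) (v : R) :
  occupation_variance jumps nu U v -> 0 <= v.
Proof.
move=> [d [Om [P [X [_ _ cv]]]]].
rewrite -lee_fin; apply: (cvge_to_ge cv); near=> t.
rewrite mule_ge0 ?variance_ge0// lee_fin invr_ge0.
by near: t; apply: nbhs_pinfty_ge; exact: num_real.
Unshelve. all: by end_near. Qed.

End TimeChanges.

(** * Two Brownian motions from six *)

Section SixBrownianMotions.
Context {R : realType} {d : measure_display} {Om : measurableType d}.
Variable P : probability Om R.

(** With weights given by the speeds of the six processes, the two coefficient
    vectors are normalized, and they are orthogonal because c12 = c22. *)
Lemma six_noises (F0 : set (set Om)) (B1 B12 B22 B13 B23 B2 : R -> Om -> R)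
    (c1 c12 c22 c13 c23 c2 s1 s2 : R) :
  pi_system F0 ->
  [/\ standard_brownian P B1, standard_brownian P B12 & standard_brownian P B22] /\
  [/\ standard_brownian P B13, standard_brownian P B23 & standard_brownian P B2] ->
  mutually_independent P [:: F0; process_sigma B1; process_sigma B12;
    process_sigma B22; process_sigma B13; process_sigma B23; process_sigma B2] ->
  [/\ 0 <= c1, 0 <= c12 & 0 <= c22] /\ [/\ 0 <= c13, 0 <= c23 & 0 <= c2] ->
  0 < s1 -> 0 < s2 -> s1 ^+ 2 = c1 + c13 + c23 + c12 + c22 ->
  s2 ^+ 2 = c2 + (c12 + c22) -> c12 = c22 ->
  exists W1 W2 : R -> Om -> R,
    [/\ standard_brownian P W1, standard_brownian P W2,
        mutually_independent P [:: F0; process_sigma W1; process_sigma W2] &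
        forall t w,
          s1 * W1 t w = B1 (c1 * t) w - B12 (c12 * t) w - B13 (c13 * t) w
            - B22 (c22 * t) w - B23 (c23 * t) w /\
          s2 * W2 t w = - B12 (c12 * t) w + B22 (c22 * t) w + B2 (c2 * t) w].
Proof.
move=> piF0 [[b1 b12 b22] [b13 b23 b2]] ind [[c10 c120 c220] [c130 c230 c20]] s10 s20 s1E s2E cE.
pose Bs := [:: B1; B12; B22; B13; B23; B2]; pose cs := [:: c1; c12; c22; c13; c23; c2].
pose B (j : 'I_6) := nth B1 Bs j; pose c (j : 'I_6) := nth 0 cs j.
have bB j : standard_brownian P (B j).
  by rewrite /B; case: j => [[|[|[|[|[|[|//]]]]]] /= _].
have c0 j : 0 <= c j by rewrite /c; case: j => [[|[|[|[|[|[|//]]]]]] /= _].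
have iB : indep P (fun o : option 'I_6 => if o is Some j then process_sigma (B j) else F0).
  move/mutually_independentP : ind; set L := [:: F0; _; _; _; _; _; _] => ind.
  pose h (o : option 'I_6) : 'I_7 := if o is Some j then lift ord0 j else ord0.
  have hi : injective h.
    by move=> [i|] [j|] //= /lift_inj ->.
  have LE (o : option 'I_6) : nth set0 L (h o) =
      if o is Some j then process_sigma (B j) else F0.
    by case: o => [[[|[|[|[|[|[|//]]]]]] j6]|].
  have piL (i : 'I_7) : pi_system (nth set0 L i).
    case: (unliftP ord0 i) => [j|] ->; last exact: piF0.
    rewrite (LE (Some j)); apply: process_sigma_pi; by case: (bB j).
  by have := indep_inj hi piL ind; apply: indep_sub => o; rewrite LE.
have sn1 : s1 != 0 by rewrite gt_eqF. 
have sn2 : s2 != 0 by rewrite gt_eqF.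
pose a1 (j : 'I_6) := s1^-1 * nth 0 [:: 1; -1; -1; -1; -1; 0] j.
pose a2 (j : 'I_6) := s2^-1 * nth 0 [:: 0; -1; 1; 0; 0; 1] j.
have sumE (F : 'I_6 -> R) : \sum_j F j = F (inord 0) + F (inord 1) + F (inord 2)
    + F (inord 3) + F (inord 4) + F (inord 5).
  rewrite !big_ord_recl big_ord0 addr0 !addrA.
  by congr (F _ + F _ + F _ + F _ + F _ + F _); apply: val_inj; rewrite /= inordK.
have n1 : \sum_j a1 j ^+ 2 * c j = 1.
  rewrite sumE /a1 /c !inordK//=.
  transitivity (s1^-1 ^+ 2 * (c1 + c13 + c23 + c12 + c22)); first by ring.
  by rewrite -s1E exprVn mulVf// expf_neq0.
have n2 : \sum_j a2 j ^+ 2 * c j = 1.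
  rewrite sumE /a2 /c !inordK//=.
  transitivity (s2^-1 ^+ 2 * (c2 + (c12 + c22))); first by ring.
  by rewrite -s2E exprVn mulVf// expf_neq0.
have n12 : \sum_j a1 j * a2 j * c j = 0.
  by rewrite sumE /a1 /a2 /c !inordK//= cE; ring.
exists (mix B c a1), (mix B c a2); split.
- exact: (mix_brownian bB c0 piF0 iB n1).
- exact: (mix_brownian bB c0 piF0 iB n2).
- exact: (mix_indep bB c0 piF0 iB n12).
move=> t w; rewrite /mix !sumE /a1 /a2 /B /c !inordK//=.
by split; field.
Qed.

End SixBrownianMotions.

(** * The diffusion limit at the stationary point *)

Lemma Rintegral_lin {R : realType} (f g : R -> R) (a b t : R) : cadlag f -> cadlag g ->
  0 <= t -> \int[lebesgue_measure]_(s in `[0, t]) (a * f s + b * g s) =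
  a * \int[lebesgue_measure]_(s in `[0, t]) f s
  + b * \int[lebesgue_measure]_(s in `[0, t]) g s.
Proof.
move=> cf cg t0; pose leb := @lebesgue_measure R.
have mI : measurable (`[0, t]%classic : set (measurableTypeR R)) by exact: measurable_itv.
have ci (h : R -> R) c : cadlag h -> leb.-integrable `[0, t] (EFin \o (fun s => c * h s)).
  move=> ch; apply: cadlag_integrable => //.
  have := cadlag_lin c 0 ch ch; congr cadlag; apply/funext => s.
  by rewrite mul0r addr0.
have If := cadlag_integrable cf (lexx 0) t0; have Ig := cadlag_integrable cg (lexx 0) t0.
rewrite (RintegralD mI (ci f a cf) (ci g b cg)).
by rewrite (RintegralZl _ _ If)// (RintegralZl _ _ Ig).
Qed.

Lemma mul_mx2_col2 {R : realType} (a b c d u v : R) :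
  mx2 a b c d *m col2 u v = col2 (a * u + b * v) (c * u + d * v).
Proof.
apply/matrixP => i j; rewrite !mxE !big_ord_recl big_ord0 !mxE /= addr0.
by case: ifP.
Qed.

Unset Implicit Arguments.
Set Strict Implicit.

Theorem corollary1 (R : realType)
  (* primitive data and the sequence of X models *)
  (p : xparams R) (sy : nat -> xsystem R)
  (dn : nat -> measure_display) (On : forall n, measurableType (dn n))
  (Pn : forall n, probability (On n) R)
  (X : forall n, R -> On n -> xstate)
  (c : nat -> R)
  (hrates : rates_positive p)
  (hsys : forall n, (0 < n)%N -> system_positive (sy n))
  (hmodel : forall n, (0 < n)%N -> xmodel p (sy n) (Pn n) (X n))
  (* stationary laws and asymptotic variances of the fast-time-scale process *)
  (nu : fstate R -> int -> R) (sig2 : fstate R -> R)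
  (hnu : forall g, bbA p g -> stationary_law (ftsp_jumps p g) (nu g))
  (hsig2 : forall g, bbA p g -> ftsp_variance p nu g (sig2 g))
  (* the fluid limit *)
  (x : R -> fstate R)
  (hx : fluid_solution p (ftsp_pi nu) (x 0) x)
  (hx_unique : forall y : R -> fstate R,
     fluid_solution p (ftsp_pi nu) (x 0) y -> assumption6 p y ->
     forall t : R, 0 <= t -> y t = x t)
  (* the limit process *)
  (d : measure_display) (Om : measurableType d) (P : probability Om R)
  (B1 B12 B22 B13 B23 B2 : R -> Om -> R) (Q Z : R -> Om -> R)
  (A1 : assumption1 p sy) (A2 : assumption2 p) (A3 : assumption3 sy c)
  (A4 : assumption4 p) (A5 : assumption5 p sy Pn X c (x 0) P)
  (A6 : assumption6 p x)
  (hB : [/\ standard_brownian P B1, standard_brownian P B12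
          & standard_brownian P B22] /\
        [/\ standard_brownian P B13, standard_brownian P B23
          & standard_brownian P B2])
  (hindep : mutually_independent P
     [:: pair_sigma (Q 0) (Z 0); process_sigma B1; process_sigma B12;
         process_sigma B22; process_sigma B13; process_sigma B23;
         process_sigma B2])
  (hmeas : forall t : R, 0 <= t ->
     measurable_fun setT (Q t) /\ measurable_fun setT (Z t))
  (hpaths : forall w, cadlag (fun t => Q t w) /\ cadlag (fun t => Z t w))
  (heq : limit_equations p (ftsp_pi nu) sig2 x P B1 B12 B22 B13 B23 B2 Q Z)
  (hlim : cvg_law_for bounded_J1_continuous2 \oo Pn
     (fun n w => (fun t => hatQs X x n t w, fun t => hatZ X x n t w))
     P (fun w => (fun t => Q t w, fun t => Z t w)))
  (hinit : cvg_law_for (@bounded_continuous R (R * R)%type) \oo Pn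
     (fun n w => (hatQs X x n 0 w, hatZ X x n 0 w))
     P (fun w => (Q 0 w, Z 0 w)))
  (hstat : x 0 = xstar p) :
  let pi12 := ftsp_pi nu in
  let zs := zstar p in
  let Xhat := fun t w => col2 (Q t w) (Z t w) in
  (* x is stationary and the time changes are linear *)
  (forall t : R, 0 <= t ->
    [/\ x t = xstar p,
        gamma1 p x t = xi1 p * t,
        gamma2 p sig2 x t = xi2 p sig2 * t
      & gamma3 sig2 x t = xi3 p sig2 * t] /\
    [/\ gamma12 p pi12 x t = xi12 p pi12 * t,
        gamma22 p pi12 x t = xi22 p pi12 * t,
        phi12 p pi12 x t = eta12 p pi12 * t
      & phi22 p pi12 x t = eta22 p pi12 * t])
  /\
  (* the coefficients *)
  [/\ M22 p < 0,
      S11 p pi12 ^+ 2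
        = xi1 p + xi12 p pi12 + xi22 p pi12 + eta12 p pi12 + eta22 p pi12
      /\ S11 p pi12 ^+ 2 = 2 * (lam1 p + lam2 p),
      S12 p pi12 = 0 /\ S21 p pi12 = 0,
      S22 p pi12 sig2 ^+ 2 = xi2 p sig2 + xi4 p pi12
    & xi4 p pi12 = 2 * mu12 p * mu22 p * zs * (m2 p - zs)
                   / (mu12 p * zs + (m2 p - zs) * mu22 p)]
  /\
  (* the stochastic differential equation *)
  (exists W1 W2 : R -> Om -> R,
    [/\ standard_brownian P W1, standard_brownian P W2,
        mutually_independent P
          [:: pair_sigma (Q 0) (Z 0); process_sigma W1; process_sigma W2]
      & linear_sde P (calM p) (calS p pi12 sig2) Xhat
          (fun t w => col2 (W1 t w) (W2 t w))])
  /\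
  (* normality of the one-dimensional marginals: the part of X(t) driven by the
     noise is centered normal and independent of X(0), and X(t) itself is
     centered normal when X(0) is *)
  (exists Phi : R -> 'M[R]_2,
    [/\ Phi 0 = 1%:M,
        (forall (t : R) i j,
           is_derive t 1 (fun s : R => Phi s i j) ((calM p *m Phi t) i j))
      & forall t : R, 0 <= t ->
          let N := fun w => Xhat t w - Phi t *m Xhat 0 w in
          centered_binormal P (fun w => N w ord0 0) (fun w => N w ord_max 0) /\
          mutually_independent P
            [:: pair_sigma (Q 0) (Z 0);
                pair_sigma (fun w => N w ord0 0) (fun w => N w ord_max 0)] ])
  /\
  (centered_binormal P (Q 0) (Z 0) ->
     forall t : R, 0 <= t -> centered_binormal P (Q t) (Z t))
  /\
  (* the steady state: the weak limit of X(t) as t tends to infinity *)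
  (let steady (ninf : probability (R * R)%type R) :=
     cvg_law_for (@bounded_continuous R (R * R)%type) (pinfty_nbhs R)
       (fun _ : R => P) (fun t w => (Q t w, Z t w)) ninf id in
   (exists ninf, steady ninf) /\
   forall ninf, steady ninf ->
     [/\ centered_binormal ninf fst snd,
         ('V_ninf[fst] = (calQ1 p pi12 + calQ2 p pi12 sig2)%:E)%E,
         ('V_ninf[snd] = (varZ p pi12 sig2)%:E)%E
       & covariance ninf fst snd = (covQZ p pi12 sig2)%:E])
  /\
  [/\ calQ1 p pi12 = (lam1 p + lam2 p) / (p1 p * th1 p + p2 p * th2 p),
      calQ2 p pi12 sig2
        = (mu22 p - mu12 p) * covQZ p pi12 sig2 / (p1 p * th1 p + p2 p * th2 p),
      varZ p pi12 sig2 = calZ1 p pi12 + calZ2 p sig2,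
      calZ1 p pi12 = zs * (1 - zs / m2 p)
    & calZ2 p sig2
        = psi p (xstar p) ^+ 2 * sig2 (xstar p) / (2 * `|M22 p|)].
Proof.
move=> pi12 zs Xhat.
have [lm0 _] := A1; have [r0 _ _] := A4.
have gA : bbA p (xstar p) by rewrite -hstat; exact: A6 _ (lexx 0).
have snu := hnu _ gA.
have sig2_ge0 : 0 <= sig2 (xstar p) := occupation_variance_ge0 (hsig2 _ gA).
have piB := pi_balance hrates lm0 r0 gA snu.
have xE t : 0 <= t -> x t = xstar p.
  move=> t0; rewrite -(hx_unique (fun=> xstar p))//.
  have t1 := th1q1 hrates; have t2 := th2q2 hrates.
  (* xstar is a rest point of the fluid equation *)
  rewrite hstat; split=> //; split.
    by split; apply: continuous_subspaceT => s; exact: cvg_cst.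
  move=> s _; rewrite /fq1 /fq2 /fz /=; split; apply: is_derive_eq; lra.
have I_cst (f : fstate R -> R) t : 0 <= t ->
    \int[lebesgue_measure]_(s in `[0, t]) f (x s) = f (xstar p) * t.
  by move=> t0; apply: Rintegral_eq_cst => // s /andP[s0 _]; rewrite xE.
have g1 t : 0 <= t -> gamma1 p x t = xi1 p * t.
  move=> t0; rewrite /gamma1 (I_cst (@fqs R))// (xi1_gamma hrates r0 gA); ring.
have g2 t : 0 <= t -> gamma2 p sig2 x t = xi2 p sig2 * t.
  by move=> t0; rewrite /gamma2 (I_cst (fun y => psi p y ^+ 2 * sig2 y)).
have g3 t : 0 <= t -> gamma3 sig2 x t = xi3 p sig2 * t.
  by move=> t0; rewrite /gamma3 (I_cst sig2).
have g12 t : 0 <= t -> gamma12 p pi12 x t = xi12 p pi12 * t.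
  by move=> t0; rewrite /gamma12 (I_cst (fun y => pi12 y * fz y))// !mulrA.
have g22 t : 0 <= t -> gamma22 p pi12 x t = xi22 p pi12 * t.
  by move=> t0; rewrite /gamma22 (I_cst (fun y => (1 - pi12 y) * (m2 p - fz y)))// !mulrA.
have f12 t : 0 <= t -> phi12 p pi12 x t = eta12 p pi12 * t.
  by move=> t0; rewrite /phi12 (I_cst (fun y => (1 - pi12 y) * fz y))// !mulrA.
have f22 t : 0 <= t -> phi22 p pi12 x t = eta22 p pi12 * t.
  by move=> t0; rewrite /phi22 (I_cst (fun y => pi12 y * (m2 p - fz y)))// !mulrA.
have M11n := M11_lt0 hrates r0.
have M22n := M22_lt0 hrates lm0 A2 r0 gA snu.
have M22d := M22_drift hrates lm0 A2 r0 gA snu.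
have etaE := eta_balance hrates lm0 r0 gA snu.
have S11s := S11_sqr nu lm0.
have S11p := S11_gt0 nu lm0.
have S22s := S22_sqr hrates lm0 A2 r0 gA snu sig2_ge0.
have S22p := S22_gt0 hrates lm0 A2 r0 gA snu sig2_ge0.
have [x12 x22 e12 e22 x2] := rates_ge0 hrates lm0 A2 r0 gA snu sig2_ge0.
have [l1 l2 l3] := lyapunov sig2 hrates lm0 A2 r0 gA snu.
have [mQ0 mZ0] := hmeas _ (lexx 0).
have piF0 : pi_system (pair_sigma (Q 0) (Z 0)).
  apply: sigma_pi_system => _ [D mD [->|->]]; rewrite -[X in measurable X]setTI.
    exact: mQ0.
  exact: mZ0.
have [W1 [W2 [bW1 bW2 iW WE]]] := six_noises piF0 hB hindep
  (conj (And3 (xi1_ge0 hrates lm0 r0 gA) e12 e22) (And3 x12 x22 x2)) S11p S22p S11s S22s etaE.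
have sde : {ae P, forall w t, 0 <= t ->
    Q t w = Q 0 w + \int[lebesgue_measure]_(s in `[0, t]) (M11 p * Q s w + M12 p * Z s w)
      + S11 p pi12 * W1 t w /\
    Z t w = Z 0 w + \int[lebesgue_measure]_(s in `[0, t]) (M22 p * Z s w)
      + S22 p pi12 sig2 * W2 t w}.
  apply: filterS heq => w Ew t t0; have [EQ EZ] := Ew t t0.
  have [cQ cZ] := hpaths w.
  have [-> ->] := WE t w.
  have -> : \int[lebesgue_measure]_(s in `[0, t]) (M22 p * Z s w) =
      - \int[lebesgue_measure]_(s in `[0, t])
          (((mu22 p - mu12 p) * pi12 (x s) + mu12 p) * Z s w).
    have -> : \int[lebesgue_measure]_(s in `[0, t])
        (((mu22 p - mu12 p) * pi12 (x s) + mu12 p) * Z s w) =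
        \int[lebesgue_measure]_(s in `[0, t]) (- M22 p * Z s w + 0 * Z s w).
      apply: eq_Rintegral => s; rewrite inE/= in_itv/= => /andP[s0 _].
      by rewrite xE// M22d opprK mul0r addr0.
    have -> : \int[lebesgue_measure]_(s in `[0, t]) (M22 p * Z s w) =
        \int[lebesgue_measure]_(s in `[0, t]) (M22 p * Z s w + 0 * Z s w).
      by apply: eq_Rintegral => s _; rewrite mul0r addr0.
    by rewrite !Rintegral_lin// !mul0r !addr0 mulNr opprK.
  rewrite EQ EZ Rintegral_lin// (g1 _ t0) (g12 _ t0) (g22 _ t0) (f12 _ t0) (f22 _ t0) (g2 _ t0).
  by rewrite /M11 /M12; split; ring.
split.
  by move=> t t0; split; [split; [exact: xE|exact: g1|exact: g2|exact: g3]
    |split; [exact: g12|exact: g22|exact: f12|exact: f22]].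
split.
  split; [exact: M22n | | | exact: S22s | exact: xi4E hrates lm0 A2 r0 gA snu].
  - by split=> //; exact: S11_sqr_lam.
  - by rewrite /S12 /S21 etaE subrr.
have [e1 [e2 [k [flow comm lt1 [ce1 ce2 ck]]]]] := flow_exists (M12 p) M11n M22n.
have S22n : S22 p pi12 sig2 != 0 by rewrite gt_eqF.
split.
  exists W1, W2; split; [exact: bW1|exact: bW2|exact: iW|].
  apply: filterS sde => w Ew t t0 i; have [EQ EZ] := Ew t t0.
  rewrite /Xhat /calM /calS mul_mx2_col2.
  under eq_Rintegral do rewrite mul_mx2_col2.
  rewrite !mxE; case: ifP => i0.
    rewrite /S12 etaE subrr mul0r addr0 EQ; congr (_ + _ + _).
    by apply: eq_Rintegral => s _; rewrite mxE i0.
  rewrite /S21 etaE subrr mul0r add0r EZ; congr (_ + _ + _).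
  by apply: eq_Rintegral => s _; rewrite mxE i0 /M21 mul0r add0r.
split.
  exists (fun t => mx2 (e1 t) (k t) 0 (e2 t)); split.
  - case: flow => _ [[e10 e20 k0] _]; apply/matrixP => i j; rewrite !mxE e10 e20 k0.
    by case: i => [[|[|//]] i2]; case: j => [[|[|//]] j2].
  - case: flow => _ [_ [de1 de2 dk]] t i j.
    rewrite mxE !big_ord_recl big_ord0 !mxE /= addr0.
    case: i => [[|[|//]] i2]; case: j => [[|[|//]] j2] /=.
    + rewrite (_ : (fun s => _) = e1); last by apply/funext => s; rewrite mxE.
      by rewrite mulr0 addr0.
    + rewrite (_ : (fun s => _) = k); last by apply/funext => s; rewrite mxE.
      exact: dk.
    + rewrite (_ : (fun s => _) = fun=> 0); last by apply/funext => s; rewrite mxE.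
      by rewrite /M21 mul0r mulr0 addr0; exact: is_derive_cst.
    + rewrite (_ : (fun s => _) = e2); last by apply/funext => s; rewrite mxE.
      by rewrite /M21 mul0r add0r.
  - move=> t t0 N.
    have N0 : (fun w => N w ord0 ord0) = noiseQ Q Z e1 k t.
      by apply/funext => w; rewrite /N /Xhat mul_mx2_col2 !mxE.
    have N1 : (fun w => N w ord_max ord0) = noiseZ Z e2 t.
      by apply/funext => w; rewrite /N /Xhat mul_mx2_col2 !mxE /= mul0r add0r.
    rewrite N0 N1; split.
      exact: (noise_normal M22n S22n flow comm lt1 l1 l2 l3 bW1 bW2 iW hmeas hpaths sde t0).
    exact: (noise_independent M22n S22n flow comm lt1 l1 l2 l3 bW1 bW2 iW hmeas hpaths sde t0).
split.
  exact: (marginal_normal M22n S22n flow comm lt1 l1 l2 l3 bW1 bW2 iW hmeas hpaths sde).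
split.
  split.
    exists (steady_law (calQ1 p pi12 + calQ2 p pi12 sig2) (covQZ p pi12 sig2) (varZ p pi12 sig2)).
    exact: (steady_cvg M22n S22n flow comm lt1 ce1 ce2 ck l1 l2 l3 bW1 bW2 iW hmeas hpaths sde).
  exact: (steady_unique M11n M22n S22n flow comm lt1 ce1 ce2 ck l1 l2 l3 bW1 bW2 iW hmeas hpaths sde).
have M11a : `|M11 p| = p1 p * th1 p + p2 p * th2 p by rewrite ltr0_norm// opprK.
split.
- by rewrite /calQ1 M11a (S11_sqr_lam nu lm0); field; rewrite -M11a normr_eq0 lt_eqF.
- by rewrite /calQ2 M11a /M12.
- by rewrite /varZ S22s mulrDl addrC.
- exact: calZ1E hrates lm0 A2 r0 gA snu.
- by [].
Qed.
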